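(* Let $(v,q)$ be a suitable weak solution to the Navier-Stokes equations in $Q$. Suppose that for some $0<m<1$, with $m_1=2m-1$, $$M_1=\sup_{0<r<1}\{A_{m_1}(v,r)+E_m(v,r)+D_m(q,r)\}<\infty .$$ Let $s>1$ and $l>1$ be numbers satisfying $$l>\kappa:=l\Big(\frac 3s+\frac 2l-1\Big)>0,$$ and assume further that $$s<p(\eta),\qquad l<q(\eta)$$ for some parameter $0\le\eta\le 1$, where $$\frac1{p(\eta)}=\frac{\eta}{6}+\frac{3(1-\eta)}{10},\qquad \frac1{q(\eta)}=\frac{\eta}{2}+\frac{3(1-\eta)}{10}.$$ Put $\alpha=2-m$ and suppose that $$0<m_0<f(m):=\frac{\frac{3(\alpha-1)}{2}\Big(1-\frac{s}{p(\eta)}\Big)\frac ls-\Big(\alpha l-\frac{3l}{s}-\alpha-1\Big)}{\frac{\alpha+1}{2}\,\kappa}.$$ Then $$\lim_{r\to0}M^{s,l}_{\kappa,m_0}(v,r)=0 .$$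
   Context: Notation: $B(r)\subset\mathbb R^3$ is the ball of radius $r$ centred at the origin, $Q(r)=B(r)\times]-r^2,0[$, $B=B(1)$, $Q=Q(1)$; points are $z=(x,t)$ and $dz=dx\,dt$. Suitable weak solution: a pair $(v,q)$ ($v$ an $\mathbb R^3$-valued velocity, $q$ a scalar pressure) is a suitable weak solution to the Navier-Stokes equations in $Q$ if (1) $v\in L_\infty(-1,0;L_2(B))$, $\nabla v\in L_2(Q)$, $q\in L_{3/2}(Q)$; (2) $\partial_tv+v\cdot\nabla v-\Delta v+\nabla q=0$ and $\mathrm{div}\,v=0$ in $Q$ in the sense of distributions; (3) for a.a. $t\in]-1,0[$ the local energy inequality $$\int_B\varphi(x,t)|v(x,t)|^2dx+2\int_{-1}^t\int_B\varphi|\nabla v|^2dxd\tau\le\int_{-1}^t\int_B\big(|v|^2(\partial_t\varphi+\Delta\varphi)+v\cdot\nabla\varphi(|v|^2+2q)\big)dxd\tau$$ holds for all smooth non-negative functions $\varphi$ vanishing in a vicinity of the parabolic boundary of $Q$. Quantities: $$E_m(v,r)=\frac1{r^m}\int_{Q(r)}|\nabla v|^2dz,\qquad A_{m_1}(v,r)=\sup_{-r^2<t<0}\frac1{r^{m_1}}\int_{B(r)}|v(x,t)|^2dx,\qquad D_m(q,r)=\frac1{r^{2m}}\int_{Q(r)}|q|^{3/2}dz,$$ $$M^{s,l}_\kappa(v,a)=\frac1{a^\kappa}\int_{-a^2}^0\Big(\int_{B(a)}|v|^sdx\Big)^{l/s}dt,\qquad M^{s,l}_{\kappa,m_0}(v,a)=a^{\kappa(1-m_0)}M^{s,l}_\kappa(v,a).$$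 (The letter $q$ denotes the pressure, whereas $q(\eta)$ denotes the number defined in the statement.) *)

(* Defs.v *)
From mathcomp Require Import all_boot all_order all_algebra.
From mathcomp Require Import all_classical all_reals all_analysis.
From mathcomp Require Import ess_sup_inf.

Set Implicit Arguments.
Unset Strict Implicit.
Unset Printing Implicit Defensive.

Import Order.TTheory GRing.Theory Num.Theory.
Import numFieldNormedType.Exports.

Local Open Scope classical_set_scope.
Local Open Scope ring_scope.

(** R^3 is [R * R * R] and a space-time point is [z = (x, t)]; this is where the
    library provides product Lebesgue measure. The norm carried by product types
    in the library is the sup norm, so the Euclidean one is [enorm] below. *)
Notation space3 R := (R * R * R)%type.
Notation spacetime R := (R * R * R * R)%type.

Section Geometry.
Context {R : realType}.
Local Notation mR1 := (measurableTypeR R).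
Local Notation mR3 := (mR1 * mR1 * mR1)%type.
Local Notation mR4 := (mR3 * mR1)%type.
Implicit Types (x y : space3 R) (z : spacetime R) (r : R) (i j : 'I_3).

Definition coord x i : R :=
  match val i with 0%N => x.1.1 | 1%N => x.1.2 | _ => x.2 end.

Definition dotp x y : R := \sum_(i < 3) coord x i * coord y i.

Definition enorm x : R := Num.sqrt (dotp x x).

Definition ball3 r : set (space3 R) := [set x | enorm x < r].

Definition pcyl r : set (spacetime R) := ball3 r `*` `]- r ^+ 2, 0[%classic.

Definition pboundary : set (spacetime R) :=
  [set z | enorm z.1 = 1 /\ -1 <= z.2 <= 0] `|`
  [set z | enorm z.1 <= 1 /\ z.2 = -1].

Definition leb1 : {measure set mR1 -> \bar R} := lebesgue_measure.
Definition leb3 : {measure set mR3 -> \bar R} :=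
  ((lebesgue_measure \x lebesgue_measure) \x lebesgue_measure)%E.
Definition leb4 : {measure set mR4 -> \bar R} :=
  (((lebesgue_measure \x lebesgue_measure) \x lebesgue_measure)
   \x lebesgue_measure)%E.

Definition ess_sup_itv (a b : R) (f : R -> \bar R) : \bar R :=
  ess_sup (mrestr leb1 (measurable_itv `]a, b[)) f.

End Geometry.

Section Calculus.
Context {R : realType}.
Implicit Types (f : spacetime R -> R) (i : 'I_3).

Definition xdir i : spacetime R :=
  (((val i == 0%N)%:R, (val i == 1%N)%:R, (val i == 2%N)%:R), 0).
Definition tdir : spacetime R := (0, 1).

Definition dx i f : spacetime R -> R := 'D_(xdir i) f.
Definition dt f : spacetime R -> R := 'D_tdir f.
Definition dotgrad (x : space3 R) f (z : spacetime R) : R :=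
  \sum_(i < 3) coord x i * dx i f z.
Definition laplx f (z : spacetime R) : R := \sum_(i < 3) dx i (dx i f) z.

Fixpoint Ck (k : nat) f : Prop :=
  continuous f /\
  if k is k'.+1 then
    [/\ (forall i z, derivable f z (xdir i)), (forall z, derivable f z tdir),
        (forall i, Ck k' (dx i f)) & Ck k' (dt f)]
  else True.

Definition smooth f := forall k, Ck k f.

Definition test_function (D : set (spacetime R)) f :=
  smooth f /\
  exists K, [/\ compact K, K `<=` D & forall z, ~ K z -> f z = 0].

End Calculus.

Section NavierStokes.
Context {R : realType}.
Implicit Types (v : spacetime R -> space3 R) (Dv : spacetime R -> 'M[R]_3)
  (q : spacetime R -> R) (phi : spacetime R -> R).

Local Notation Q := (pcyl (1 : R)).
Local Notation mR1 := (measurableTypeR R).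
Local Notation mQ := (Q : set (mR1 * mR1 * mR1 * mR1)).
Local Notation B := (ball3 (1 : R)).

Definition mxnorm2 (A : 'M[R]_3) : R := \sum_(i < 3) \sum_(j < 3) A i j ^+ 2.

(** [Dv] is the spatial gradient of [v] in the sense of distributions in Q,
    [Dv z i j] being the derivative of the i-th component in the direction j. *)
Definition weak_gradient v Dv :=
  forall (i j : 'I_3) phi, test_function Q phi ->
    (\int[leb4]_(z in Q) (coord (v z) i * dx j phi z)%:E =
     - \int[leb4]_(z in Q) (Dv z i j * phi z)%:E)%E.

Definition energy_class v Dv q :=
  [/\ measurable_fun mQ v,
      (ess_sup_itv (-1) 0
         (fun t => \int[leb3]_(x in B) (enorm (v (x, t)) ^+ 2)%:E) < +oo)%E,
      (forall i j, measurable_fun mQ (fun z => Dv z i j)) /\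
      (\int[leb4]_(z in Q) (mxnorm2 (Dv z))%:E < +oo)%E &
      measurable_fun mQ q /\
      (\int[leb4]_(z in Q) (`|q z| `^ (3 / 2))%:E < +oo)%E].

(** The i-th component of
      dt v + v . grad v - laplacian v + grad q = 0,
    tested against [phi]; the nonlinear term is the function
    (v . grad v)_i = sum_j v_j d_j v_i, which is integrable on Q. *)
Definition momentum_equation v Dv q :=
  forall (i : 'I_3) phi, test_function Q phi ->
    (\int[leb4]_(z in Q)
       (- (coord (v z) i * dt phi z)
        + (\sum_(j < 3) coord (v z) j * Dv z i j) * phi z
        - coord (v z) i * laplx phi z
        - q z * dx i phi z)%:E = 0)%E.

Definition divergence_free v :=
  forall phi, test_function Q phi ->
    (\int[leb4]_(z in Q) (dotgrad (v z) phi z)%:E = 0)%E.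

(** Test functions of the local energy inequality need not vanish near t = 0. *)
Definition energy_test_function phi :=
  [/\ smooth phi, (forall z, Q z -> 0 <= phi z) &
      exists U, [/\ open U, pboundary `<=` U &
                    forall z, U z -> Q z -> phi z = 0]].

Definition local_energy_inequality v Dv q :=
  {ae leb1, forall t : R, -1 < t < 0 ->
    forall phi, energy_test_function phi ->
    (\int[leb3]_(x in B) (phi (x, t) * enorm (v (x, t)) ^+ 2)%:E
     + 2%:E * \int[leb1]_(tau in `](-1)%R, t[)
         \int[leb3]_(x in B) (phi (x, tau) * mxnorm2 (Dv (x, tau)))%:E
     <= \int[leb1]_(tau in `](-1)%R, t[)
         \int[leb3]_(x in B)
           (enorm (v (x, tau)) ^+ 2 * (dt phi (x, tau) + laplx phi (x, tau))
            + dotgrad (v (x, tau)) phi (x, tau)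
              * (enorm (v (x, tau)) ^+ 2 + 2 * q (x, tau)))%:E)%E}.

(** The gradient of [v], unique up to null sets, is an explicit argument. *)
Definition suitable_weak_solution v Dv q :=
  [/\ weak_gradient v Dv, energy_class v Dv q,
      momentum_equation v Dv q /\ divergence_free v &
      local_energy_inequality v Dv q].

(** The quantities E_m, A_{m1}, D_m, M^{s,l}_kappa and M^{s,l}_{kappa,m0}. As [v]
    is defined up to null sets, the supremum over time is an essential one. *)
Definition qE (m : R) Dv (r : R) : \bar R :=
  (((r `^ m)^-1)%:E * \int[leb4]_(z in pcyl r) (mxnorm2 (Dv z))%:E)%E.

Definition qA (m1 : R) v (r : R) : \bar R :=
  ess_sup_itv (- r ^+ 2) 0 (fun t =>
    ((r `^ m1)^-1)%:E * \int[leb3]_(x in ball3 r) (enorm (v (x, t)) ^+ 2)%:E)%E.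

Definition qD (m : R) q (r : R) : \bar R :=
  (((r `^ (2 * m))^-1)%:E
   * \int[leb4]_(z in pcyl r) (`|q z| `^ (3 / 2))%:E)%E.

Definition qM (s l kappa : R) v (a : R) : \bar R :=
  (((a `^ kappa)^-1)%:E
   * \int[leb1]_(t in `](- a ^+ 2)%R, 0%R[)
       (\int[leb3]_(x in ball3 a) (enorm (v (x, t)) `^ s)%:E) `^ (l / s))%E.

Definition qM0 (s l kappa m0 : R) v (a : R) : \bar R :=
  ((a `^ (kappa * (1 - m0)))%:E * qM s l kappa v a)%E.

Definition p_eta (eta : R) : R := (eta / 6 + 3 * (1 - eta) / 10)^-1.
Definition q_eta (eta : R) : R := (eta / 2 + 3 * (1 - eta) / 10)^-1.

End NavierStokes.

(* Main.v *)
(* Put alpha = 2 - m and lam = r ^ (2 / (alpha + 1)), so that r <= lam / 2 for small r. For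
   almost every time the Sobolev inequality on the cube inscribed in B(lam) bounds the sixth
   power integral of |v| on B(r) by g(t) ^ 3, where g is a multiple of the sum of the
   integrals over B(lam) of |grad v| ^ 2 and of |v| ^ 2 / lam ^ 2. Interpolate |v| ^ s on B(r)
   between 1, |v| ^ 2 and |v| ^ 6: g then enters the time integral with the power
   tau = l / q(eta) < 1, and Jensen's inequality bounds everything by powers of r. With this
   choice of lam the two terms of g contribute equally, and the resulting exponent of r is
   positive exactly when m0 < f(m).

   The Sobolev inequality for a distributional gradient, at almost every fixed time, is
   obtained from a grid: testing against smooth approximations of the difference of the
   indicators of two neighbouring cells bounds the difference of the averages of v by
   an integral of |grad v|, the averages satisfy a discrete Sobolev inequality, and they
   converge weakly to v as the grid is refined. *)
From HB Require Import structures.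
From mathcomp Require Import all_boot all_order all_algebra.
From mathcomp Require Import ring lra zify finmap ess_sup_inf measurable_realfun.
From mathcomp Require Import all_classical all_reals all_analysis.
Require Import Defs.
Set Implicit Arguments. Unset Strict Implicit. Unset Printing Implicit Defensive.
Import Order.TTheory GRing.Theory Num.Theory.
Import numFieldNormedType.Exports.
Local Open Scope classical_set_scope.
Local Open Scope ring_scope.

(** The gradient is only a distribution on space-time, whereas the decay argument needs a bound on
    the sixth power of v at almost every fixed time. The grid answers this in two ways. Over all
    refinements it has countably many cells, so the estimates between neighbouring cells, each valid
    outside its own null set of times, hold together outside one null set. And each estimate asks
    only for test functions that are products of functions of one variable: the time factor tends to
    the indicator of an arbitrary interval, and Lebesgue's differentiation theorem then frees the
    time.

    Weak convergence of the averages is enough because the limit is tested only against simple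
    functions approximating sign(u) |u| ^ 5; Young's inequality produces 5/6 of the integral to be
    bounded, which is absorbed.

    The number 3/10 is (2/5)/2 + (3/5)/6, the interpolation between the second and the sixth power
    at which the sixth-power term enters the time integral of |v| ^ (10/3) linearly; eta = 1 is the
    sixth power alone. Accordingly a share (2/5)(1 - eta) of the power s is taken from |v| ^ 2 and
    the rest from |v| ^ 6. *)

Local Notation mR1 R := (measurableTypeR R).
Local Notation mR3 R := (measurableTypeR R * measurableTypeR R * measurableTypeR R)%type.
Local Notation mR4 R :=
  (measurableTypeR R * measurableTypeR R * measurableTypeR R * measurableTypeR R)%type.

(** * Discrete Sobolev inequality *)

Section DiscreteSobolev.
Context {R : rcfType}.

Lemma sum_cauchy_schwarz (I : Type) (r : seq I) (P : pred I) (x y : I -> R) :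
  (\sum_(i <- r | P i) x i * y i) ^+ 2
  <= (\sum_(i <- r | P i) x i ^+ 2) * (\sum_(i <- r | P i) y i ^+ 2).
Proof.
elim: r => [|a r IH]; first by rewrite !big_nil expr0n mul0r.
rewrite !big_cons; case: ifP => // _.
have : 0 <= \sum_(i <- r | P i) x i ^+ 2 by apply: sumr_ge0 => i _; exact: sqr_ge0.
have : 0 <= \sum_(i <- r | P i) y i ^+ 2 by apply: sumr_ge0 => i _; exact: sqr_ge0.
move: IH; set X := \sum_(i <- r | P i) x i * y i; set A := \sum_(i <- r | P i) x i ^+ 2.
set B := \sum_(i <- r | P i) y i ^+ 2; move: X A B (x a) (y a) => X A B c d XAB B0 A0.
(* The cross term, by the arithmetic-geometric mean inequality and [X ^+ 2 <= A * B]. *)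
suff : 2 * X * (c * d) <= A * d ^+ 2 + B * c ^+ 2 by nra.
have h : 0 <= A * d ^+ 2 + B * c ^+ 2 by rewrite addr_ge0// mulr_ge0// sqr_ge0.
apply: le_trans (ler_norm _) _; rewrite -(@ler_pXn2r _ 2)// ?nnegrE//.
rewrite real_normK ?num_real//.
have : 0 <= (A * d ^+ 2 - B * c ^+ 2) ^+ 2 by exact: sqr_ge0.
have : X ^+ 2 * (c * d) ^+ 2 <= A * B * (c * d) ^+ 2 by rewrite ler_wpM2r// sqr_ge0.
nra.
Qed.

(** Cauchy-Schwarz over the pairs (j, k) splits off [a]; a second application, over i for each fixed
    pair, separates [b] from [c]. *)
Lemma loomis_whitney (I J K : finType) (a : J -> K -> R) (b : I -> K -> R)
    (c : I -> J -> R) :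
  (\sum_i \sum_j \sum_k a j k * b i k * c i j) ^+ 2
  <= (\sum_j \sum_k a j k ^+ 2) * (\sum_i \sum_k b i k ^+ 2)
     * (\sum_i \sum_j c i j ^+ 2).
Proof.
have -> : \sum_i \sum_j \sum_k a j k * b i k * c i j =
    \sum_(p : J * K) a p.1 p.2 * \sum_i b i p.2 * c i p.1.
  under [RHS]eq_bigr do rewrite mulr_sumr.
  rewrite [RHS]exchange_big; apply: eq_bigr => i _.
  by rewrite pair_big /=; apply: eq_bigr => p _; rewrite mulrA.
apply: le_trans (sum_cauchy_schwarz _ _ _ _) _.
rewrite -mulrA [leRHS]mulrC -(pair_big xpredT xpredT (fun j k => a j k ^+ 2)) /=.
rewrite [leRHS]mulrC ler_wpM2l//.
  by apply: sumr_ge0 => j _; apply: sumr_ge0 => k _; exact: sqr_ge0.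
rewrite [X in X * _]exchange_big [X in _ * X]exchange_big /=.
rewrite -(pair_big xpredT xpredT (fun j k => (\sum_i b i k * c i j) ^+ 2)) /=.
rewrite exchange_big mulr_suml; apply: ler_sum => k _.
rewrite mulr_sumr; apply: ler_sum => j _; exact: sum_cauchy_schwarz.
Qed.

(** [g i] differs from every [g k] by at most the total variation; averaging over k gives the
    bound. *)
Lemma line_sup_le (N : nat) (g : nat -> R) (i : 'I_N) :
  `|g i| <= (\sum_(k < N) `|g k|) / N%:R
            + \sum_(k < N | (k.+1 < N)%N) `|g k.+1 - g k|.
Proof.
set TV := (X in _ <= _ + X).
have N0 : 0 < N%:R :> R by rewrite ltr0n (leq_ltn_trans _ (ltn_ord i)).
have step (a b : nat) : (a <= b < N)%N -> `|g b - g a| <= TV.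
  move=> /andP[ab bN]; rewrite -telescope_sumr//.
  apply: le_trans (ler_norm_sum _ _ _) _.
  rewrite /TV -(big_mkord (fun k => (k.+1 < N)%N) (fun k => `|g k.+1 - g k|)).
  rewrite [in leRHS](big_cat_nat (n := a))//=; last by lia.
  rewrite [X in _ <= _ + X](big_cat_nat (n := b))//=; last by lia.
  rewrite addrCA ler_wpDr//.
    by apply: addr_ge0; apply: sumr_ge0 => *; exact: normr_ge0.
  rewrite big_nat_cond [leRHS]big_nat_cond.
  rewrite le_eqVlt; apply/orP; left; apply/eqP; apply: eq_bigl => k.
  by apply/idP/idP; lia.
have stepP (k : 'I_N) : `|g i| <= `|g k| + TV.
  have : `|g i - g k| <= TV.
    case: (leqP k i) => [ki|/ltnW ki]; last rewrite distrC;
      by apply: step; rewrite ki ltn_ord.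
  have := ler_normD (g i - g k) (g k); rewrite subrK; lra.
rewrite -(@ler_pM2r _ N%:R)// mulrDl divfK ?gt_eqF//.
have := ler_sum (index_enum 'I_N) (P := xpredT) (fun k _ => stepP k).
by rewrite big_split /= !sumr_const card_ord !mulr_natr.
Qed.

Lemma shift_sum_le (N : nat) (g : nat -> R) : (forall k, 0 <= g k) ->
  \sum_(k < N | (k.+1 < N)%N) g k.+1 <= \sum_(k < N) g k.
Proof.
move=> g0; rewrite -(big_mkord xpredT g).
rewrite -(big_mkord (fun k => (k.+1 < N)%N) (fun k => g k.+1)).
case: N => [|N]; first by rewrite !big_nil.
rewrite big_mkcond big_nat_recr//= ltnn addr0 [leRHS]big_nat_recl//=.
rewrite ler_wpDl// big_nat [leRHS]big_nat; apply: ler_sum => k /= kN.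
by rewrite ltnS kN.
Qed.

Definition sum3 (N : nat) (F : nat -> nat -> nat -> R) : R :=
  \sum_(i < N) \sum_(j < N) \sum_(k < N) F i j k.
(** The condition on the innermost index keeps both ends of a forward difference inside the grid.
    Differences in the other directions are obtained by permuting the arguments, so that the
    direction of the difference always comes last. *)
Definition dsum3 (N : nat) (F : nat -> nat -> nat -> R) : R :=
  \sum_(i < N) \sum_(j < N) \sum_(k < N | (k.+1 < N)%N) F i j k.

Lemma sum3E N F : sum3 N F = \sum_(p : 'I_N * 'I_N * 'I_N) F p.1.1 p.1.2 p.2.
Proof. by rewrite /sum3 pair_big pair_big. Qed.

Lemma dsum3E N F : dsum3 N F =
  \sum_(p : 'I_N * 'I_N * 'I_N | (p.2.+1 < N)%N) F p.1.1 p.1.2 p.2.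
Proof. by rewrite /dsum3 pair_big pair_big. Qed.

(** The bound of [line_sup_le] for [f ^+ 4] on the line through (i, j) in the third direction. *)
Let lines (N : nat) (f : nat -> nat -> nat -> R) (i j : nat) : R :=
  (\sum_(k < N) f i j k ^+ 4) / N%:R
  + \sum_(k < N | (k.+1 < N)%N) `|f i j k.+1 ^+ 4 - f i j k ^+ 4|.

(** Cauchy-Schwarz is arranged so that the sum of sixth powers comes out as a factor: f ^ 4 = f ^ 3
    f for the mean, and |x ^ 4 - y ^ 4| <= 2 (|x| ^ 3 + |y| ^ 3) |x - y| for the variation. *)
Let lines_sum (N : nat) (f : nat -> nat -> nat -> R) :
  (\sum_(i < N) \sum_(j < N) lines N f i j) ^+ 2
  <= sum3 N (fun i j k => f i j k ^+ 6)
     * (2 * (sum3 N (fun i j k => f i j k ^+ 2) / N%:R ^+ 2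
           + 16 * dsum3 N (fun i j k => (f i j k.+1 - f i j k) ^+ 2))).
Proof.
set S := sum3 N _; set F := sum3 N _; set D := dsum3 N _.
have -> : \sum_(i < N) \sum_(j < N) lines N f i j =
    sum3 N (fun i j k => f i j k ^+ 4) / N%:R
    + dsum3 N (fun i j k => `|f i j k.+1 ^+ 4 - f i j k ^+ 4|).
  rewrite /sum3 /dsum3 mulr_suml -big_split; apply: eq_bigr => i _ /=.
  by rewrite mulr_suml -big_split.
set A := sum3 _ _; set B := dsum3 _ _.
have S0 : 0 <= S by rewrite /S sum3E; apply: sumr_ge0 => p _; rewrite exprn_even_ge0.
have AS : A ^+ 2 <= S * F.
  rewrite /A /S /F !sum3E.
  under eq_bigr do rewrite exprSr.
  apply: le_trans (sum_cauchy_schwarz _ _ _ _) _.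
  by under eq_bigr do rewrite -exprM.
(* The square of 2 (|x| ^ 3 + |y| ^ 3) is at most 8 x ^ 6 + 8 y ^ 6, and each of the two resulting
   sums is at most [S]; hence 16. *)
have BS : B ^+ 2 <= S * (16 * D).
  have := sum_cauchy_schwarz (index_enum ('I_N * 'I_N * 'I_N)%type)
    (fun p => (p.2.+1 < N)%N)
    (fun p => 2 * (`|f p.1.1 p.1.2 p.2.+1| ^+ 3 + `|f p.1.1 p.1.2 p.2| ^+ 3))
    (fun p => `|f p.1.1 p.1.2 p.2.+1 - f p.1.1 p.1.2 p.2|).
  rewrite [X in _ <= _ * X](_ : _ = D); last first.
    by rewrite /D dsum3E; apply: eq_bigr => p _; rewrite real_normK ?num_real.
  move=> h.
  rewrite mulrA.
  apply: (@le_trans _ _ ((\sum_(p : 'I_N * 'I_N * 'I_N | (p.2.+1 < N)%N)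
     (2 * (`|f p.1.1 p.1.2 p.2.+1| ^+ 3 + `|f p.1.1 p.1.2 p.2| ^+ 3)) ^+ 2) * D)); last first.
    rewrite ler_wpM2r//.
      by rewrite /D dsum3E; apply: sumr_ge0 => p _; exact: sqr_ge0.
    apply: (@le_trans _ _ (\sum_(p : 'I_N * 'I_N * 'I_N | (p.2.+1 < N)%N)
      (8 * f p.1.1 p.1.2 p.2.+1 ^+ 6 + 8 * f p.1.1 p.1.2 p.2 ^+ 6))).
      apply: ler_sum => p _.
      have n6 (x : R) : x ^+ 6 = `|x| ^+ 6.
        by rewrite -normrX ger0_norm// exprn_even_ge0.
      rewrite (n6 (f p.1.1 p.1.2 p.2.+1)) (n6 (f p.1.1 p.1.2 p.2)).
      move: (f p.1.1 p.1.2 p.2.+1) (f p.1.1 p.1.2 p.2) => c d; move: (Num.norm c) (Num.norm d) => x y.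
      have : 0 <= (x ^+ 3 - y ^+ 3) ^+ 2 by exact: sqr_ge0.
      lra.
    rewrite big_split /= -!mulr_sumr.
    rewrite -(dsum3E N (fun i j k => f i j k.+1 ^+ 6)) -(dsum3E N (fun i j k => f i j k ^+ 6)).
    have h1 : dsum3 N (fun i j k => f i j k.+1 ^+ 6) <= S.
      apply: ler_sum => i _; apply: ler_sum => j _.
      have g0 k : 0 <= f i j k ^+ 6 by rewrite exprn_even_ge0.
      exact: (shift_sum_le N g0).
    have h2 : dsum3 N (fun i j k => f i j k ^+ 6) <= S.
      apply: ler_sum => i _; apply: ler_sum => j _.
      rewrite big_mkcond /=; apply: ler_sum => k _.
      by case: ifP => // _; rewrite exprn_even_ge0.
    lra.
  apply: le_trans h.
  rewrite ler_pXn2r// ?nnegrE; last 2 first.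
  - by rewrite /B dsum3E; apply: sumr_ge0 => p _; exact: normr_ge0.
  - apply: sumr_ge0 => p _; rewrite !mulr_ge0// ?addr_ge0 ?exprn_ge0//.
  rewrite /B dsum3E; apply: ler_sum => p _.
  move: (f _ _ _) (f _ _ _) => y x.
  rewrite (_ : x ^+ 4 - y ^+ 4 = (x + y) * (x ^+ 2 + y ^+ 2) * (x - y)); last by ring.
  rewrite normrM ler_wpM2r// normrM.
  have := ler_normD x y; have := normr_ge0 (x + y).
  rewrite -[x ^+ 2]real_normK ?num_real// -[y ^+ 2]real_normK ?num_real//.
  rewrite [ `| _ ^+ 2 + _|]ger0_norm ?addr_ge0 ?sqr_ge0//.
  have := normr_ge0 x; have := normr_ge0 y.
  move: (`|x + y|) (`|x|) (`|y|) => w a b b0 a0 w0 wab.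
  apply: (@le_trans _ _ ((a + b) * (a ^+ 2 + b ^+ 2))).
    by rewrite ler_wpM2r// addr_ge0 ?sqr_ge0.
  have : 0 <= (a - b) ^+ 2 * (a + b) by rewrite mulr_ge0 ?sqr_ge0 ?addr_ge0.
  nra.
have : (A / N%:R + B) ^+ 2 <= 2 * (A / N%:R) ^+ 2 + 2 * B ^+ 2.
  have : 0 <= (A / N%:R - B) ^+ 2 by exact: sqr_ge0.
  by lra.
have : (A / N%:R) ^+ 2 <= S * (F / N%:R ^+ 2).
  by rewrite exprMn exprVn mulrA ler_wpM2r// invr_ge0 sqr_ge0.
lra.
Qed.

(* Gagliardo's argument, applied to [f ^+ 4]: on each line parallel to an axis
   [f ^+ 4] is at most its mean plus its total variation, so that
   [f ^+ 6 = f ^+ 2 * f ^+ 2 * f ^+ 2] is bounded by a product of three functions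
   of two variables, to which the Loomis-Whitney inequality applies. *)
Lemma discrete_sobolev (N : nat) (f : nat -> nat -> nat -> R) (K : R) :
  2 * (sum3 N (fun i j k => f i j k ^+ 2) / N%:R ^+ 2
       + 16 * dsum3 N (fun i j k => (f i j k.+1 - f i j k) ^+ 2)) <= K ->
  2 * (sum3 N (fun i j k => f i j k ^+ 2) / N%:R ^+ 2
       + 16 * dsum3 N (fun i k j => (f i j.+1 k - f i j k) ^+ 2)) <= K ->
  2 * (sum3 N (fun i j k => f i j k ^+ 2) / N%:R ^+ 2
       + 16 * dsum3 N (fun j k i => (f i.+1 j k - f i j k) ^+ 2)) <= K ->
  sum3 N (fun i j k => f i j k ^+ 6) <= K ^+ 3.
Proof.
move=> K3 K2 K1; set S := sum3 _ _.
have S0 : 0 <= S by rewrite /S sum3E; apply: sumr_ge0 => p _; rewrite exprn_even_ge0.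
have K0 : 0 <= K.
  apply: le_trans K3; rewrite mulr_ge0// addr_ge0// ?mulr_ge0 ?invr_ge0 ?sqr_ge0//.
    by rewrite sum3E; apply: sumr_ge0 => p _; exact: sqr_ge0.
  by rewrite dsum3E; apply: sumr_ge0 => p _; exact: sqr_ge0.
have lines0 g i j : 0 <= lines N g i j.
  rewrite addr_ge0// ?mulr_ge0 ?invr_ge0 ?ler0n//; apply: sumr_ge0 => k _ //.
  by rewrite exprn_even_ge0.
have linesP (g : nat -> nat -> nat -> R) i j (k : 'I_N) : g i j k ^+ 2 <= Num.sqrt (lines N g i j).
  rewrite -[leLHS]ger0_norm ?sqr_ge0// -sqrtr_sqr ler_wsqrtr//.
  rewrite -exprM -[leLHS]ger0_norm ?exprn_even_ge0//.
  apply: le_trans (line_sup_le (fun k => g i j k ^+ 4) k) _.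
  rewrite lerD2r ler_wpM2r ?invr_ge0// ler_sum// => l _.
  by rewrite ger0_norm// exprn_even_ge0.
(* Copies of [f] with the differenced direction moved to the last argument. *)
pose f2 i k j := f i j k; pose f1 j k i := f i j k.
have H3 := lines_sum N f; have H2 := lines_sum N f2; have H1 := lines_sum N f1.
have E2 e : sum3 N (fun i j k => f2 i j k ^+ e) = sum3 N (fun i j k => f i j k ^+ e).
  by apply: eq_bigr => i _; rewrite exchange_big.
have E1 e : sum3 N (fun i j k => f1 i j k ^+ e) = sum3 N (fun i j k => f i j k ^+ e).
  rewrite [RHS]exchange_big; apply: eq_bigr => j _; by rewrite exchange_big.
rewrite !E2 in H2; rewrite !E1 in H1; rewrite -/S in H1 H2 H3.
move: H1 H2 H3.
set A1 := \sum_(i < N) \sum_(j < N) lines N f1 i j.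
set A2 := \sum_(i < N) \sum_(j < N) lines N f2 i j.
set A3 := \sum_(i < N) \sum_(j < N) lines N f i j => H1 H2 H3.
have {}H1 : A1 ^+ 2 <= S * K by apply: le_trans H1 _; exact: ler_wpM2l.
have {}H2 : A2 ^+ 2 <= S * K by apply: le_trans H2 _; exact: ler_wpM2l.
have {}H3 : A3 ^+ 2 <= S * K by apply: le_trans H3 _; exact: ler_wpM2l.
have A0 g : 0 <= \sum_(i < N) \sum_(j < N) lines N g i j.
  by do 2 (apply: sumr_ge0 => ? _).
have SA : S ^+ 2 <= A1 * A2 * A3.
  have := @loomis_whitney 'I_N 'I_N 'I_N (fun j k => Num.sqrt (lines N f1 j k))
   (fun i k => Num.sqrt (lines N f2 i k)) (fun i j => Num.sqrt (lines N f i j)).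
  have sq g : \sum_(i < N) \sum_(j < N) Num.sqrt (lines N g i j) ^+ 2 =
     \sum_(i < N) \sum_(j < N) lines N g i j.
    by apply: eq_bigr => i _; apply: eq_bigr => j _; rewrite sqr_sqrtr.
  rewrite !sq; apply: le_trans; rewrite ler_pXn2r ?nnegrE//; last first.
    by do 3 (apply: sumr_ge0 => ? _); rewrite !mulr_ge0 ?sqrtr_ge0.
  apply: ler_sum => i _; apply: ler_sum => j _; apply: ler_sum => k _.
  rewrite (_ : forall x : R, x ^+ 6 = x ^+ 2 * x ^+ 2 * x ^+ 2); last by move=> x; ring.
  apply: (ler_pM _ _ _ (linesP f i j k)); [by rewrite mulr_ge0 ?sqr_ge0|exact: sqr_ge0|].
  by apply: (ler_pM _ _ (linesP f1 j k i) (linesP f2 i k j)); exact: sqr_ge0.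
(* [S ^+ 2 <= A1 * A2 * A3] is squared and each [Ai ^+ 2] replaced by [S * K]; cancelling [S ^+ 3]
   then leaves the claim. *)
have S4 : S ^+ 4 <= S ^+ 3 * K ^+ 3.
  rewrite (_ : S ^+ 4 = (S ^+ 2) ^+ 2); last by rewrite -exprM.
  apply: (@le_trans _ _ ((A1 * A2 * A3) ^+ 2)).
    by rewrite ler_pXn2r ?nnegrE ?sqr_ge0// !mulr_ge0//; exact: A0.
  have -> : S ^+ 3 * K ^+ 3 = (S * K) * (S * K) * (S * K) by ring.
  rewrite !exprMn; apply: (ler_pM _ _ _ H3); [by rewrite mulr_ge0 ?sqr_ge0|exact: sqr_ge0|].
  by apply: ler_pM => //; exact: sqr_ge0.
have [->|Sn0] := eqVneq S 0; first by rewrite exprn_ge0.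
by rewrite -(@ler_pM2l _ (S ^+ 3)) ?exprn_gt0 ?lt_def ?Sn0// -exprSr.
Qed.

End DiscreteSobolev.

(** * Smooth cut-off functions *)

Section SmoothReal.
Context {R : realType}.
Implicit Types f g : R -> R.

(** The derivative is quantified existentially so that a formula can be supplied at each order;
    [smooth1_derive] recovers the canonical ['D_1 f]. *)
Fixpoint Ck1 (k : nat) f : Prop :=
  if k is k'.+1 then exists g, (forall x : R, is_derive x 1 f (g x)) /\ Ck1 k' g
  else continuous f.

Definition smooth1 f := forall k, Ck1 k f.

Lemma is_derive_continuous f (x df : R) : is_derive x 1 f df -> {for x, continuous f}.
Proof.
by move=> fdf; apply/differentiable_continuous/derivable1_diffP; exact: ex_derive.
Qed.

Lemma Ck1_continuous k f : Ck1 k f -> continuous f.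
Proof. by case: k => // k [g [fg _]] x; exact: (is_derive_continuous (fg x)). Qed.

Lemma Ck1W k f : Ck1 k.+1 f -> Ck1 k f.
Proof.
elim: k f => [|k IH] f; first by exact: (@Ck1_continuous 1).
by move=> [g [fg gC]]; exists g; split => //; exact: IH.
Qed.

Lemma smooth1_derive f : smooth1 f ->
  (forall x : R, is_derive x 1 f ('D_1 f x)) /\ smooth1 ('D_1 f).
Proof.
move=> fS; split => [x|k].
  by have [g [fg _]] := fS 1%N; have [] := fg x => ? _; exact/derivableP.
have [g [fg gC]] := fS k.+1.
by rewrite (_ : 'D_1 f = g)//; apply/funext => x; rewrite (derive_val (is_derive := fg x)).
Qed.

Lemma smooth1_intro f g : (forall x : R, is_derive x 1 f (g x)) -> smooth1 g -> smooth1 f.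
Proof. by move=> fg gS [|k]; [move=> x; exact: (is_derive_continuous (fg x))|exists g]. Qed.

Lemma smooth1_cst (c : R) : smooth1 (cst c).
Proof.
move=> k; elim: k c => [|k IH] c; first by move=> x; exact: cvg_cst.
by exists (cst 0); split => // x; exact: is_derive_cst.
Qed.

Lemma Ck1D k f g : Ck1 k f -> Ck1 k g -> Ck1 k (fun x => f x + g x).
Proof.
elim: k f g => [|k IH] f g; first by move=> fC gC x; exact: (cvgD (fC x) (gC x)).
move=> [f' [ff' f'C]] [g' [gg' g'C]]; exists (fun x => f' x + g' x); split.
  by move=> x; exact: (is_deriveD (ff' x) (gg' x)).
exact: IH.
Qed.

Lemma Ck1M k f g : Ck1 k f -> Ck1 k g -> Ck1 k (fun x => f x * g x).
Proof.
elim: k f g => [|k IH] f g; first by move=> fC gC x; exact: (cvgM (fC x) (gC x)).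
move=> /[dup]/Ck1W fC [f' [ff' f'C]] /[dup]/Ck1W gC [g' [gg' g'C]].
exists (fun x => f x * g' x + g x * f' x); split.
  by move=> x; exact: (is_deriveM (ff' x) (gg' x)).
by apply: Ck1D; exact: IH.
Qed.

Lemma smooth1D f g : smooth1 f -> smooth1 g -> smooth1 (fun x => f x + g x).
Proof. by move=> fS gS k; exact: Ck1D. Qed.

Lemma smooth1M f g : smooth1 f -> smooth1 g -> smooth1 (fun x => f x * g x).
Proof. by move=> fS gS k; exact: Ck1M. Qed.

Lemma smooth1N f : smooth1 f -> smooth1 (fun x => - f x).
Proof.
move=> fS; rewrite (_ : (fun x => _) = (fun x => cst (-1) x * f x)).
  by apply: smooth1M => //; exact: smooth1_cst.
by apply/funext => x; rewrite mulN1r.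
Qed.

Lemma smooth1X f n : smooth1 f -> smooth1 (fun x => f x ^+ n).
Proof.
move=> fS; elim: n => [|n IH].
  by under eq_fun do rewrite expr0; exact: smooth1_cst.
by under eq_fun do rewrite exprS; exact: smooth1M.
Qed.

Lemma is_derive_affine (a b x : R) : is_derive x 1 (fun y => a * y + b) a.
Proof.
have h : is_derive x 1 (fun y : R => a * y + b) (a *: 1 + 0).
  by apply: is_deriveD; apply: is_deriveZ.
by rewrite [a *: _]mulr1 addr0 in h.
Qed.

Lemma smooth1_affine f (a b : R) : smooth1 f -> smooth1 (fun x => f (a * x + b)).
Proof.
move=> fS k; elim: k f fS => [|k IH] f fS.
  move=> x; apply: (@continuous_comp _ _ _ (fun x => a * x + b) f); last exact: (fS 0%N).
  exact: (is_derive_continuous (is_derive_affine _ _ _)).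
have [fD DS] := smooth1_derive fS.
exists (fun x => 'D_1 f (a * x + b) * cst a x); split.
  by move=> x; apply: (@is_derive1_comp _ f _ x); exact: is_derive_affine.
apply: (@Ck1M k (fun x => 'D_1 f (a * x + b)) (cst a)); last exact: smooth1_cst.
exact: (IH _ DS).
Qed.

Lemma smooth1_shift f (b : R) : smooth1 f -> smooth1 (fun x => f (x - b)).
Proof.
move=> /(@smooth1_affine _ 1 (- b)); rewrite (_ : (fun x => _) = fun x => f (x - b))//.
by apply/funext => x; rewrite mul1r.
Qed.

(** The inequality exp(y / N) >= 1 + y / N >= y / N raised to the power N, for N = n + 1. *)
Lemma expR_ge_pow n (y : R) : 0 <= y -> (y / n.+1%:R) ^+ n.+1 <= expR y.
Proof.
move=> y0; rewrite -[X in expR X](@divfK _ n.+1%:R) ?pnatr_eq0// expRM_natr.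
rewrite ler_pXn2r ?nnegrE ?divr_ge0 ?expR_ge0//.
by apply: le_trans (expR_ge1Dx _); rewrite lerDr.
Qed.

(** The function p(1/x) exp(-1/x) continued by zero. The polynomial factor makes the family closed
    under differentiation; [flat 1] is the classical smooth function vanishing to infinite order at
    0. *)
Definition flat (p : {poly R}) (x : R) : R :=
  if 0 < x then p.[x^-1] * expR (- x^-1) else 0.

(** The exponential of 1/x dominates the power [size p] plus two of 1/x, so the function is O(x ^ 2)
    at 0; this is what makes its derivative vanish there. *)
Lemma flat_le (p : {poly R}) : exists2 C, 0 <= C &
  forall x, `|x| < 1 -> `|flat p x| <= C * x ^+ 2.
Proof.
pose c := \sum_(i < size p) `|p`_i|.
have c0 : 0 <= c by apply: sumr_ge0 => i _; exact: normr_ge0.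
pose N := (size p).+1.
exists (c * N.+1%:R ^+ N.+1); first by rewrite mulr_ge0// exprn_ge0.
move=> x x1; rewrite /flat; case: ifPn => x0; last first.
  by rewrite normr0; apply: mulr_ge0; [rewrite mulr_ge0// exprn_ge0|exact: sqr_ge0].
have {}x1 : x < 1 by rewrite -(gtr0_norm x0).
pose y := x^-1; have y1 : 1 <= y by rewrite invr_ge1 ?unitf_gt0// ltW.
have y0 : 0 < y by apply: lt_le_trans y1.
rewrite -/y (_ : x = y^-1); last by rewrite invrK.
rewrite normrM (ger0_norm (expR_ge0 _)) expRN.
have py : `|p.[y]| <= c * y ^+ (size p).
  rewrite horner_coef (le_trans (ler_norm_sum _ _ _))// mulr_suml ler_sum// => i _.
  rewrite normrM ler_wpM2l// ger0_norm ?exprn_ge0 ?(ltW y0)//.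
  by rewrite ler_weXn2l// ltnW.
have ey := expR_ge_pow N (ltW y0).
rewrite ler_pdivrMr ?expR_gt0//; apply: le_trans py _.
rewrite [leRHS](_ : _ = c * (N.+1%:R ^+ N.+1 * ((y^-1) ^+ 2 * expR y))); last by rewrite !mulrA.
rewrite ler_wpM2l// -[leLHS]mul1r.
apply: (@le_trans _ _ (N.+1%:R ^+ N.+1 * ((y^-1) ^+ 2 * (y / N.+1%:R) ^+ N.+1))).
  rewrite [X in _ <= X](_ : _ = y ^+ size p) ?mul1r//.
  have k0 : N.+1%:R != 0 :> R by rewrite pnatr_eq0.
  move: k0; rewrite expr_div_n exprVn {2 4}/N !exprS; move: (N.+1%:R : R) => k k0.
  by field; rewrite expf_neq0 k0 //= gt_eqF.
by rewrite (ler_wpM2l (exprn_ge0 _ _))//; rewrite (ler_wpM2l (sqr_ge0 _)).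
Qed.

(** For x > 0, differentiation multiplies by x ^ -2, which is ['X^2] evaluated at 1/x, and replaces
    p by p - p'. Having the derivative in the same family gives smoothness by induction on the
    order. *)
Lemma is_derive_flat (p : {poly R}) (x : R) :
  is_derive x 1 (flat p) (flat ('X^2 * (p - p^`())) x).
Proof.
have [x0|x0|->] := ltgtP x 0.
- rewrite {2}/flat ltNge (ltW x0) /=.
  apply: (near_eq_is_derive _ (is_derive_cst (0 : R) x 1)).
  near=> y; rewrite /flat ltNge (_ : y <= 0)//=.
  by apply: ltW; near: y; exact: lt_nbhsl.
- rewrite {2}/flat x0.
  have dV : is_derive x 1 (fun y => y^-1) (- x ^- 2).
    have := @is_deriveV R id x 1 1 (lt0r_neq0 x0) (is_derive_id _ _).
    by rewrite [_ *: _]mulr1.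
  have dP := @is_derive1_comp _ (horner p) _ x _ _ (is_derive_poly p x^-1) dV.
  have dE := @is_derive1_comp _ expR _ x _ _ (is_derive_expR _) (is_deriveN dV).
  have h : is_derive x 1 (fun x => p.[x^-1] * expR (- x^-1))
      (('X^2 * (p - p^`())).[x^-1] * expR (- x^-1)).
    have := is_deriveM dP dE; congr (is_derive _ _ _ _).
    rewrite hornerM hornerXn hornerD hornerN -exprVn.
    change (p.[x^-1] * (expR (- x^-1) * - - x^-1 ^+ 2)
      + expR (- x^-1) * (p^`().[x^-1] * - x^-1 ^+ 2)
      = x^-1 ^+ 2 * (p.[x^-1] - p^`().[x^-1]) * expR (- x^-1)).
    ring.
  apply: (near_eq_is_derive _ h).
  near=> y; rewrite /flat (_ : 0 < y)//.
  by near: y; exact: lt_nbhsr.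
- rewrite {2}/flat ltxx.
  have f0 : flat p 0 = 0 by rewrite /flat ltxx.
  suff h : (fun h => h^-1 *: ((flat p \o shift 0) (h *: 1) - flat p 0)) @ 0^' --> (0 : R).
    by apply: DeriveDef; [apply/cvg_ex; exists 0|exact: cvg_lim h].
  have [C C0 hC] := flat_le p.
  apply/cvgr0Pnorm_lt => e e0.
  near=> h.
  have h0 : h != 0 by near: h; exact: nbhs_dnbhs_neq.
  have h1 : `|h| < Num.min 1 (e / (C + 1)).
    near: h; apply: dnbhs0_lt.
    by rewrite lt_min ltr01 divr_gt0// ltr_wpDl.
  rewrite f0 subr0 /= addr0 [h *: 1]mulr1 normrZ normfV.
  rewrite ltr_pdivrMl ?normr_gt0//.
  move: h1; rewrite lt_min => /andP[h1 h2].
  apply: le_lt_trans (hC _ h1) _.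
  rewrite -[h ^+ 2]real_normK ?num_real// expr2 mulrA [C * _]mulrC -mulrA.
  rewrite ltr_pM2l ?normr_gt0//.
  rewrite ltr_pdivlMr ?ltr_wpDl// in h2.
  by apply: le_lt_trans h2; rewrite mulrC ler_wpM2l// lerDl.
Unshelve. all: by end_near. Qed.

Lemma smooth1_flat p : smooth1 (flat p).
Proof.
move=> k; elim: k p => [|k IH] p; last first.
  by exists (flat ('X^2 * (p - p^`()))); split => // x; exact: is_derive_flat.
by move=> x; exact: (is_derive_continuous (is_derive_flat _ _)).
Qed.

(** The product of the two [flat] factors lies in [0, 1[ and is positive exactly on ]a, b[. The n-th
    power of its complement to 1 therefore tends to 0 on ]a, b[ and equals 1 elsewhere: a smooth
    approximation, from below, of the indicator of the open interval. *)
Definition bump (a b : R) (n : nat) (x : R) : R :=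
  1 - (1 - flat 1 (x - a) * flat 1 (b - x)) ^+ n.

Lemma flat1_bounds x : 0 <= flat 1 x < 1.
Proof.
rewrite /flat; case: ifPn => x0; last by rewrite lexx ltr01.
rewrite hornerC mul1r expR_ge0 -[ltRHS]expR0 ltr_expR.
by rewrite oppr_lt0 invr_gt0.
Qed.

Lemma flat1_gt0 x : (0 < flat 1 x) = (0 < x).
Proof.
by rewrite /flat; case: ifPn => x0; [rewrite hornerC mul1r expR_gt0|rewrite ltxx].
Qed.

Lemma smooth1_bump a b n : smooth1 (bump a b n).
Proof.
apply: smooth1D; first exact: (smooth1_cst 1).
apply: smooth1N; apply: smooth1X; apply: smooth1D; first exact: (smooth1_cst 1).
apply: smooth1N; apply: smooth1M; first by apply: smooth1_shift; exact: smooth1_flat.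
rewrite (_ : (fun x => _) = fun x => flat 1 (-1 * x + b)).
  by apply: smooth1_affine; exact: smooth1_flat.
by apply/funext => x; rewrite mulN1r addrC.
Qed.

Lemma bump_bounds a b n x : 0 <= bump a b n x <= 1.
Proof.
have /andP[u0 /ltW u1] := flat1_bounds (x - a).
have /andP[v0 /ltW v1] := flat1_bounds (b - x).
have w0 : 0 <= 1 - flat 1 (x - a) * flat 1 (b - x).
  by rewrite subr_ge0 mulr_ile1.
have w1 : 1 - flat 1 (x - a) * flat 1 (b - x) <= 1 by rewrite gerBl mulr_ge0.
by rewrite /bump subr_ge0 exprn_ile1//= gerBl exprn_ge0.
Qed.

Lemma bump_eq0 a b n x : ~~ (a < x < b) -> bump a b n x = 0.
Proof.
move=> xab; rewrite /bump (_ : flat 1 (x - a) * _ = 0).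
  by rewrite subr0 expr1n subrr.
apply/eqP; rewrite mulf_eq0 /flat !subr_gt0; move: xab.
by case: (a < x) => //=; case: (x < b) => //=; rewrite eqxx ?orbT.
Qed.

Lemma cvg_bump a b x : bump a b n x @[n --> \oo] --> ((a < x < b)%R%:R : R).
Proof.
have [xab|xab] := boolP (a < x < b); last first.
  by under eq_fun do rewrite bump_eq0//; exact: cvg_cst.
rewrite -[X in _ --> X](@subr0 R) /=; apply: cvgB; first exact: cvg_cst.
apply: cvg_expr; have /andP[ax xb] := xab.
have /andP[u0 u1] := flat1_bounds (x - a).
have /andP[v0 v1] := flat1_bounds (b - x).
have uv : flat 1 (x - a) * flat 1 (b - x) <= 1 by apply: mulr_ile1 => //; exact: ltW.
rewrite ger0_norm ?subr_ge0// ltrBlDr ltrDl.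
by rewrite mulr_gt0// flat1_gt0 subr_gt0.
Qed.

Lemma continuous_primitive (f : R -> R) (a : R) : continuous f ->
  (forall x, x <= a -> f x = 0) ->
  exists F : R -> R, forall x : R, is_derive x 1 F (f x).
Proof.
move=> cf f0.
(* The base point lies strictly to the left of all points where [f] can be nonzero: the
   differentiation theorem covers every x > a - 1, and [F] is locally constant at the remaining
   points. *)
pose F (x : R) := (\int[lebesgue_measure]_(t in `[a - 1, x]) f t)%R.
have F1 x : a - 1 < x -> is_derive x 1 F (f x).
  move=> ax; have xx : x < x + 1 by rewrite ltrDl.
  have fi : lebesgue_measure.-integrable `[a - 1, x + 1] (EFin \o f).
    apply: continuous_compact_integrable; first exact: segment_compact.
    exact: continuous_subspaceT.
  have [dF F'] := continuous_FTC1_closed xx fi ax (cf x).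
  by apply: DeriveDef; [exact: dF|rewrite -derive1E; exact: F'].
have F0 x : x < a -> F x = 0.
  move=> xa; rewrite /F; under eq_Rintegral.
    move=> t; rewrite inE/= in_itv/= => /andP[_ tx].
    rewrite f0; last exact: le_trans tx (ltW xa).
    over.
  by rewrite Rintegral_cst// mul0r.
exists F => x; have [ax|ax] := ltP (a - 1) x; first exact: F1.
have xa : x < a by apply: le_lt_trans ax _; rewrite gtrBl.
rewrite f0 ?ltW//; apply: (near_eq_is_derive _ (is_derive_cst (0 : R) x 1)).
near=> y; rewrite F0//; near: y; exact: lt_nbhsl.
Unshelve. all: by end_near. Qed.

(* The primitive of [bump (a + h) (b + h) n - bump a b n] with compact support; as
   [n] grows its derivative tends to the difference of two indicators. *)
Lemma bump_shift_primitive (a b h : R) (n : nat) : a <= b -> 0 <= h ->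
  exists A : R -> R, [/\ smooth1 A,
    forall x : R, is_derive x 1 A (bump (a + h) (b + h) n x - bump a b n x),
    forall x, `|A x| <= h & forall x, ~~ (a < x < b + h) -> A x = 0].
Proof.
move=> ab h0.
have cb : continuous (bump a b n) by exact: (smooth1_bump a b n 0).
have [|G GE] := @continuous_primitive (bump a b n) a cb.
  by move=> x xa; apply: bump_eq0; rewrite ltNge xa.
have Gc x : {for x, continuous G} by exact: is_derive_continuous (GE x).
(* By the mean value theorem the function is -h times a value of the bump on [x - h, x]; this
   formula yields both the bound by h and the support. *)
have GI x : exists2 y, x - h <= y <= x & G (x - h) - G x = - (bump a b n y * h).
  have xh : x - h <= x by rewrite gerBl.
  have Gw : {within `[x - h, x], continuous G}.
    by apply: continuous_subspaceT => y; exact: Gc.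
  have [y] := MVT_segment xh (fun y _ => GE y) Gw.
  rewrite in_itv/= => yx GG; exists y => //.
  by rewrite -opprB GG opprB addrC subrK.
exists (fun x => G (x - h) - G x); split.
- apply: smooth1D; last first.
    by apply: smooth1N; apply: smooth1_intro (smooth1_bump a b n); exact: GE.
  by apply: smooth1_shift; apply: smooth1_intro (smooth1_bump a b n); exact: GE.
- move=> x; have := GE (x - h).
  have dS : is_derive x 1 (fun y : R => y - h) 1.
    have := is_derive_affine 1 (- h) x.
    by rewrite (_ : (fun y => _) = (fun y => y - h))//; apply/funext => y; rewrite mul1r.
  move=> Gh; have := is_deriveB (@is_derive1_comp _ G _ x _ _ Gh dS) (GE x).
  rewrite mulr1 (_ : bump a b n (x - h) = bump (a + h) (b + h) n x)//.
  have e1 : x - h - a = x - (a + h) by ring.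
  have e2 : b - (x - h) = b + h - x by ring.
  by rewrite /bump e1 e2.
- move=> x; have [y _ ->] := GI x; rewrite normrN normrM (ger0_norm h0).
  have /andP[u0 u1] := bump_bounds a b n y.
  by rewrite ger0_norm// -[leRHS]mul1r ler_wpM2r.
- move=> x xab; have [y /andP[xy yx] ->] := GI x.
  rewrite bump_eq0 ?mul0r ?oppr0//; apply: contra xab => /andP[ay yb].
  by rewrite (lt_le_trans ay yx)/= -ltrBlDr (le_lt_trans xy yb).
Qed.

End SmoothReal.

(** * Products of one-variable functions as test functions on space-time *)

Section Tensor.
Context {R : realType}.
Implicit Types (a : 'I_3 -> R -> R) (d : R -> R) (z : spacetime R) (i j : 'I_3).

Definition tens a d z : R := (\prod_(j < 3) a j (coord z.1 j)) * d z.2.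
Definition upd a i (g : R -> R) j := if j == i then g else a j.

Lemma coord_xdir (h : R) i z j :
  coord (h *: (xdir i : spacetime R) + z).1 j = coord z.1 j + h * (j == i)%:R.
Proof.
case: z => [[[x y] w] t].
case: i => [[|[|[|//]]] i3]; case: j => [[|[|[|//]]] j3];
  by rewrite /coord /xdir /= /GRing.scale /= /GRing.scale /= addrC.
Qed.

Lemma time_xdir (h : R) i z : (h *: (xdir i : spacetime R) + z).2 = z.2.
Proof. by case: z => [x t] /=; rewrite /GRing.scale /= mulr0 add0r. Qed.

Lemma coord_tdir (h : R) z : (h *: (tdir : spacetime R) + z).1 = z.1.
Proof. by case: z => [x t] /=; rewrite scaler0 add0r. Qed.

Lemma time_tdir (h : R) z : (h *: (tdir : spacetime R) + z).2 = z.2 + h.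
Proof. by case: z => [x t] /=; rewrite /GRing.scale /= mulr1 addrC. Qed.

Lemma is_derive_line (f : spacetime R -> R) (v z : spacetime R) (g : R -> R) (x0 c g' : R) :
  (forall h : R, f (h *: v + z) = c * g (x0 + h)) -> is_derive x0 1 g g' ->
  is_derive z v f (c * g').
Proof.
move=> fE [dg gE]; suff h :
    (fun h => h^-1 *: ((f \o shift z) (h *: v) - f z)) @ 0^' --> c * g'.
  by apply: DeriveDef; [apply/cvg_ex; exists (c * g')|exact: cvg_lim h].
have fz : f z = c * g x0 by rewrite -[z in LHS]add0r -(scale0r v) fE addr0.
rewrite (_ : (fun h => _) =
  (fun h : R => c * (h^-1 *: ((g \o shift x0) (h *: 1) - g x0)))); last first.
  apply/funext => h; rewrite /shift /= fE fz -mulrBr [h *: 1]mulr1 [h + x0]addrC.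
  by rewrite /GRing.scale /= mulrCA.
by apply: cvgM; [exact: cvg_cst|rewrite -gE; exact: dg].
Qed.

Lemma is_derive_tens_x a d i z (g' : R) : is_derive (coord z.1 i) 1 (a i) g' ->
  is_derive z (xdir i) (tens a d) ((\prod_(j < 3 | j != i) a j (coord z.1 j)) * d z.2 * g').
Proof.
move=> da; apply: (@is_derive_line _ _ _ (a i) (coord z.1 i) _ _ _ da) => h.
rewrite /tens time_xdir (bigD1 i)//= coord_xdir eqxx mulr1 [RHS]mulrC [RHS]mulrA.
congr (_ * _ * _); apply: eq_bigr => j ji.
by rewrite coord_xdir (negbTE ji) mulr0 addr0.
Qed.

Lemma is_derive_tens_t a d z (g' : R) : is_derive z.2 1 d g' ->
  is_derive z tdir (tens a d) ((\prod_(j < 3) a j (coord z.1 j)) * g').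
Proof.
by move=> dd; apply: (@is_derive_line _ _ _ d z.2 _ _ _ dd) => h; rewrite /tens coord_tdir time_tdir.
Qed.

(** The derivative is again of the form [tens], which closes the induction in [smooth_tens]. *)
Lemma derivative_tens_x a d i z (g : R -> R) : is_derive (coord z.1 i) 1 (a i) (g (coord z.1 i)) ->
  is_derive z (xdir i) (tens a d) (tens (upd a i g) d z).
Proof.
move=> /is_derive_tens_x; move/(_ d); congr is_derive.
rewrite /tens [in RHS](bigD1 i)//= /upd eqxx [LHS]mulrC [LHS]mulrA.
by congr (_ * _ * _); apply: eq_bigr => j /negbTE ->.
Qed.

Lemma continuous_coord i : continuous (fun z : spacetime R => coord z.1 i).
Proof.
have c1 (z : spacetime R) : z.1 @[z --> z] --> z.1 by exact: cvg_fst.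
have c2 (z : spacetime R) : z.1.1 @[z --> z] --> z.1.1.
  by apply: (@cvg_comp _ _ _ _ fst _ _ _ (c1 z)); exact: cvg_fst.
have c3 (z : spacetime R) : z.1.1.1 @[z --> z] --> z.1.1.1.
  by apply: (@cvg_comp _ _ _ _ fst _ _ _ (c2 z)); exact: cvg_fst.
have c4 (z : spacetime R) : z.1.1.2 @[z --> z] --> z.1.1.2.
  by apply: (@cvg_comp _ _ _ _ snd _ _ _ (c2 z)); exact: cvg_snd.
have c5 (z : spacetime R) : z.1.2 @[z --> z] --> z.1.2.
  by apply: (@cvg_comp _ _ _ _ snd _ _ _ (c1 z)); exact: cvg_snd.
case: i => [[|[|[|//]]] i3] z; [exact: c3|exact: c4|exact: c5].
Qed.

Lemma continuous_tens a d : (forall j, continuous (a j)) -> continuous d ->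
  continuous (tens a d).
Proof.
move=> ca cd z; rewrite /tens; apply: cvgM; last first.
  by apply: (@continuous_comp _ _ _ snd d); [exact: cvg_snd|exact: cd].
rewrite (_ : (fun x : spacetime R => _) =
  fun x => a ord0 (coord x.1 ord0) * (a (lift ord0 ord0) (coord x.1 (lift ord0 ord0))
   * a (lift ord0 (lift ord0 ord0)) (coord x.1 (lift ord0 (lift ord0 ord0))))).
  have cc i : (fun x : spacetime R => a i (coord x.1 i)) @ z --> a i (coord z.1 i).
    apply: (@continuous_comp _ _ _ (fun x : spacetime R => coord x.1 i) (a i)).
      exact: continuous_coord.
    exact: ca.
  rewrite !big_ord_recl big_ord0 mulr1.
  by apply: cvgM => //; apply: cvgM.
by apply/funext => x; rewrite !big_ord_recl big_ord0 mulr1.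
Qed.

Lemma smooth_tens a d : (forall j, smooth1 (a j)) -> smooth1 d -> smooth (tens a d).
Proof.
move=> sa sd k; elim: k a d sa sd => [|k IH] a d sa sd.
  split => //; apply: continuous_tens; [move=> j; exact: (sa j 0%N)|exact: (sd 0%N)].
have dxE i z : is_derive z (xdir i) (tens a d) (tens (upd a i ('D_1 (a i))) d z).
  by apply: derivative_tens_x; have [+ _] := smooth1_derive (sa i); exact.
have dtE z : is_derive z tdir (tens a d) (tens a ('D_1 d) z).
  by apply: is_derive_tens_t; have [+ _] := smooth1_derive sd; exact.
split; first by apply: continuous_tens; [move=> j; exact: (sa j 0%N)|exact: (sd 0%N)].
split => [i z|z|i|].
- exact: ex_derive.
- exact: ex_derive.
- rewrite (_ : dx i _ = tens (upd a i ('D_1 (a i))) d).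
    apply: IH => // j; rewrite /upd; case: ifP => // _.
    by have [_ +] := smooth1_derive (sa i).
  by apply/funext => z; exact: derive_val.
- rewrite (_ : dt _ = tens a ('D_1 d)).
    by apply: IH => //; have [_ +] := smooth1_derive sd.
  by apply/funext => z; exact: derive_val.
Qed.

Definition cbox (lo hi : 'I_3 -> R) : set (space3 R) :=
  [set x | forall j, lo j <= coord x j <= hi j].

Lemma compact_cbox lo hi (s t : R) : compact (cbox lo hi `*` `[s, t]).
Proof.
apply: compact_setX; last exact: segment_compact.
rewrite (_ : cbox lo hi = `[lo ord0, hi ord0] `*` `[lo (lift ord0 ord0), hi (lift ord0 ord0)]
  `*` `[lo (lift ord0 (lift ord0 ord0)), hi (lift ord0 (lift ord0 ord0))]).
  apply: compact_setX; last exact: segment_compact.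
  by apply: compact_setX; exact: segment_compact.
apply/seteqP; split => [x xb|x [[]]]; rewrite /= ?in_itv/=.
  by split; [split|]; exact: (xb _).
move=> x0 x1 x2.
by move=> [[|[|[|//]]] j3]; [move: x0|move: x1|move: x2]; congr (lo _ <= _ <= hi _); exact/val_inj.
Qed.

Lemma test_function_tens (D : set (spacetime R)) a d lo hi (s t : R) :
  (forall j, smooth1 (a j)) -> smooth1 d -> cbox lo hi `*` `[s, t] `<=` D ->
  (forall j x, ~~ (lo j <= x <= hi j) -> a j x = 0) ->
  (forall x, ~~ (s <= x <= t) -> d x = 0) ->
  test_function D (tens a d).
Proof.
move=> sa sd KD a0 d0; split; first exact: smooth_tens.
exists (cbox lo hi `*` `[s, t]); split => //; first exact: compact_cbox.
move=> z /not_andP[|].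
  move=> /existsNP[j /negP zj].
  by rewrite /tens (bigD1 j)//= a0// !mul0r.
by rewrite /= in_itv/= => /negP zt; rewrite /tens d0// mulr0.
Qed.

End Tensor.

(** * Boxes and time slices *)

Section SigmaFinite.
Context {R : realType}.

(* The library equips a product of measures with its sigma-finite structure only
   when the factors are subprobabilities; here it is needed for Lebesgue measure. *)
Lemma sigma_finite_product_measure d1 d2 (T1 : measurableType d1) (T2 : measurableType d2)
    (m1 : {sigma_finite_measure set T1 -> \bar R})
    (m2 : {sigma_finite_measure set T2 -> \bar R}) : sigma_finite setT (m1 \x m2)%E.
Proof.
have [F TF Foo] := sigma_finiteT m1; have [G TG Goo] := sigma_finiteT m2.
pose H n := if @choice.unpickle (nat * nat)%type n is Some p then F p.1 `*` G p.2 else set0.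
exists H.
  apply/esym/seteqP; split => // -[x y] _.
  have : setT x by []. rewrite TF => -[i _ Fx].
  have : setT y by []. rewrite TG => -[k _ Gy].
  by exists (choice.pickle (i, k)) => //; rewrite /H choice.pickleK.
move=> n; rewrite /H; case: (choice.unpickle n) => [[i k]|]; last by rewrite measure0.
have [mF Fi] := Foo i; have [mG Gk] := Goo k.
split; first exact: measurableX.
by rewrite product_measure1E// lte_mul_pinfty// ge0_fin_numE.
Qed.

Definition sleb2 : set (mR1 R * mR1 R)%type -> \bar R :=
  (@lebesgue_measure R \x @lebesgue_measure R)%E.
HB.instance Definition _ := Measure.on sleb2.
HB.instance Definition _ := Measure_isSigmaFinite.Build _ _ _ sleb2
  (sigma_finite_product_measure _ _).
Definition sleb3 : set (mR1 R * mR1 R * mR1 R)%type -> \bar R :=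
  (sleb2 \x @lebesgue_measure R)%E.
HB.instance Definition _ := Measure.on sleb3.
HB.instance Definition _ := Measure_isSigmaFinite.Build _ _ _ sleb3
  (sigma_finite_product_measure _ _).
End SigmaFinite.

Section Boxes.
Context {R : realType}.
Implicit Types (lo hi : 'I_3 -> R) (x : space3 R).

Lemma measurable_coord (i : 'I_3) :
  measurable_fun [set: mR3 R] ((coord ^~ i) : mR3 R -> mR1 R).
Proof.
case: i => [[|[|[|//]]] i3]; rewrite /coord /=.
- by apply: (measurableT_comp (f := fst)) => //; exact: measurable_fst.
- by apply: (measurableT_comp (f := snd)) => //; exact: measurable_fst.
- exact: measurable_snd.
Qed.

Definition prod3 (A : 'I_3 -> set R) : set (space3 R) := [set x | forall k, A k (coord x k)].

Lemma prod3E (A : 'I_3 -> set R) :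
  prod3 A = A ord0 `*` A (lift ord0 ord0) `*` A (lift ord0 (lift ord0 ord0)).
Proof.
apply/seteqP; split => [x xA|x [[/= x0 x1] x2]].
  by split; [split|]; exact: (xA _).
by move=> [[|[|[|//]]] j3]; [move: x0|move: x1|move: x2]; congr (A _ _); exact/val_inj.
Qed.

Lemma measurable_prod3 (A : 'I_3 -> set (mR1 R)) : (forall k, measurable (A k)) ->
  measurable (prod3 A : set (mR3 R)).
Proof. by move=> mA; rewrite prod3E; do 2 (apply: measurableX => //). Qed.

Lemma leb3_prod3 (A : 'I_3 -> set (mR1 R)) : (forall k, measurable (A k)) ->
  (leb3 (prod3 A) = \prod_(k < 3) lebesgue_measure (A k))%E.
Proof.
move=> mA; rewrite prod3E /leb3 /=.
rewrite product_measure1E//=; last by apply: measurableX.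
rewrite product_measure1E//=.
by rewrite !big_ord_recl big_ord0 mule1 muleA.
Qed.

Lemma leb4_setX (A : set (mR3 R)) (L : set (mR1 R)) : measurable A -> measurable L ->
  (leb4 (A `*` L) = leb3 A * lebesgue_measure L)%E.
Proof. by move=> mA mL; rewrite /leb4 /leb3 /= product_measure1E. Qed.

Definition hplane (k : 'I_3) (c : R) : set (space3 R) := [set x | coord x k = c].

Lemma measurable_hplane k c : measurable (hplane k c : set (mR3 R)).
Proof.
by rewrite -[hplane k c]setTI; exact: (measurable_coord k measurableT (measurable_set1 c)).
Qed.

Lemma leb3_hplane k c : leb3 (hplane k c) = 0%E.
Proof.
rewrite (_ : hplane k c = prod3 (fun j => if j == k then [set c] else setT)).
  rewrite leb3_prod3.
    by rewrite (bigD1 k)//= eqxx lebesgue_measure_set1 mul0e.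
  by move=> j; case: ifP.
apply/seteqP; split => [x xk j /=|x /(_ k)]; last by rewrite eqxx.
by case: ifPn => // /eqP ->.
Qed.

(** Half-open boxes tile a cube, whereas the smooth cut-offs converge to indicators of open boxes.
    The lower faces, by which they differ, are null sets, and [integral_hbox] passes from one kind
    to the other. *)
Definition obox lo hi : set (space3 R) := prod3 (fun k => `]lo k, hi k[%classic).
Definition hbox lo hi : set (space3 R) := prod3 (fun k => `[lo k, hi k[%classic).

Lemma measurable_obox lo hi : measurable (obox lo hi : set (mR3 R)).
Proof. by apply: measurable_prod3 => k; exact: measurable_itv. Qed.

Lemma measurable_hbox lo hi : measurable (hbox lo hi : set (mR3 R)).
Proof. by apply: measurable_prod3 => k; exact: measurable_itv. Qed.

Lemma leb3_hbox lo hi : (forall k, lo k <= hi k) ->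
  leb3 (hbox lo hi) = (\prod_(k < 3) (hi k - lo k))%:E.
Proof.
move=> lh; rewrite leb3_prod3; last by move=> k; exact: measurable_itv.
rewrite -prodEFin; apply: eq_bigr => k _.
by rewrite lebesgue_measure_itv/= lte_fin; case: ltgtP (lh k) => // ->; rewrite subrr.
Qed.

Lemma hboxD_hplane lo hi :
  hbox lo hi `\` (\big[setU/set0]_(k < 3) hplane k (lo k)) = obox lo hi.
Proof.
apply/seteqP; split => [x [xb xN] k|x xo].
  have := xb k; rewrite /= !in_itv/= => /andP[xl ->]; rewrite andbT.
  rewrite lt_neqAle xl andbT; apply/eqP => lx; apply: xN.
  by rewrite -bigcup_mkord_ord; exists k => //=; rewrite (_ : inord k = k)//; exact: inord_val.
split => [k|]; first by have := xo k; rewrite /= !in_itv/= => /andP[/ltW -> ->].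
rewrite -bigcup_mkord_ord => -[k k3 /= xk].
by have := xo (inord k); rewrite /= in_itv/= xk ltxx.
Qed.

Lemma measurable_hplanes lo :
  measurable (\big[setU/set0]_(k < 3) hplane k (lo k) : set (mR3 R)).
Proof. by apply: bigsetU_measurable => k _; exact: measurable_hplane. Qed.

Lemma leb3_hplanes lo : (leb3 (\big[setU/set0]_(k < 3) hplane k (lo k)) = 0)%E.
Proof.
suff [] : measurable (\big[setU/set0]_(k < 3) hplane k (lo k) : set (mR3 R)) /\
    leb3 (\big[setU/set0]_(k < 3) hplane k (lo k)) = 0%E by [].
elim/big_ind : _ => [|A B [mA A0] [mB B0]|k _].
- by split => //; rewrite measure0.
- by split; [exact: measurableU|rewrite null_set_setU].
- by split; [exact: measurable_hplane|exact: leb3_hplane].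
Qed.

Lemma integral_hbox lo hi (f : mR3 R -> \bar R) : leb3.-integrable (hbox lo hi) f ->
  (\int[leb3]_(x in hbox lo hi) f x = \int[leb3]_(x in obox lo hi) f x)%E.
Proof.
move=> fi; rewrite -hboxD_hplane; apply: negligible_integral => //.
- exact: measurable_hplanes.
- exact: measurable_hbox.
- exact: leb3_hplanes.
Qed.

End Boxes.

(** * Integration over time slices *)

Section Slices.
Context {R : realType}.

Lemma integrable_restrictT d (T : measurableType d) (mu : {measure set T -> \bar R})
    (D : set T) (f : T -> \bar R) : measurable D -> mu.-integrable setT f ->
  mu.-integrable setT (f \_ D).
Proof.
move=> mD fi; apply/(integrable_mkcond f mD).1.
exact: (integrableS measurableT).
Qed.

(** Moves a product domain into the integrand, so that the Fubini theorems apply on the whole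
    space. *)
Lemma restrict_setX_slice (f : mR4 R -> \bar R) (A : set (mR3 R)) (L : set (mR1 R)) :
  (fun t => \int[leb3]_x (f \_ (A `*` L)) (x, t))%E
  = (fun t => \int[leb3]_(x in A) f (x, t))%E \_ L.
Proof.
apply/funext => t; rewrite /patch; case: ifPn => [/set_mem Lt|/negP Lt].
  rewrite [RHS]integral_mkcond; apply: eq_integral => x _.
  rewrite /patch; congr (if _ then _ else _); apply/idP/idP => /set_mem.
    by move=> [? ?]; exact: mem_set.
  by move=> ?; exact: mem_set.
apply: integral0_eq => x _; case: ifPn => // /set_mem [_ /= Lt'].
by exfalso; apply: Lt; exact: mem_set.
Qed.

Lemma ge0_integral_slices (f : mR4 R -> \bar R) (A : set (mR3 R)) (L : set (mR1 R)) :
  measurable A -> measurable L -> measurable_fun [set: mR4 R] f -> (forall z, 0 <= f z)%E ->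
  (\int[leb4]_(z in A `*` L) f z =
   \int[leb1]_(t in L) \int[leb3]_(x in A) f (x, t))%E.
Proof.
move=> mA mL mf f0; rewrite integral_mkcond [RHS]integral_mkcond -restrict_setX_slice.
set g := f \_ (A `*` L).
have mg : measurable_fun [set: mR4 R] g; last first.
  have g0 z : (0 <= g z)%E by apply: erestrict_ge0.
  exact: (@fubini_tonelli2 _ _ _ _ R sleb3 (@lebesgue_measure R) g mg g0).
by apply/(measurable_restrictT _ _).1; [exact: measurableX|exact: measurable_funS mf].
Qed.

Lemma measurable_ge0_slices (f : mR4 R -> \bar R) (A : set (mR3 R)) :
  measurable A -> measurable_fun [set: mR4 R] f -> (forall z, 0 <= f z)%E ->
  measurable_fun [set: mR1 R] (fun t => \int[leb3]_(x in A) f (x, t))%E.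
Proof.
move=> mA mf f0.
rewrite -[X in measurable_fun _ X](patch_setT (fun=> 0%E)) -restrict_setX_slice.
set g := f \_ (A `*` setT).
have mg : measurable_fun [set: mR4 R] g.
  by apply/(measurable_restrictT _ _).1; [exact: measurableX|exact: measurable_funS mf].
have g0 z : (0 <= g z)%E by apply: erestrict_ge0.
exact: (@measurable_fun_fubini_tonelli_G _ _ _ _ R sleb3 g mg g0).
Qed.

Lemma integral_slices (f : mR4 R -> \bar R) (A : set (mR3 R)) (L : set (mR1 R)) :
  measurable A -> measurable L -> leb4.-integrable setT f ->
  (\int[leb4]_(z in A `*` L) f z =
   \int[leb1]_(t in L) \int[leb3]_(x in A) f (x, t))%E.
Proof.
move=> mA mL fi; rewrite integral_mkcond [RHS]integral_mkcond -restrict_setX_slice.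
set g := f \_ (A `*` L).
have ig : leb4.-integrable setT g.
  by apply: integrable_restrictT => //; exact: measurableX.
exact/esym/(@integral21_prod_meas1 _ _ _ _ R sleb3 (@lebesgue_measure R) g ig).
Qed.

Lemma integrable_slices (f : mR4 R -> \bar R) (A : set (mR3 R)) :
  measurable A -> leb4.-integrable setT f ->
  leb1.-integrable setT (fun t => \int[leb3]_(x in A) f (x, t))%E.
Proof.
move=> mA fi.
rewrite -[X in integrable _ _ X](patch_setT (fun=> 0%E)) -restrict_setX_slice.
set g := f \_ (A `*` setT).
have ig : leb4.-integrable setT g.
  by apply: integrable_restrictT => //; exact: measurableX.
have mG := @measurable_fubini_G _ _ _ _ R sleb3 (@lebesgue_measure R) g ig.
apply/integrableP; split; first exact: mG.
have /integrableP[mg goo] := ig.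
apply: le_lt_trans goo.
have mabs : measurable_fun [set: mR4 R] (abse \o g) by exact: measurableT_comp.
have abs0 z : (0 <= (abse \o g) z)%E by exact: abse_ge0.
rewrite [leRHS](@fubini_tonelli2 _ _ _ _ R sleb3 (@lebesgue_measure R) (abse \o g) mabs abs0).
apply: ge0_le_integral => //=.
- by apply: measurableT_comp => //; exact: mG.
- exact: (@measurable_fun_fubini_tonelli_G _ _ _ _ R sleb3 (abse \o g) mabs abs0).
- move=> t _; apply: (@le_abse_integral _ _ _ (@leb3 R) setT _ measurableT).
  by apply: (measurableT_comp mg); exact: pair2_measurable.
Qed.

Lemma ae_integrable_slices (f : mR4 R -> \bar R) : leb4.-integrable setT f ->
  {ae leb1, forall t, leb3.-integrable setT (fun x => f (x, t))}.
Proof.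
move=> fi; exact: (@ae_integrable2 _ _ _ _ R sleb3 (@lebesgue_measure R) f fi).
Qed.

End Slices.

(** * Weak gradients and translations *)

Section WeakShift.
Context {R : realType}.
Implicit Types (lo hi : 'I_3 -> R) (u G : mR4 R -> R) (z : spacetime R).

Lemma measurable_tens (a : 'I_3 -> R -> R) (d : R -> R) :
  (forall j, continuous (a j)) -> continuous d -> measurable_fun [set: mR4 R] (tens a d).
Proof.
move=> ca cd; apply: measurable_funM; last first.
  apply: (measurableT_comp (f := d)); last exact: measurable_snd.
  exact: continuous_measurable_fun.
apply: measurable_prod => j _.
apply: (measurableT_comp (f := a j)); first exact: continuous_measurable_fun.
apply: (measurableT_comp (f := coord ^~ j)); last exact: measurable_fst.
exact: measurable_coord.
Qed.

Definition tbump lo hi (s t : R) (n : nat) : spacetime R -> R :=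
  tens (fun k => bump (lo k) (hi k) n) (bump s t n).

Lemma tbump_bounds lo hi s t n z : 0 <= tbump lo hi s t n z <= 1.
Proof.
have h k : 0 <= bump (lo k) (hi k) n (coord z.1 k) <= 1 by exact: bump_bounds.
have /andP[d0 d1] := bump_bounds s t n z.2.
apply/andP; split; first by apply: mulr_ge0 => //; apply: prodr_ge0 => k _; case/andP: (h k).
apply: mulr_ile1 => //; first by apply: prodr_ge0 => k _; case/andP: (h k).
by apply: prodr_ile1 => k _; exact: h.
Qed.

Lemma measurable_tbump lo hi s t n : measurable_fun [set: mR4 R] (tbump lo hi s t n).
Proof.
apply: measurable_tens => [j|]; exact: (smooth1_bump _ _ n 0).
Qed.

Lemma obox_itvP lo hi (s t : R) z : (obox lo hi `*` `]s, t[) z <->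
  (forall k, lo k < coord z.1 k < hi k) /\ s < z.2 < t.
Proof.
split => [[zo]|[zo zt]].
  by rewrite /= in_itv/= => zt; split => // k; have := zo k; rewrite /= in_itv.
by split; [move=> k; rewrite /= in_itv/=|rewrite /= in_itv/=].
Qed.

Lemma cvg_tbump lo hi s t z :
  tbump lo hi s t n z @[n --> \oo] --> (\1_(obox lo hi `*` `]s, t[) z : R).
Proof.
have -> : \1_(obox lo hi `*` `]s, t[) z =
  (\prod_(k < 3) (lo k < coord z.1 k < hi k)%R%:R) * (s < z.2 < t)%R%:R :> R.
  rewrite indicE; have [/set_mem/obox_itvP[zo ->]|/negP zN] := boolP (_ \in _).
    by rewrite mulr1 big1// => k _; rewrite zo.
  have [zt|] := boolP (s < z.2 < t); last by rewrite mulr0.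
  rewrite mulr1; have [k zk] : exists k, ~~ (lo k < coord z.1 k < hi k).
    apply: contrapT => /forallNP zk; apply: zN; apply/mem_set/obox_itvP; split => // k.
    exact/negPn/negP/zk.
  by rewrite (bigD1 k)//= (negbTE zk) mul0r.
apply: cvgM; last exact: cvg_bump.
under eq_fun do rewrite !big_ord_recl big_ord0.
rewrite !big_ord_recl big_ord0.
by do 3 (apply: cvgM; first exact: cvg_bump); exact: cvg_cst.
Qed.

Lemma integrable_Ml (D : set (mR4 R)) u (f : mR4 R -> R) (M : R) : measurable D ->
  leb4.-integrable D (EFin \o u) -> measurable_fun D f ->
  (forall z, `|f z| <= M) -> leb4.-integrable D (EFin \o (fun z => u z * f z)).
Proof.
move=> mD iu mf fM.
rewrite (_ : EFin \o _ = (EFin \o u) \* (EFin \o f))%E//.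
apply: integrableMl => //; exists M; split; rewrite ?num_real// => y My z _ /=.
exact: le_trans (fM z) (ltW My).
Qed.

Lemma cvg_integral_tbump (D : set (mR4 R)) u lo hi s t : measurable D ->
  leb4.-integrable D (EFin \o u) -> obox lo hi `*` `]s, t[ `<=` D ->
  \int[leb4]_(z in D) (u z * tbump lo hi s t n z) @[n --> \oo] -->
  \int[leb4]_(z in obox lo hi `*` `]s, t[) u z.
Proof.
move=> mD iu boxD.
have mbox : measurable (obox lo hi `*` `]s, t[ : set (mR4 R)).
  by apply: measurableX => //; exact: measurable_obox.
have mu : measurable_fun D u by apply/measurable_EFinP; exact: measurable_int iu.
have E : (\int[leb4]_(z in obox lo hi `*` `]s, t[) (u z)%:E =
    \int[leb4]_(z in D) (u z * \1_(obox lo hi `*` `]s, t[) z)%:E)%E.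
  rewrite -[X in integral _ X _](setIidr boxD) integral_mkcondr.
  apply: eq_integral => z _; rewrite /patch indicE.
  by case: ifPn; rewrite ?mulr1 ?mulr0.
have h := @dominated_convergence _ _ _ leb4 D mD
  (fun n z => (u z * tbump lo hi s t n z)%:E)
  (fun z => (u z * \1_(obox lo hi `*` `]s, t[) z)%:E) (abse \o (EFin \o u)).
have [|||||_ _ hc] := h.
- move=> n; apply/measurable_EFinP/measurable_funM => //.
  exact: measurable_funS (measurable_tbump _ _ _ _ _).
- by apply/measurable_EFinP/measurable_funM.
- apply: aeW => z _ /=; apply: cvg_EFin; first exact: nearW.
  by apply: cvgM; [exact: cvg_cst|exact: cvg_tbump].
- exact: integrable_abse.
- apply: aeW => z n _; rewrite /= lee_fin normrM ler_piMr//.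
  by have /andP[b0 b1] := tbump_bounds lo hi s t n z; rewrite ger0_norm.
rewrite -E in hc.
rewrite /Rintegral; apply: fine_cvg; rewrite fineK//.
by apply: integrable_fin_num => //; exact: integrableS iu.
Qed.

(** The test function is the primitive of [bump_shift_primitive] in direction j times bumps in the
    other directions and in time. Its derivative in direction j is the difference of the cut-offs of
    the two boxes; it is at most h in absolute value and vanishes outside their hull [obox lo hi'].
    The resulting estimate holds for each n and passes to the limit. *)
Lemma weak_shift (D : set (mR4 R)) u G (j : 'I_3) lo (h s t : R) :
  let lo' k := lo k + h * (k == j)%:R in let hi k := lo k + h in
  let hi' k := lo' k + h in
  measurable D -> leb4.-integrable D (EFin \o u) -> leb4.-integrable D (EFin \o G) ->
  (forall phi, test_function D phi ->
    (\int[leb4]_(z in D) (u z * dx j phi z)%:E =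
     - \int[leb4]_(z in D) (G z * phi z)%:E)%E) ->
  0 <= h -> cbox lo hi' `*` `[s, t] `<=` D ->
  `| \int[leb4]_(z in obox lo' hi' `*` `]s, t[) u z
     - \int[leb4]_(z in obox lo hi `*` `]s, t[) u z |
  <= h * \int[leb4]_(z in obox lo hi' `*` `]s, t[) `|G z|.
Proof.
move=> lo' hi hi' mD iu iG W h0 KD.
have lo'E k : lo k <= lo' k by rewrite lerDl mulr_ge0.
have hi'E k : hi k <= hi' k by rewrite lerD2r.
have KD' : obox lo hi' `*` `]s, t[ `<=` D.
  move=> z /obox_itvP[zo /andP[zs zt]]; apply: KD; split; last first.
    by rewrite /= in_itv/= !ltW.
  by move=> k; have /andP[/ltW -> /ltW ->] := zo k.
have c1 : obox lo' hi' `*` `]s, t[ `<=` D.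
  move=> z /obox_itvP[zo zt]; apply: KD'; apply/obox_itvP; split => // k.
  by have /andP[l r] := zo k; rewrite r (le_lt_trans (lo'E k) l).
have c2 : obox lo hi `*` `]s, t[ `<=` D.
  move=> z /obox_itvP[zo zt]; apply: KD'; apply/obox_itvP; split => // k.
  by have /andP[l r] := zo k; rewrite l (lt_le_trans r (hi'E k)).
have C1 := cvg_integral_tbump mD iu c1.
have C2 := cvg_integral_tbump mD iu c2.
have CC : `|\int[leb4]_(z in D) (u z * tbump lo' hi' s t n z)
    - \int[leb4]_(z in D) (u z * tbump lo hi s t n z)| @[n --> \oo] -->
  `| \int[leb4]_(z in obox lo' hi' `*` `]s, t[) u z
     - \int[leb4]_(z in obox lo hi `*` `]s, t[) u z |.
  exact: (cvg_norm (cvgB C1 C2)).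
rewrite -(cvg_lim _ CC)//; apply: limr_le; first by apply/cvg_ex; eexists; exact: CC.
apply: nearW => n /=.
have loj : lo j <= hi j by rewrite lerDl.
have [A [sA dA Ah A0]] := @bump_shift_primitive R (lo j) (hi j) h n loj h0.
pose a k := if k == j then A else bump (lo k) (hi k) n.
pose d := bump s t n; pose phi := tens a d.
have sa k : smooth1 (a k) by rewrite /a; case: ifP => // _; exact: smooth1_bump.
have sd : smooth1 d by exact: smooth1_bump.
have lo'n k : k != j -> lo' k = lo k by move=> /negbTE kj; rewrite /lo' kj mulr0 addr0.
have lo'j : lo' j = lo j + h by rewrite /lo' eqxx mulr1.
have hi'n k : k != j -> hi' k = hi k by move=> kj; rewrite /hi' lo'n.
have hi'j : hi' j = hi j + h by rewrite /hi' lo'j.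
have a0 k x : ~~ (lo k < x < hi' k) -> a k x = 0.
  rewrite /a; case: eqVneq => [->|kj]; first by rewrite hi'j; exact: A0.
  by rewrite hi'n//; exact: bump_eq0.
have tphi : test_function D phi.
  apply: (test_function_tens sa sd KD) => [k x|x] xn.
    by apply: a0; apply: contra xn => /andP[/ltW -> /ltW ->].
  by apply: bump_eq0; apply: contra xn => /andP[/ltW -> /ltW ->].
have dphi z : dx j phi z = tbump lo' hi' s t n z - tbump lo hi s t n z.
  have dAz : is_derive (coord z.1 j) 1 (a j)
      (bump (lo' j) (hi' j) n (coord z.1 j) - bump (lo j) (hi j) n (coord z.1 j)).
    by rewrite /a eqxx lo'j hi'j; exact: dA.
  have T lo1 hi1 : (forall k, k != j -> lo1 k = lo k /\ hi1 k = hi k) ->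
      tbump lo1 hi1 s t n z = (\prod_(k < 3 | k != j) a k (coord z.1 k)) * d z.2
        * bump (lo1 j) (hi1 j) n (coord z.1 j).
    move=> E; rewrite /tbump /tens (bigD1 j)//= -[LHS]mulrA [LHS]mulrC; congr (_ * _ * _).
    by apply: eq_bigr => k kj; rewrite /a (negbTE kj); have [-> ->] := E k kj.
  rewrite /dx (derive_val (is_derive := is_derive_tens_x d dAz)).
  rewrite (T lo' hi') ?(T lo hi) ?mulrBr// => k kj.
  by rewrite lo'n// hi'n.
have Ia lo1 hi1 : leb4.-integrable D (EFin \o (fun z => u z * tbump lo1 hi1 s t n z)).
  apply: (@integrable_Ml _ _ _ 1) => //.
    exact: measurable_funS (measurable_tbump _ _ _ _ _).
  by move=> z; have /andP[b0 b1] := tbump_bounds lo1 hi1 s t n z; rewrite ger0_norm.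
rewrite -RintegralB//.
have -> : \int[leb4]_(z in D) (u z * tbump lo' hi' s t n z - u z * tbump lo hi s t n z)
    = - \int[leb4]_(z in D) (G z * phi z).
  have := congr1 fine (W phi tphi).
  rewrite fineN -/(Rintegral _ _ _) => <-; apply: eq_Rintegral => z _.
  by rewrite dphi mulrBr.
have phih z : `|phi z| <= h * \1_(obox lo hi' `*` `]s, t[) z.
  rewrite indicE; have [zb|/negP zN] := boolP (_ \in _).
    rewrite mulr1 /phi /tens normrM normr_prod (bigD1 j)//= /a eqxx -mulrA.
    rewrite -[leRHS]mulr1; apply: ler_pM => //.
      by apply: mulr_ge0 => //; apply: prodr_ge0 => k _.
    apply: mulr_ile1 => //; first by apply: prodr_ge0 => k _.
      apply: prodr_ile1 => k kj; rewrite normr_ge0 (negbTE kj)/=.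
      by have /andP[b0 b1] := bump_bounds (lo k) (hi k) n (coord z.1 k); rewrite ger0_norm.
    by have /andP[b0 b1] := bump_bounds s t n z.2; rewrite ger0_norm.
  rewrite mulr0 normr_le0; apply/eqP; apply: contrapT => phi0; apply: zN.
  apply/mem_set/obox_itvP; split => [k|].
    apply/negPn/negP => zk; apply: phi0.
    by rewrite /phi /tens (bigD1 k)//= a0// !mul0r.
  by apply/negPn/negP => zt; apply: phi0; rewrite /phi /tens /d bump_eq0// mulr0.
have mphi : measurable_fun D phi.
  apply: (measurable_funS measurableT) => //; apply: measurable_tens => [k|].
    exact: (sa k 0%N).
  exact: (sd 0%N).
have phih' z : `|phi z| <= h.
  by apply: le_trans (phih z) _; rewrite ler_piMr// indicE; rewrite lern1 leq_b1.
rewrite normrN; apply: le_trans (le_normr_Rintegral mD _) _.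
  exact: integrable_Ml phih'.
have mbox : measurable (obox lo hi' `*` `]s, t[ : set (mR4 R)).
  by apply: measurableX => //; exact: measurable_obox.
have iG' : leb4.-integrable D (EFin \o (fun z => `|G z|)).
  exact: (integrable_abse iG).
have iG'' : leb4.-integrable D (EFin \o (fun z => h * `|G z|)).
  under eq_fun do rewrite mulrC.
  exact: (@integrable_Ml _ _ (cst h) `|h|).
rewrite -RintegralZl//; last exact: integrableS iG'.
rewrite -[X in _ <= Rintegral _ X _](setIidr KD') [leRHS]Rintegral_mkcondr.
apply: le_Rintegral => //.
- exact: (integrable_abse (integrable_Ml mD iG mphi phih')).
- rewrite (_ : _ \o _ = (EFin \o (fun z => h * `|G z|)) \_ (obox lo hi' `*` `]s, t[)).
    apply/integrable_restrict => //.
    by rewrite setIidr//; exact: integrableS iG''.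
  by rewrite restrict_EFin.
- move=> z _; rewrite normrM /patch; have := phih z; rewrite indicE.
  case: ifPn => _; rewrite ?mulr1 ?mulr0 => pz; first by rewrite mulrC ler_wpM2r.
  by rewrite (_ : `|phi z| = 0) ?mulr0//; apply/eqP; rewrite eq_le pz normr_ge0.
Qed.

End WeakShift.

(** * Translation estimates at almost every time *)

Section WeakShiftSlices.
Context {R : realType}.
Implicit Types (lo hi : 'I_3 -> R) (u G : mR4 R -> R).

Lemma ae_mono d (T : measurableType d) (mu : {measure set T -> \bar R}) (P Q : T -> Prop) :
  (forall x, P x -> Q x) -> {ae mu, forall x, P x} -> {ae mu, forall x, Q x}.
Proof.
move=> PQ [N [mN N0 PN]]; exists N; split => // x nQ; apply: PN => /= Px.
exact/nQ/PQ.
Qed.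

Lemma ae_and d (T : measurableType d) (mu : {measure set T -> \bar R}) (P Q : T -> Prop) :
  {ae mu, forall x, P x} -> {ae mu, forall x, Q x} -> {ae mu, forall x, P x /\ Q x}.
Proof.
move=> [N [mN N0 PN]] [M [mM M0 QM]]; exists (N `|` M); split.
- exact: measurableU.
- by rewrite null_set_setU.
- move=> x /= /not_andP[nP|nQ]; [left; exact: PN|right; exact: QM].
Qed.

(** At a Lebesgue point [K x] is the limit of the means over balls about x, and small balls are
    intervals inside ]a, b[. *)
Lemma ae_ge0_itv (a b : R) (K : R -> R) :
  (@lebesgue_measure R).-integrable setT (EFin \o K) ->
  (forall s t, a < s -> s < t -> t < b ->
    0 <= \int[@lebesgue_measure R]_(x in `]s, t[) K x) ->
  {ae leb1, forall x : R, a < x < b -> 0 <= K x}.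
Proof.
move=> iK K0.
have lK : locally_integrable setT K by apply: open_integrable_locally => //; exact: openT.
apply: ae_mono (lebesgue_differentiation lK) => x Kx /andP[ax xb].
pose E (y : R) (n : nat) : set R := ball y n.+1%:R^-1.
have hE y : nicely_shrinking y (E y).
  split; first by move=> n; exact: measurable_ball.
  exists (1, fun n => n.+1%:R^-1%:pos); split => //.
  - exact: cvg_harmonic.
  - by move=> n z.
  - by move=> n; rewrite mul1e.
have xa0 : 0 < x - a by rewrite subr_gt0.
have xb0 : 0 < b - x by rewrite subr_gt0.
have cK := nice_lebesgue_differentiation hE lK Kx.
rewrite -lee_fin; apply: (cvge_to_ge cK); near=> n.
rewrite mule_ge0// ?inve_ge0//.
have Ks : (@lebesgue_measure R).-integrable (E x n) (EFin \o K).
  by apply: integrableS iK => //; exact: measurable_ball.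
rewrite -[X in (0 <= X)%E]fineK ?lee_fin; last first.
  by apply: integrable_fin_num => //; exact: measurable_ball.
rewrite /E ball_itv; apply: K0.
- rewrite ltrBrDl -ltrBrDr; near: n.
  exact: (near_infty_natSinv_lt (PosNum xa0)).
- by rewrite ltrD2l -subr_gt0 opprK addr_gt0.
- rewrite -ltrBrDl; near: n.
  exact: (near_infty_natSinv_lt (PosNum xb0)).
Unshelve. all: by end_near. Qed.

(** Real-valued: the value is 0 at times where the integral is infinite. For integrable [u] these
    times are negligible, which is used in [integral_slice]. *)
Definition slice (A : set (mR3 R)) (u : mR4 R -> R) (t : R) : R :=
  \int[leb3]_(x in A) u (x, t).

Lemma integrable_slice A u : measurable A -> leb4.-integrable setT (EFin \o u) ->
  leb1.-integrable setT (EFin \o slice A u).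
Proof.
move=> mA iu; have iG := integrable_slices mA iu.
apply: le_integrable iG => //.
  apply/measurable_EFinP; apply: (measurableT_comp (f := fine)) => //.
  exact: measurable_int (integrable_slices mA iu).
have le_fine (x : \bar R) : (`|(fine x)%:E| <= `|x|)%E.
  by case: x => [r||] //=; rewrite normr0 leey.
by move=> t _; exact: le_fine.
Qed.

Lemma integral_slice A (L : set (mR1 R)) u : measurable A -> measurable L ->
  leb4.-integrable setT (EFin \o u) ->
  \int[leb4]_(z in A `*` L) u z = \int[leb1]_(t in L) slice A u t.
Proof.
move=> mA mL iu; have iG := integrable_slices mA iu.
rewrite /Rintegral [X in fine X = _](integral_slices mA mL iu); congr fine.
apply: ae_eq_integral => //.
- exact: measurable_funS (measurable_int _ iG).
- exact: measurable_funS (measurable_int _ (integrable_slice mA iu)).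
apply: ae_mono (integrable_ae measurableT iG) => t /(_ I) fin _.
by rewrite /slice /Rintegral /= fineK.
Qed.

(** Integrated over a subinterval ]s, t[ this is [weak_shift]. As the subinterval is arbitrary,
    [ae_ge0_itv] applied to [H - F] and [H + F] yields the estimate pointwise in time. *)
Lemma weak_shift_slices (B : set (mR3 R)) (a b : R) u G (j : 'I_3) lo (h : R) :
  let lo' k := lo k + h * (k == j)%:R in let hi k := lo k + h in
  let hi' k := lo' k + h in
  measurable B -> leb4.-integrable setT (EFin \o u) -> leb4.-integrable setT (EFin \o G) ->
  (forall phi, test_function (B `*` `]a, b[) phi ->
    (\int[leb4]_(z in B `*` `]a, b[) (u z * dx j phi z)%:E =
     - \int[leb4]_(z in B `*` `]a, b[) (G z * phi z)%:E)%E) ->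
  0 <= h -> cbox lo hi' `<=` B ->
  {ae leb1, forall t, a < t < b ->
    `|slice (obox lo' hi') u t - slice (obox lo hi) u t|
    <= h * slice (obox lo hi') (fun z => `|G z|) t}.
Proof.
move=> lo' hi hi' mB iu iG W h0 KB.
have mD : measurable (B `*` `]a, b[ : set (mR4 R)) by exact: measurableX.
have iG' : leb4.-integrable setT (EFin \o (fun z => `|G z|)) by exact: (integrable_abse iG).
have iuD : leb4.-integrable (B `*` `]a, b[) (EFin \o u) by exact: integrableS iu.
have iGD : leb4.-integrable (B `*` `]a, b[) (EFin \o G) by exact: integrableS iG.
pose F t := slice (obox lo' hi') u t - slice (obox lo hi) u t.
pose H t := h * slice (obox lo hi') (fun z => `|G z|) t.
have mo l r : measurable (obox l r : set (mR3 R)) by exact: measurable_obox.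
have iF : leb1.-integrable setT (EFin \o F).
  rewrite (_ : _ \o _ = (EFin \o slice (obox lo' hi') u) \- (EFin \o slice (obox lo hi) u))%E//.
  by apply: integrableB => //; exact: integrable_slice.
have iH : leb1.-integrable setT (EFin \o H).
  rewrite (_ : _ \o _ = (fun t => h%:E * (EFin \o slice (obox lo hi') (fun z => `|G z|%R)) t)%E)//.
  by apply: integrableZl => //; exact: integrable_slice.
have FH s t : a < s -> s < t -> t < b ->
    `|\int[leb1]_(x in `]s, t[) F x| <= \int[leb1]_(x in `]s, t[) H x.
  move=> as_ st tb; have := @weak_shift R _ u G j lo h s t mD iuD iGD W h0.
  rewrite -/lo' -/hi -/hi' !integral_slice// -RintegralB//; last 2 first.
  - by apply: integrableS (integrable_slice _ iu).
  - by apply: integrableS (integrable_slice _ iu).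
  rewrite -RintegralZl//; last by apply: integrableS (integrable_slice _ iG').
  apply => z [zB zt]; split; first exact: KB.
  move: zt; rewrite /= !in_itv/= => /andP[sz zt].
  by rewrite (lt_le_trans as_ sz) (le_lt_trans zt tb).
have iS s t K : leb1.-integrable setT (EFin \o K) -> leb1.-integrable `]s, t[ (EFin \o K).
  by move=> iK; exact: integrableS iK.
have h1 : {ae leb1, forall t : R, a < t < b -> 0 <= H t - F t}.
  apply: ae_ge0_itv.
    rewrite (_ : _ \o _ = (EFin \o H) \- (EFin \o F))%E//.
    exact: integrableB.
  move=> s t as_ st tb; rewrite RintegralB ?subr_ge0//; try exact: iS.
  exact: le_trans (ler_norm _) (FH _ _ as_ st tb).
have h2 : {ae leb1, forall t : R, a < t < b -> 0 <= H t + F t}.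
  apply: ae_ge0_itv.
    rewrite (_ : _ \o _ = (EFin \o H) \+ (EFin \o F))%E//.
    exact: integrableD.
  move=> s t as_ st tb; rewrite RintegralD//; try exact: iS.
  have := FH _ _ as_ st tb; rewrite ler_norml => /andP[+ _].
  by rewrite -subr_ge0 opprK addrC.
apply: ae_mono (ae_and h1 h2) => t [H1 H2] tab.
rewrite ler_norml; have := H1 tab; have := H2 tab.
by rewrite -/(F t) -/(H t); move: (F t) (H t) => x y; lra.
Qed.

End WeakShiftSlices.

(** * Weak convergence of averages *)

Import HBNNSimple.

Section WeakAverages.
Context d (T : measurableType d) (R : realType) (mu : {measure set T -> \bar R}).
Variables (C : set T) (I : nat -> finType) (c : forall n, I n -> set T) (m : nat -> R).
#[local] Arguments c : clear implicits.
Hypotheses (mC : measurable C) (muC : (mu C < +oo)%E).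
Hypothesis mc : forall n i, measurable (c n i).
Hypothesis tc : forall n, trivIset setT (c n).
Hypothesis CE : forall n, C = \bigcup_i c n i.
Hypothesis muc : forall n i, mu (c n i) = (m n)%:E.
Hypothesis m0 : forall n, 0 < m n.
Implicit Types g h u : T -> R.

Definition square_integrable g :=
  measurable_fun C g /\ mu.-integrable C (EFin \o (fun x => g x ^+ 2)).

Let cC n i : c n i `<=` C. Proof. by rewrite (CE n); exact: bigcup_sup. Qed.

Lemma integrable_of_le g h : measurable_fun C g -> mu.-integrable C (EFin \o h) ->
  (forall x, C x -> `|g x| <= `|h x|) -> mu.-integrable C (EFin \o g).
Proof.
move=> mg ih gh; apply: (le_integrable mC _ _ ih) => [|x Cx].
  exact/measurable_EFinP.
by rewrite /= lee_fin gh.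
Qed.

Lemma integrable_cstC (r : R) : mu.-integrable C (EFin \o cst r).
Proof. by apply: measurable_bounded_integrable => //; exact: bounded_cst. Qed.

Lemma integrable_add g h : mu.-integrable C (EFin \o g) -> mu.-integrable C (EFin \o h) ->
  mu.-integrable C (EFin \o (fun x => g x + h x)).
Proof. by move=> ig ih; rewrite (_ : _ \o _ = (EFin \o g) \+ (EFin \o h))%E//; exact: integrableD. Qed.

Lemma integrable_scale (k : R) g : mu.-integrable C (EFin \o g) ->
  mu.-integrable C (EFin \o (fun x => k * g x)).
Proof. by move=> ig; rewrite (_ : _ \o _ = (fun x => k%:E * (EFin \o g) x)%E)//; exact: integrableZl. Qed.

Lemma L2_mul g h : square_integrable g -> square_integrable h ->
  mu.-integrable C (EFin \o (fun x => g x * h x)).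
Proof.
move=> [mg g2] [mh h2]; apply: (@integrable_of_le _ (fun x => g x ^+ 2 + h x ^+ 2)).
- exact: measurable_funM.
- exact: integrable_add.
- move=> x _; rewrite normrM [leRHS]ger0_norm ?addr_ge0 ?sqr_ge0//.
  rewrite -[g x ^+ 2]real_normK ?num_real// -[h x ^+ 2]real_normK ?num_real//.
  move: `|g x| `|h x| (normr_ge0 (g x)) (normr_ge0 (h x)) => a b a0 b0.
  have := sqr_ge0 (a - b); have := sqr_ge0 (a + b); nra.
Qed.

Lemma L2_cst (r : R) : square_integrable (cst r).
Proof. by split => //; exact: (integrable_cstC (r ^+ 2)). Qed.

Lemma L2_integrable g : square_integrable g -> mu.-integrable C (EFin \o g).
Proof.
move=> gL; have := L2_mul gL (L2_cst 1).
by rewrite (_ : (fun x => _) = g)//; apply/funext => x; rewrite mulr1.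
Qed.

Lemma L2D g h : square_integrable g -> square_integrable h ->
  square_integrable (fun x => g x + h x).
Proof.
move=> gL hL; split; first by apply: measurable_funD; [exact: gL.1|exact: hL.1].
rewrite (_ : (fun x => _) = (fun x => g x ^+ 2 + (2 * (g x * h x) + h x ^+ 2))).
  apply: integrable_add; first exact: gL.2.
  by apply: integrable_add; [apply: integrable_scale; exact: L2_mul|exact: hL.2].
by apply/funext => x; ring.
Qed.

Lemma L2Z (k : R) g : square_integrable g -> square_integrable (fun x => k * g x).
Proof.
move=> gL; split; first by apply: measurable_funM => //; exact: gL.1.
rewrite (_ : (fun x => _) = (fun x => k ^+ 2 * (g x ^+ 2))).
  by apply: integrable_scale; exact: gL.2.
by apply/funext => x; ring.
Qed.

Lemma L2_indic (E : set T) : measurable E -> square_integrable (\1_E).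
Proof.
move=> mE; split; first exact: measurable_indic.
apply: (@integrable_of_le _ (cst 1)); last 2 first.
- exact: integrable_cstC.
- by move=> x _; rewrite indicE normr1 normrX exprn_ile1//= normr_nat lern1 leq_b1.
- by apply: measurable_funX; exact: measurable_indic.
Qed.

Let cell_integrable n i g : mu.-integrable C (EFin \o g) -> mu.-integrable (c n i) (EFin \o g).
Proof. by move=> ig; apply: integrableS ig => //; exact: cC. Qed.

Lemma sum_cells n g : mu.-integrable C (EFin \o g) ->
  \int[mu]_(x in C) g x = \sum_i \int[mu]_(x in c n i) g x.
Proof.
move=> ig; have CE' : C = \big[setU/set0]_(i <- index_enum (I n)) c n i.
  rewrite (CE n) -bigcup_seq; apply: eq_bigcupl; split => i //= _.
  exact: mem_index_enum.
rewrite [in LHS]/Rintegral [in LHS]CE' integral_bigsetU_EFin//; last 3 first.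
- exact: index_enum_uniq.
- exact: (sub_trivIset (@subsetT _ _) (@tc n)).
- by rewrite -CE'; exact: measurable_int ig.
rewrite -sum_fine// => i _; apply: integrable_fin_num => //.
exact: cell_integrable.
Qed.

(** The variance of [g] on the cell is nonnegative: the integral of (g - b) ^ 2 is expanded with b
    the mean. *)
Lemma sqr_mean_le n i g : square_integrable g ->
  (\int[mu]_(x in c n i) g x) ^+ 2 <= m n * \int[mu]_(x in c n i) g x ^+ 2.
Proof.
move=> gL; have ig := cell_integrable i (L2_integrable gL).
have ig2 := cell_integrable i gL.2.
set A := \int[mu]_(x in c n i) g x; set B := \int[mu]_(x in c n i) g x ^+ 2.
pose b := A / m n.
have ib : mu.-integrable (c n i) (EFin \o cst (b ^+ 2)).
  by apply: cell_integrable; exact: integrable_cstC.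
have igb : mu.-integrable (c n i) (EFin \o (fun x => 2 * b * g x)).
  by apply: cell_integrable; apply: integrable_scale; exact: L2_integrable.
have igg : mu.-integrable (c n i) (EFin \o (fun x => g x ^+ 2 - 2 * b * g x)).
  have i1 := integrable_scale (- (2 * b)) (L2_integrable gL).
  have := cell_integrable i (integrable_add gL.2 i1).
  by under eq_fun do rewrite mulNr.
have : 0 <= \int[mu]_(x in c n i) (g x - b) ^+ 2.
  by apply: Rintegral_ge0 => x _; exact: sqr_ge0.
have -> : \int[mu]_(x in c n i) (g x - b) ^+ 2 = B - 2 * b * A + b ^+ 2 * m n.
  transitivity (\int[mu]_(x in c n i) ((g x ^+ 2 - 2 * b * g x) + cst (b ^+ 2) x)).
    by apply: eq_Rintegral => x _ /=; ring.
  by rewrite RintegralD// RintegralB// RintegralZl// Rintegral_cst// muc.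
have mn0 : m n != 0 by rewrite gt_eqF.
rewrite (_ : _ + _ = B - A ^+ 2 / m n); last by rewrite /b; field.
by rewrite subr_ge0 ler_pdivrMr// mulrC.
Qed.

Variable u : T -> R.
Hypothesis uL : square_integrable u.

Definition average n (i : I n) : R := (\int[mu]_(x in c n i) u x) / m n.

#[local] Arguments average : clear implicits.

(** The integral over [C] of [g] times the difference between the step function of the averages at
    level n and [u]. *)
Definition defect n g : R :=
  \sum_i average n i * \int[mu]_(x in c n i) g x - \int[mu]_(x in C) (u x * g x).

(** Young's inequality with weight e, combined on each cell with [sqr_mean_le]. The bound does not
    depend on n. *)
Lemma defect_le n g (e : R) : square_integrable g -> 0 < e ->
  `|defect n g| <= e * \int[mu]_(x in C) u x ^+ 2 + e^-1 * \int[mu]_(x in C) g x ^+ 2.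
Proof.
move=> gL e0.
have young (a b : R) : `|a * b| <= (e * a ^+ 2 + e^-1 * b ^+ 2) / 2.
  rewrite normrM -[a ^+ 2]real_normK ?num_real// -[b ^+ 2]real_normK ?num_real//.
  rewrite -subr_ge0 (_ : _ - _ = e / 2 * (`|a| - e^-1 * `|b|) ^+ 2).
    by rewrite mulr_ge0 ?sqr_ge0 ?divr_ge0// ltW.
  by field; rewrite gt_eqF.
set U := \int[mu]_(x in C) u x ^+ 2; set G := \int[mu]_(x in C) g x ^+ 2.
have h1 : `|\sum_i average n i * \int[mu]_(x in c n i) g x| <= (e * U + e^-1 * G) / 2.
  rewrite /U /G (sum_cells n uL.2) (sum_cells n gL.2) !mulr_sumr -big_split mulr_suml /=.
  apply: le_trans (ler_norm_sum _ _ _) _; apply: ler_sum => i _.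
  have mn0 : m n != 0 by rewrite gt_eqF.
  rewrite -[X in `|_ * X|](divfK mn0) mulrCA mulrA.
  rewrite [X in `|X|](_ : _ = (average n i * m n) * ((\int[mu]_(x in c n i) g x) / m n)); last first.
    by rewrite /average; field.
  rewrite /average divfK//.
  set a := \int[mu]_(x in c n i) u x; set b := \int[mu]_(x in c n i) g x.
  have ua : a ^+ 2 <= m n * \int[mu]_(x in c n i) u x ^+ 2 by exact: sqr_mean_le.
  have gb : b ^+ 2 <= m n * \int[mu]_(x in c n i) g x ^+ 2 by exact: sqr_mean_le.
  rewrite mulrA normrM [ `|(m n)^-1|]gtr0_norm ?invr_gt0//.
  rewrite ler_pdivrMr//; apply: le_trans (young a b) _.
  rewrite mulrAC ler_pM2r ?invr_gt0// mulrDl.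
  by rewrite lerD// -mulrA ler_pM2l ?invr_gt0// mulrC.
have h2 : `|\int[mu]_(x in C) (u x * g x)| <= (e * U + e^-1 * G) / 2.
  have iug := L2_mul uL gL.
  apply: le_trans (le_normr_Rintegral mC iug) _.
  have i1 := integrable_scale e uL.2; have i2 := integrable_scale e^-1 gL.2.
  rewrite /U /G -RintegralZl//; last exact: uL.2.
  rewrite -RintegralZl//; last exact: gL.2.
  rewrite -RintegralD// -RintegralZr//; last exact: integrable_add.
  apply: le_Rintegral => //.
  - exact: (integrable_abse iug).
  - rewrite (_ : (fun x => _) = (fun x => 2^-1 * (e * u x ^+ 2 + e^-1 * g x ^+ 2))).
      by apply: integrable_scale; exact: integrable_add.
    by apply/funext => x; rewrite mulrC.
apply: le_trans (ler_normB _ _) _.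
by apply: le_trans (lerD h1 h2) _; rewrite -splitr.
Qed.

Lemma defectD n g h : square_integrable g -> square_integrable h ->
  defect n (fun x => g x + h x) = defect n g + defect n h.
Proof.
move=> gL hL; rewrite /defect.
have -> : \sum_i average n i * \int[mu]_(x in c n i) (g x + h x) =
    \sum_i average n i * \int[mu]_(x in c n i) g x
    + \sum_i average n i * \int[mu]_(x in c n i) h x.
  rewrite -big_split; apply: eq_bigr => i _ /=; rewrite -mulrDr; congr (_ * _).
  by rewrite RintegralD//; apply: cell_integrable; exact: L2_integrable.
under [X in _ - X = _]eq_Rintegral do rewrite mulrDr.
by rewrite RintegralD//; [ring|exact: L2_mul|exact: L2_mul].
Qed.

Lemma defectZ n k g : square_integrable g -> defect n (fun x => k * g x) = k * defect n g.
Proof.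
move=> gL; rewrite /defect mulrBr; congr (_ - _).
  rewrite mulr_sumr; apply: eq_bigr => i _.
  by rewrite (RintegralZl k (mc i) (cell_integrable i (L2_integrable gL))) mulrCA.
rewrite -(RintegralZl k mC (L2_mul uL gL)).
by apply: eq_Rintegral => x _; rewrite mulrCA.
Qed.

Definition averages_converge g := defect n g @[n --> \oo] --> 0.

Lemma averages_convergeD g h : square_integrable g -> square_integrable h ->
  averages_converge g -> averages_converge h -> averages_converge (fun x => g x + h x).
Proof.
move=> gL hL g0 h0; rewrite /averages_converge.
rewrite (_ : (fun n => _) = (fun n => defect n g + defect n h)); last first.
  by apply/funext => n; rewrite defectD.
by have := cvgD g0 h0; rewrite addr0; exact.
Qed.

Lemma averages_convergeZ k g : square_integrable g ->
  averages_converge g -> averages_converge (fun x => k * g x).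
Proof.
move=> gL g0; rewrite /averages_converge.
rewrite (_ : (fun n => _) = (fun n => k * defect n g)); last first.
  by apply/funext => n; rewrite defectZ.
by have := @cvgMr _ _ _ _ _ k _ g0; rewrite mulr0; exact.
Qed.

Let indicDl (E F : set T) : F `<=` E -> \1_E = (fun x => \1_F x + \1_(E `\` F) x) :> (T -> R).
Proof.
move=> FE; apply/funext => x; rewrite !indicE in_setD.
have [xF|xF] := boolP (x \in F); last by rewrite add0r andbT.
by rewrite mem_set ?andbF ?addr0//; apply: FE; exact: set_mem.
Qed.

Lemma averages_convergeDs (E F : set T) : measurable E -> measurable F -> F `<=` E ->
  averages_converge \1_E -> averages_converge \1_F -> averages_converge \1_(E `\` F).
Proof.
move=> mE mF FE cE cF.
rewrite (_ : \1_(E `\` F) = (fun x => \1_E x + -1 * \1_F x)); last first.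
  by rewrite (indicDl FE); apply/funext => x /=; ring.
by apply: averages_convergeD => //; [exact: L2_indic|apply: L2Z; exact: L2_indic|
  apply: averages_convergeZ => //; exact: L2_indic].
Qed.

Lemma averages_converge_setT : averages_converge \1_setT.
Proof.
rewrite /averages_converge (_ : (fun n => _) = cst 0); first exact: cvg_cst.
apply/funext => n; apply/eqP; rewrite subr_eq0; apply/eqP.
transitivity (\int[mu]_(x in C) u x); last first.
  by apply: eq_Rintegral => x _; rewrite indicT mulr1.
rewrite (sum_cells n (L2_integrable uL)); apply: eq_bigr => i _.
under eq_Rintegral do rewrite indicT.
by rewrite Rintegral_cst// muc /= mul1r divfK// gt_eqF.
Qed.

(** Continuity of the defect at 0 in the L2 norm, uniformly in n. The uniformity allows limits of
    sets to be exchanged with the refinement of the grid. *)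
Lemma defect_small (e : R) : 0 < e -> exists2 r, 0 < r &
  forall n g, square_integrable g -> \int[mu]_(x in C) g x ^+ 2 < r -> `|defect n g| < e.
Proof.
move=> e0; set U := \int[mu]_(x in C) u x ^+ 2.
have U0 : 0 <= U by apply: Rintegral_ge0 => x _; exact: sqr_ge0.
(* [U + 1] keeps the divisor positive even when [U] is 0; [b * U] is at most e / 2. *)
pose b := e / (2 * (U + 1)).
have b0 : 0 < b by rewrite divr_gt0 ?mulr_gt0 ?ltr_wpDl.
exists (b * (e / 2)); first by apply: mulr_gt0 => //; exact: divr_gt0.
move=> n g gL gr; apply: le_lt_trans (defect_le n gL b0) _.
rewrite -/U [ltRHS]splitr; apply: ler_ltD; last by rewrite ltr_pdivrMl//.
have U1 : 0 < U + 1 by rewrite ltr_wpDl.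
rewrite (_ : b * U = e / 2 * (U / (U + 1))); last by rewrite /b; field; rewrite gt_eqF.
by apply: ler_piMr; [rewrite divr_ge0// ltW|rewrite ler_pdivrMr// mul1r lerDl].
Qed.

Lemma cvg_measure_exhaustion (E : set T) (F : nat -> set T) : measurable E ->
  (forall n, measurable (F n)) -> (forall x, E x -> \forall n \near \oo, F n x) ->
  \int[mu]_(x in C) (\1_(E `\` F n) x) ^+ 2 @[n --> \oo] --> 0.
Proof.
move=> mE mF EF.
have [||||| _ _ h] := @dominated_convergence _ _ _ mu C mC
  (fun n x => (((\1_(E `\` F n) : T -> R) x) ^+ 2)%:E) (cst 0%E) (cst 1%E).
- move=> n; apply/measurable_EFinP/measurable_funX; apply: measurable_indic.
  exact: measurableD.
- exact: measurable_cst.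
- apply: aeW => x Cx; apply: cvg_near_cst.
  have [Ex|nEx] := pselect (E x).
    near=> n; rewrite indicE memNset ?expr0n//= => -[_]; apply.
    by near: n; exact: EF.
  by apply: nearW => n; rewrite indicE memNset ?expr0n//= => -[].
- exact: integrable_cstC.
- apply: aeW => x n _; rewrite /= lee_fin indicE.
  by case: (x \in _); rewrite ?expr1n ?expr0n ?normr1 ?normr0.
rewrite integral0 in h; exact: (fine_cvg h).
Unshelve. all: by end_near. Qed.

Let indic_split n (E F : set T) : measurable E -> measurable F -> F `<=` E ->
  defect n \1_E = defect n \1_F + defect n \1_(E `\` F).
Proof.
move=> mE mF FE; rewrite (indicDl FE) defectD//; apply: L2_indic => //.
exact: measurableD.
Qed.

(** On a union of cells the defect vanishes exactly; the part of [E] left out by [F n] has measure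
    tending to 0 within [C] and falls under [defect_small]. *)
Lemma averages_converge_adapted (E : set T) (F : nat -> set T) : measurable E ->
  (forall n, measurable (F n)) -> (forall n, F n `<=` E) ->
  (forall x, E x -> \forall n \near \oo, F n x) ->
  (forall n i, c n i `<=` F n \/ c n i `&` F n = set0) ->
  averages_converge \1_E.
Proof.
move=> mE mF FE EF adapted.
have F0 n : defect n \1_(F n) = 0.
  apply/eqP; rewrite subr_eq0; apply/eqP.
  rewrite (sum_cells n (L2_mul uL (L2_indic (mF n)))); apply: eq_bigr => i _.
  have [cF|cF] := adapted n i.
    have E1 x : x \in c n i -> \1_(F n) x = 1 :> R.
      by move=> xc; rewrite indicE mem_set//; apply: cF; exact: set_mem.
    have -> : \int[mu]_(x in c n i) \1_(F n) x = \int[mu]_(x in c n i) cst 1 x.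
      by apply: eq_Rintegral => x xc; rewrite E1.
    have -> : \int[mu]_(x in c n i) (u x * \1_(F n) x) = \int[mu]_(x in c n i) u x.
      by apply: eq_Rintegral => x xc; rewrite E1// mulr1.
    by rewrite Rintegral_cst// muc mul1r /average divfK// gt_eqF.
  have E0 x : x \in c n i -> \1_(F n) x = 0 :> R.
    move=> /set_mem xc; rewrite indicE memNset// => xF.
    by rewrite -[False]/(set0 x) -cF.
  have -> : \int[mu]_(x in c n i) \1_(F n) x = \int[mu]_(x in c n i) cst 0 x.
    by apply: eq_Rintegral => x xc; rewrite E0.
  have -> : \int[mu]_(x in c n i) (u x * \1_(F n) x) = \int[mu]_(x in c n i) cst 0 x.
    by apply: eq_Rintegral => x xc; rewrite E0// mulr0.
  by rewrite !Rintegral_cst// !mul0r mulr0.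
apply/cvgr0Pnorm_lt => e e0; have [r r0 small] := defect_small e0.
have := cvg_measure_exhaustion mE mF EF.
move=> /cvgr0Pnorm_lt/(_ r r0); apply: filterS => n nr.
rewrite (indic_split n mE (mF n) (FE n)) F0 add0r; apply: small.
  by apply: L2_indic; exact: measurableD.
exact: le_lt_trans (ler_norm _) nr.
Qed.

(** An index j is fixed for which the part missed by [F j] has small defect at all levels n at once;
    only then does n tend to infinity. *)
Lemma averages_converge_bigcup (F : nat -> set T) : (forall n, measurable (F n)) ->
  nondecreasing_seq F -> (forall n, averages_converge \1_(F n)) ->
  averages_converge \1_(\bigcup_n F n).
Proof.
move=> mF ndF cF; set E := \bigcup_n F n.
have mE : measurable E by exact: bigcupT_measurable.
have FE n : F n `<=` E by exact: bigcup_sup.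
have EF x : E x -> \forall n \near \oo, F n x.
  move=> [k _ Fk]; near=> n; have kn : (k <= n)%N by near: n; exact: nbhs_infty_ge.
  by have /subsetPset := ndF k n kn; apply.
apply/cvgr0Pnorm_lt => e e0; have e20 : 0 < e / 2 by rewrite divr_gt0.
have [r r0 small] := defect_small e20.
have := cvg_measure_exhaustion mE mF EF.
move=> /cvgr0Pnorm_lt/(_ r r0)[j _ /(_ j (leqnn j)) /= jr].
have := cF j; move=> /cvgr0Pnorm_lt/(_ _ e20); apply: filterS => n ne.
rewrite (indic_split n mE (mF j) (FE j)) [e]splitr.
apply: le_lt_trans (ler_normD _ _) _; apply: ltrD ne _; apply: small.
  by apply: L2_indic; exact: measurableD.
exact: le_lt_trans (ler_norm _) jr.
Unshelve. all: by end_near. Qed.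

Lemma averages_converge_lambda_system :
  lambda_system setT [set E | measurable E /\ averages_converge \1_E].
Proof.
split => //.
- by split => //; exact: averages_converge_setT.
- move=> E F FE [mE cE] [mF cF]; split; first exact: measurableD.
  exact: averages_convergeDs.
- move=> F ndF cF; split; first by apply: bigcupT_measurable => n; have [] := cF n.
  by apply: averages_converge_bigcup => // n; have [] := cF n.
Qed.

Lemma L2_sum (r : seq R) (F : R -> R) (A : R -> set T) : (forall y, measurable (A y)) ->
  square_integrable (fun x => \sum_(y <- r) F y * \1_(A y) x).
Proof.
move=> mA; elim: r => [|y r IH].
  by under eq_fun do rewrite big_nil; exact: L2_cst.
under eq_fun do rewrite big_cons.
by apply: L2D => //; apply: L2Z; exact: L2_indic.
Qed.

Lemma nnsfun_sum (phi : {nnsfun T >-> R}) (F : R -> R) :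
  (fun x => F (phi x)) =
  (fun x => \sum_(y <- fset_set (range phi)) F y * \1_(phi @^-1` [set y]) x).
Proof.
apply/funext => x.
have phix : phi x \in fset_set (range phi).
  by rewrite in_fset_set//; apply/mem_set; exists x.
rewrite (bigD1_seq (phi x))//= ?fset_uniq// indicE mem_set// mulr1 big1 ?addr0// => y yx.
by rewrite indicE memNset ?mulr0//= => xy; rewrite xy eqxx in yx.
Qed.

Lemma L2_nnsfun (phi : {nnsfun T >-> R}) (F : R -> R) : square_integrable (fun x => F (phi x)).
Proof. by rewrite nnsfun_sum; apply: L2_sum. Qed.

(** Duality with simple functions. For simple [phi k] increasing to |u| and [g] equal to sign(u)
    (phi k) ^ 5, the integral K of (phi k) ^ 6 is at most that of u g. Convergence of the averages
    and Young's inequality bound the latter by M / 6 + 5 K / 6. As K is finite it can be absorbed,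
    and monotone convergence concludes. *)
Lemma sixth_power_le (M : R) :
  (forall E, measurable E -> averages_converge \1_E) ->
  (forall n, m n * \sum_i average n i ^+ 6 <= M) ->
  (\int[mu]_(x in C) (u x ^+ 6)%:E <= M%:E)%E.
Proof.
move=> cE avgM.
have mu_ : measurable_fun C u := uL.1.
have mabs : measurable_fun C (fun x => (`|u x|)%:E).
  by apply/measurable_EFinP; apply: measurableT_comp.
pose phi := nnsfun_approx mC mabs.
have abs0 x : C x -> (0 <= (`|u x|)%:E)%E by move=> _; rewrite lee_fin.
have phi_cvg x : C x -> (phi k x)%:E @[k --> \oo] --> (`|u x|)%:E.
  by move=> Cx; exact: cvg_nnsfun_approx.
have phi_le k x : C x -> phi k x <= `|u x|.
  by move=> Cx; rewrite -lee_fin /phi nnsfun_approxE; exact: le_approx.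
have phi0 k x : 0 <= phi k x by exact: fun_ge0.
pose P := C `&` u @^-1` `[0, +oo[.
have mP : measurable P by exact: mu_.
have seqC (r : seq R) (F : R -> R) (A : R -> set T) : (forall y, measurable (A y)) ->
    averages_converge (fun x => \sum_(y <- r) F y * \1_(A y) x).
  move=> mA; elim: r => [|y r IH].
    rewrite (_ : (fun x => _) = (fun x => 0 * \1_setT x)).
      by apply: averages_convergeZ; [exact: L2_indic|exact: averages_converge_setT].
    by apply/funext => x; rewrite big_nil mul0r.
  under eq_fun do rewrite big_cons.
  apply: averages_convergeD => //.
  - by apply: L2Z; exact: L2_indic.
  - exact: L2_sum.
  - by apply: averages_convergeZ; [exact: L2_indic|exact: cE].
have phi6 k : \int[mu]_(x in C) (phi k x) ^+ 6 <= M.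
  pose r : seq R := fset_set (range (phi k)).
  pose A y := phi k @^-1` [set y].
  have mA y : measurable (A y) by rewrite /A.
  (* The sign of u is written as twice the indicator of [P] minus 1, which makes [g] a finite
     combination of indicators. *)
  pose g x := 2 * (\sum_(y <- r) y ^+ 5 * \1_(A y `&` P) x)
              + -1 * \sum_(y <- r) y ^+ 5 * \1_(A y) x.
  have gL : square_integrable g.
    by apply: L2D; apply: L2Z; apply: L2_sum => // y; exact: measurableI.
  have gC : averages_converge g.
    apply: averages_convergeD; try (apply: L2Z; apply: L2_sum => // y; exact: measurableI).
      apply: averages_convergeZ; first by apply: L2_sum => // y; exact: measurableI.
      by apply: seqC => y; exact: measurableI.
    by apply: averages_convergeZ; [exact: L2_sum|exact: seqC].
  have gE x : C x -> g x = phi k x ^+ 5 * (if 0 <= u x then 1 else -1).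
    move=> Cx.
    have E1 : \sum_(y <- r) y ^+ 5 * \1_(A y) x = phi k x ^+ 5.
      by have := nnsfun_sum (phi k) (fun y => y ^+ 5); move=> /(congr1 (@^~ x)) ->.
    rewrite /g E1.
    have -> : \sum_(y <- r) y ^+ 5 * \1_(A y `&` P) x = phi k x ^+ 5 * \1_P x.
      rewrite -E1 mulr_suml; apply: eq_bigr => y _.
      by rewrite -mulrA !indicE in_setI; case: (x \in A y); case: (x \in P); rewrite /= ?mulr1 ?mulr0.
    rewrite indicE; have [u0|u0] := ifPn.
      by rewrite mem_set ?mulr1; [ring|split => //=; rewrite in_itv/= u0].
    rewrite memNset ?mulr0; first by ring.
    by move=> [_]; rewrite /= in_itv/= (negbTE u0).
  have phi6i : mu.-integrable C (EFin \o (fun x => phi k x ^+ 6)).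
    exact: (L2_integrable (L2_nnsfun (phi k) (fun y => y ^+ 6))).
  set K := \int[mu]_(x in C) (phi k x) ^+ 6.
  (* Young's inequality with exponents 6 and 6/5. For nonnegative t the difference of the two sides
     is (t - b) ^ 2 times a polynomial with nonnegative coefficients. *)
  have young (a b : R) : 0 <= b -> a * b ^+ 5 <= 6^-1 * a ^+ 6 + 5 / 6 * b ^+ 6.
    move=> b0.
    have h (t : R) : 0 <= t -> t * b ^+ 5 <= 6^-1 * t ^+ 6 + 5 / 6 * b ^+ 6.
      move=> t0; rewrite -subr_ge0.
      rewrite (_ : _ - _ = 6^-1 * ((t - b) ^+ 2 * (t ^+ 4 + 2 * (t ^+ 3 * b)
        + 3 * (t ^+ 2 * b ^+ 2) + 4 * (t * b ^+ 3) + 5 * b ^+ 4))); last by field.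
      apply: mulr_ge0 => //; apply: mulr_ge0; first exact: sqr_ge0.
      have := exprn_ge0 4 b0; have := exprn_ge0 4 t0.
      have := mulr_ge0 (exprn_ge0 3 t0) b0; have := mulr_ge0 (exprn_ge0 2 t0) (exprn_ge0 2 b0).
      have := mulr_ge0 t0 (exprn_ge0 3 b0); lra.
    apply: (@le_trans _ _ (`|a| * b ^+ 5)).
      by rewrite ler_wpM2r ?exprn_ge0// ler_norm.
    by apply: le_trans (h _ (normr_ge0 a)) _; rewrite -normrX ger0_norm// exprn_even_ge0.
  have avg_le n : \sum_i average n i * \int[mu]_(x in c n i) g x <= M / 6 + 5 / 6 * K.
    rewrite /K (sum_cells n phi6i) mulr_sumr.
    apply: (@le_trans _ _ (m n * (\sum_i average n i ^+ 6) / 6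
      + \sum_i 5 / 6 * \int[mu]_(x in c n i) (phi k x) ^+ 6)); last first.
      by rewrite lerD2r ler_pM2r ?invr_gt0.
    rewrite mulr_sumr mulr_suml -big_split; apply: ler_sum => i _ /=.
    have ig := cell_integrable i (L2_integrable gL).
    have ip := cell_integrable i phi6i.
    rewrite -RintegralZl// -[X in _ <= _ + X]RintegralZl//.
    have -> : m n * average n i ^+ 6 / 6 = \int[mu]_(x in c n i) cst (6^-1 * average n i ^+ 6) x.
      by rewrite Rintegral_cst// muc /=; ring.
    have ic : mu.-integrable (c n i) (EFin \o cst (6^-1 * average n i ^+ 6)).
      by apply: cell_integrable; exact: integrable_cstC.
    have ip' : mu.-integrable (c n i) (EFin \o (fun x => 5 / 6 * phi k x ^+ 6)).
      by apply: cell_integrable; exact: integrable_scale.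
    rewrite -RintegralD//; apply: le_Rintegral => //.
    - by apply: cell_integrable; apply: integrable_scale; exact: L2_integrable.
    - apply: cell_integrable; apply: integrable_add; first exact: integrable_cstC.
      exact: integrable_scale.
    - move=> x /cC Cx; rewrite gE//=; case: ifP => _.
        by rewrite mulr1; exact: young.
      rewrite mulrN1 mulrN -mulNr.
      apply: le_trans (young _ _ (phi0 k x)) _.
      by rewrite (_ : (- average n i) ^+ 6 = average n i ^+ 6)//; ring.
  have ug_le : \int[mu]_(x in C) (u x * g x) <= M / 6 + 5 / 6 * K.
    apply/ler_addgt0Pr => e e0.
    have := gC; move=> /cvgr0Pnorm_lt/(_ e e0)[n _ /(_ n (leqnn n)) /=].
    rewrite ltr_norml => /andP[de _]; have := avg_le n; move: de.
    rewrite /defect; move: (\sum_i _) (\int[mu]_(x in C) (u x * g x)) => a b.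
    by move=> h1 h2; lra.
  have K_le : K <= \int[mu]_(x in C) (u x * g x).
    apply: le_Rintegral => //; first exact: L2_mul.
    move=> x Cx; rewrite gE//; have := phi_le k x Cx; have := phi0 k x.
    move: (phi k x) => p p0 pu.
    have -> : u x * (p ^+ 5 * (if 0 <= u x then 1 else -1)) = `|u x| * p ^+ 5.
      case: ifPn => u0; first by rewrite mulr1 ger0_norm.
      by rewrite ltr0_norm ?ltNge//; ring.
    by rewrite exprS ler_wpM2r// exprn_ge0.
  lra.
have nd k : mu.-integrable C (EFin \o (fun x => phi k x ^+ 6)).
  exact: (L2_integrable (L2_nnsfun (phi k) (fun y => y ^+ 6))).
have -> : (\int[mu]_(x in C) (u x ^+ 6)%:E =
    \int[mu]_(x in C) limn (fun k => (phi k x ^+ 6)%:E))%E.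
  apply: eq_integral => x /set_mem Cx; apply/esym/cvg_lim => //.
  have -> : u x ^+ 6 = `|u x| ^+ 6 by rewrite -normrX ger0_norm// exprn_even_ge0.
  apply: cvg_EFin; first exact: nearW.
  have /fine_cvg h := phi_cvg x Cx.
  under eq_fun do rewrite !exprS expr0.
  rewrite !exprS expr0.
  by do 6 (apply: cvgM; first exact: h); exact: cvg_cst.
rewrite monotone_convergence//.
- apply: lime_le.
    apply: ereal_nondecreasing_is_cvgn => k l kl; apply: ge0_le_integral => //.
    + by move=> x _; rewrite lee_fin exprn_ge0.
    + exact: measurable_int (nd k).
    + exact: measurable_int (nd l).
    + move=> x _; rewrite lee_fin ler_pXn2r ?nnegrE//.
      by have /lefP := nd_nnsfun_approx mC mabs kl; apply.
  apply: nearW => k; rewrite -[leLHS]fineK ?lee_fin; first exact: phi6.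
  exact: integrable_fin_num (nd k).
- by move=> k; exact: measurable_int (nd k).
- by move=> k x _; rewrite lee_fin exprn_ge0.
- move=> x _ k l kl; rewrite lee_fin ler_pXn2r ?nnegrE//.
  by have /lefP := nd_nnsfun_approx mC mabs kl; apply.
Qed.

End WeakAverages.

(** * Lambda systems and generators of product sigma-algebras *)

Section Rectangles.

(** The theorem on lambda systems is applied to the first factor with the second fixed, then to the
    second factor, and finally to the measurable rectangles, which are closed under intersection and
    generate the product. *)
Lemma lambda_system_rectangles d1 d2 (T1 : measurableType d1) (T2 : measurableType d2)
    (G1 : set (set T1)) (G2 : set (set T2)) (H : set (set (T1 * T2))) :
  lambda_system setT H -> setI_closed G1 -> setI_closed G2 -> G1 setT -> G2 setT ->
  measurable `<=` <<s G1 >> -> measurable `<=` <<s G2 >> ->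
  (forall A B, G1 A -> G2 B -> H (A `*` B)) -> measurable `<=` H.
Proof.
move=> lH I1 I2 G1T G2T m1 m2 GH; have [_ HT HD HU] := lH.
have step1 A B : measurable A -> G2 B -> H (A `*` B).
  move=> mA GB; suff : <<s G1 >> `<=` [set A | H (A `*` B)] by apply; exact: m1.
  apply: lambda_system_subset => //; last by move=> A' GA'; exact: GH.
  split => //; first exact: GH.
  - move=> X Y YX HX HY; rewrite /= (_ : _ `*` _ = (X `*` B) `\` (Y `*` B)).
      by apply: HD => //; exact: setSX.
    apply/seteqP; split => [[x y] /= [[Xx nYx] By]|[x y] /= [[Xx By] nY]].
      by split => // -[].
    by split => //; split => // Yx; apply: nY.
  - move=> F ndF HF; rewrite /= (_ : _ `*` _ = \bigcup_n (F n `*` B)); last first.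
      apply/seteqP; split => [[x y] [[n _ Fx] By]|[x y] [n _ [Fx By]]].
        by exists n.
      by split => //; exists n.
    apply: HU => // i j ij; apply/subsetPset; apply: setSX => //.
    exact/subsetPset/ndF.
have step2 A B : measurable A -> measurable B -> H (A `*` B).
  move=> mA mB; suff : <<s G2 >> `<=` [set B | H (A `*` B)] by apply; exact: m2.
  apply: lambda_system_subset => //; last by move=> B' GB'; exact: step1.
  split => //; first exact: step1.
  - move=> X Y YX HX HY; rewrite /= (_ : _ `*` _ = (A `*` X) `\` (A `*` Y)).
      by apply: HD => //; exact: setSX.
    apply/seteqP; split => [[x y] /= [Ax [Xy nYy]]|[x y] /= [[Ax Xy] nY]].
      by split => // -[].
    by split => //; split => // Yy; apply: nY.
  - move=> F ndF HF; rewrite /= (_ : _ `*` _ = \bigcup_n (A `*` F n)); last first.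
      apply/seteqP; split => [[x y] [Ax [n _ Fy]]|[x y] [n _ [Ax Fy]]].
        by exists n.
      by split => //; exists n.
    apply: HU => // i j ij; apply/subsetPset; apply: setSX => //.
    exact/subsetPset/ndF.
rewrite measurable_prod_measurableType; apply: lambda_system_subset => //.
  move=> _ _ [A1 mA1 [B1 mB1 <-]] [A2 mA2 [B2 mB2 <-]].
  exists (A1 `&` A2); first exact: measurableI.
  by exists (B1 `&` B2); [exact: measurableI|rewrite setXI].
by move=> _ [A mA [B mB <-]]; exact: step2.
Qed.

Context {R : realType}.

(** The whole line is added because [lambda_system_rectangles] asks for generating families that
    contain it. *)
Definition upper_ray : set (set (mR1 R)) :=
  [set A | A = setT \/ exists x, A = `]x, +oo[%classic].

Lemma upper_rayI : setI_closed upper_ray.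
Proof.
move=> A B [->|[x ->]]; first by rewrite setTI.
move=> [->|[y ->]]; first by rewrite setIT; right; exists x.
right; exists (Num.max x y); apply/seteqP; split => z; rewrite /= !in_itv/= !andbT.
  by move=> [xz yz]; rewrite gt_max xz yz.
by rewrite gt_max => /andP[].
Qed.

Lemma upper_ray_generates : measurable `<=` <<s upper_ray >>.
Proof.
move=> A; rewrite [X in X _ -> _](RGenOInfty.measurableE R).
apply: sub_sigma_algebra2 => B [x ->]; right; by exists x.
Qed.

Lemma upper_ray_measurable A : upper_ray A -> measurable A.
Proof. by move=> [->|[x ->]]. Qed.

Lemma lambda_system_orthants (H : set (set (mR3 R))) : lambda_system setT H ->
  (forall A : 'I_3 -> set R, (forall k, upper_ray (A k)) -> H (prod3 A)) -> measurable `<=` H.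
Proof.
move=> lH HA.
pose G2 : set (set (mR1 R * mR1 R)) := [set A `*` B | A in upper_ray & B in upper_ray].
have I2 : setI_closed G2.
  move=> _ _ [A1 mA1 [B1 mB1 <-]] [A2 mA2 [B2 mB2 <-]].
  exists (A1 `&` A2); first exact: upper_rayI.
  by exists (B1 `&` B2); [exact: upper_rayI|rewrite setXI].
have rT : upper_ray setT by left.
apply: (lambda_system_rectangles lH I2 upper_rayI) => //.
- by exists setT => //; exists setT => //; rewrite setXTT.
- apply: (lambda_system_rectangles _ upper_rayI upper_rayI) => //.
  + exact: g_sigma_algebra_lambda_system.
  + exact: upper_ray_generates.
  + exact: upper_ray_generates.
  + by move=> A B rA rB; apply: sub_sigma_algebra; exists A => //; exists B.
- exact: upper_ray_generates.
move=> _ B [A0 rA0 [A1 rA1 <-]] rB.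
pose A (k : 'I_3) := match val k with 0%N => A0 | 1%N => A1 | _ => B end.
have := HA A; rewrite prod3E; apply.
by move=> [[|[|[|//]]] k3].
Qed.

End Rectangles.

(** * Sobolev inequality on a cube *)

Section Grid.
Context {R : realType}.
Variable a : R.
Hypothesis a0 : 0 < a.

(** Each edge of the cube is cut into n + 1 pieces, so that level 0 is the cube itself. *)
Definition mesh (n : nat) : R := 2 * a / n.+1%:R.

Lemma mesh_gt0 n : 0 < mesh n.
Proof. by rewrite divr_gt0// mulr_gt0. Qed.

Lemma mesh_total n : n.+1%:R * mesh n = 2 * a.
Proof. by rewrite /mesh mulrC divfK// pnatr_eq0. Qed.

Definition node n (i : nat) : R := - a + i%:R * mesh n.

Lemma nodeS n i : node n i.+1 = node n i + mesh n.
Proof. by rewrite /node -natr1; ring. Qed.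

Lemma le_node n i j : (i <= j)%N -> node n i <= node n j.
Proof. by move=> ij; rewrite lerD2l ler_wpM2r ?ler_nat// ltW ?mesh_gt0. Qed.

Lemma node_cover n x : - a <= x < a -> exists i : 'I_n.+1, node n i <= x < node n i + mesh n.
Proof.
move=> /andP[ax xa]; pose y := (x + a) / mesh n.
have y0 : 0 <= y by rewrite divr_ge0 ?(ltW (mesh_gt0 n))//; lra.
have /andP[ty yt] := truncn_itv y0.
have yN : (Num.truncn y < n.+1)%N.
  rewrite -(@ltr_nat R); apply: le_lt_trans ty _.
  by rewrite ltr_pdivrMr ?mesh_gt0// mesh_total; lra.
exists (Ordinal yN); rewrite /= -nodeS /node.
rewrite -lerBrDl -ltrBlDl -ler_pdivlMr ?mesh_gt0// -ltr_pdivrMr ?mesh_gt0//.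
by rewrite opprK ty yt.
Qed.

Lemma node_disjoint n i j x : node n i <= x < node n i + mesh n ->
  node n j <= x < node n j + mesh n -> i = j.
Proof.
move=> /andP[ix xi] /andP[jx xj]; apply/eqP; rewrite eqn_leq; apply/andP.
split; rewrite leqNgt; apply/negP => ij; have := le_node n ij; rewrite nodeS; lra.
Qed.

Definition idx3 (i j k : nat) (d : 'I_3) : nat :=
  match val d with 0%N => i | 1%N => j | _ => k end.

Definition gcell n (i j k : nat) : set (mR3 R) :=
  hbox (fun d => node n (idx3 i j k d)) (fun d => node n (idx3 i j k d) + mesh n).

Definition gcube : set (mR3 R) := hbox (fun=> - a) (fun=> a).

Lemma measurable_gcell n i j k : measurable (gcell n i j k).
Proof. exact: measurable_hbox. Qed.

Lemma leb3_gcell n i j k : leb3 (gcell n i j k) = (mesh n ^+ 3)%:E.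
Proof.
rewrite /gcell leb3_hbox => [|d]; last by rewrite lerDl; exact: ltW (mesh_gt0 n).
by rewrite !big_ord_recl big_ord0; congr EFin; ring.
Qed.

Definition pcell n (p : 'I_n.+1 * 'I_n.+1 * 'I_n.+1) := gcell n p.1.1 p.1.2 p.2.

Lemma trivIset_pcell n : trivIset setT (@pcell n).
Proof.
move=> [[i j] k] [[i' j'] k'] _ _ [x [xp xq]].
have E d : idx3 i j k d = idx3 i' j' k' d.
  apply: (@node_disjoint n _ _ (coord x d)).
    by have := xp d; rewrite /= in_itv.
  by have := xq d; rewrite /= in_itv.
congr (_, _, _); apply/val_inj.
- exact: (E ord0).
- exact: (E (lift ord0 ord0)).
- exact: (E (lift ord0 (lift ord0 ord0))).
Qed.

Lemma gcube_pcells n : gcube = \bigcup_p @pcell n p.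
Proof.
apply/seteqP; split => [x xC|x [[[i j] k] _ xp] d].
  have N d : exists i : 'I_n.+1, node n i <= coord x d < node n i + mesh n.
    by have := xC d; rewrite /= in_itv/= => /(@node_cover n).
  have [i xi] := N ord0; have [j xj] := N (lift ord0 ord0).
  have [k xk] := N (lift ord0 (lift ord0 ord0)).
  exists (i, j, k) => // -[[|[|[|//]]] d3]; rewrite /= in_itv/= /idx3 /=.
  - exact: xi.
  - exact: xj.
  - exact: xk.
have := xp d; rewrite /= !in_itv/= => /andP[l r].
have lt_idx : (idx3 i j k d < n.+1)%N by case: d {l r} => [[|[|[|//]]] d3]; rewrite /idx3 /= ltn_ord.
rewrite (le_trans _ l)/=; last by rewrite -[leLHS]addr0 lerD2l mulr_ge0// ltW ?mesh_gt0.
apply: lt_le_trans r _; rewrite -nodeS; apply: le_trans (le_node n lt_idx) _.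
by rewrite /node mesh_total; lra.
Qed.

Lemma leb3_gcube : leb3 gcube = ((2 * a) ^+ 3)%:E.
Proof.
rewrite /gcube leb3_hbox => [|d]; last by rewrite /= ge0_cp ?ltW.
by rewrite !big_ord_recl big_ord0; congr EFin; ring.
Qed.

Lemma cvg_mesh : mesh n @[n --> \oo] --> 0.
Proof.
rewrite -[X in _ --> X](mulr0 (2 * a)); apply: cvgMr; exact: cvg_harmonic.
Qed.

(** A ray is exhausted from inside by closed rays starting at grid points; such a ray contains each
    half-open interval of the grid or misses it. *)
Lemma upper_ray_grid (A : set (mR1 R)) : upper_ray A ->
  exists F : nat -> set (mR1 R), [/\ (forall n, measurable (F n)), (forall n, F n `<=` A),
    (forall x, A x -> \forall n \near \oo, F n x) &
    forall n i, (forall x, node n i <= x < node n i + mesh n -> F n x) \/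
                (forall x, node n i <= x < node n i + mesh n -> ~ F n x)].
Proof.
case=> [->|[y ->]].
  by exists (fun=> setT); split => // [x _|n i]; [exact: nearW|left].
(* The first point strictly after y of the grid continued along the whole line; its index is an
   integer that may fall outside the range of the cube. *)
pose e n : R := - a + (Num.floor ((y + a) / mesh n) + 1)%:~R * mesh n.
have ey n : y < e n <= y + mesh n.
  have /andP[l r] := floor_itv ((y + a) / mesh n).
  rewrite ler_pdivlMr ?mesh_gt0// in l; rewrite ltr_pdivrMr ?mesh_gt0// in r.
  rewrite /e; rewrite intrD mulrDl mul1r in r *; lra.
exists (fun n => `[e n, +oo[%classic); split => //.
- move=> n x; rewrite /= !in_itv/= !andbT; have /andP[ye _] := ey n; exact: lt_le_trans.
- move=> x; rewrite /= in_itv/= andbT => yx.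
  have := cvg_mesh => /cvgr0Pnorm_lt/(_ (x - y)).
  rewrite subr_gt0 => /(_ yx); apply: filterS => n.
  rewrite gtr0_norm ?mesh_gt0// => h; rewrite /= in_itv/= andbT.
  have /andP[_ ey'] := ey n; lra.
- move=> n i; set K := (Num.floor ((y + a) / mesh n) + 1).
  have [Ki|iK] := leP K i%:Z.
    left => x /andP[ix _]; rewrite /= in_itv/= andbT; apply: le_trans ix.
    by rewrite /e /node lerD2l ler_wpM2r ?(ltW (mesh_gt0 n))// -/K -[i%:R]/(i%:~R) ler_int.
  right => x /andP[_ xi]; rewrite /= in_itv/= andbT => ex.
  have : e n < node n i.+1 by rewrite nodeS; exact: le_lt_trans xi.
  rewrite /e /node ltrD2l ltr_pM2r ?mesh_gt0// -/K -[i.+1%:R]/(i.+1%:~R) ltr_int.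
  by rewrite ltNge => /negP; apply; move: iK; lia.
Qed.

End Grid.

(** * From the grid to the inequality on the cube *)

Section CubeSobolev.
Context {R : realType}.
Variable a : R.
Hypothesis a0 : 0 < a.
Local Notation C := (gcube a).
Local Notation L2 := (square_integrable leb3 C).

Let mC : measurable (C : set (mR3 R)). Proof. exact: measurable_hbox. Qed.
Let muC : (leb3 C < +oo)%E. Proof. by rewrite leb3_gcube// ltry. Qed.
Let mp n (p : 'I_n.+1 * 'I_n.+1 * 'I_n.+1) : measurable (pcell a p).
Proof. exact: measurable_gcell. Qed.
Let tp n := trivIset_pcell a0 (n := n).
Let CE n := gcube_pcells a0 n.
Let mup n (p : 'I_n.+1 * 'I_n.+1 * 'I_n.+1) : leb3 (pcell a p) = (mesh a n ^+ 3)%:E.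
Proof. exact: leb3_gcell. Qed.
Let m0 n : 0 < mesh a n ^+ 3. Proof. by rewrite exprn_gt0// mesh_gt0. Qed.

(** Orthants generate the measurable sets, and they are exhausted from inside by orthants with faces
    on the grid, for which the defect vanishes. *)
Lemma cube_averages_converge (u : mR3 R -> R) (E : set (mR3 R)) : L2 u -> measurable E ->
  averages_converge leb3 C (@pcell R a) (fun n => mesh a n ^+ 3) u \1_E.
Proof.
move=> uL mE; have lS := averages_converge_lambda_system mC muC mp tp CE mup m0 uL.
suff : measurable `<=` [set E | measurable E /\
    averages_converge leb3 C (@pcell R a) (fun n => mesh a n ^+ 3) u \1_E].
  by move=> /(_ E mE)[].
apply: lambda_system_orthants => // A rA.
have mA : measurable (prod3 A : set (mR3 R)).
  by apply: measurable_prod3 => k; exact: upper_ray_measurable.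
split => //.
have [F FP] := choice (fun k => upper_ray_grid a0 (rA k)).
apply: (averages_converge_adapted mC muC mp tp CE mup m0 uL (F := fun n => prod3 (F ^~ n))) => //.
- by move=> n; apply: measurable_prod3 => k; have [+ _ _ _] := FP k; exact.
- by move=> n x xF k; have [_ + _ _] := FP k; apply; exact: xF.
- move=> x xA.
  have : \forall n \near \oo, forall k : 'I_3, F k n (coord x k).
    apply: filter_forall => k; have [_ _ + _] := FP k; apply; exact: xA.
  by apply: filterS => n.
- move=> n [[i j] k].
  have [[d dF]|nF] := pselect (exists d : 'I_3, forall y,
      node a n (idx3 i j k d) <= y < node a n (idx3 i j k d) + mesh a n -> ~ F d n y).
    right; apply/seteqP; split => // x [xp xF].
    by apply: (dF (coord x d)); [have := xp d; rewrite /= in_itv|exact: xF].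
  left => x xp d; have [_ _ _ /(_ n (idx3 i j k d))] := FP d.
  case=> [h|h]; last by exfalso; apply: nF; exists d.
  by apply: h; have := xp d; rewrite /= in_itv.
Qed.

(** In a given direction each cell belongs to at most two neighbouring pairs; hence the factor 2. *)
Lemma dsum3_le N (e : R) (D g : nat -> nat -> nat -> R) : 0 <= e ->
  (forall i j k, 0 <= g i j k) ->
  (forall i j k, (i < N)%N -> (j < N)%N -> (k.+1 < N)%N ->
    D i j k <= e * (g i j k + g i j k.+1)) ->
  dsum3 N D <= 2 * e * sum3 N g.
Proof.
move=> e0 g0 Dg.
apply: (@le_trans _ _ (\sum_(i < N) \sum_(j < N) (2 * e * \sum_(k < N) g i j k))); last first.
  by rewrite /sum3 mulr_sumr ler_sum// => i _; rewrite mulr_sumr.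
apply: ler_sum => i _; apply: ler_sum => j _.
apply: (@le_trans _ _ (\sum_(k < N | (k.+1 < N)%N) e * (g i j k + g i j k.+1))).
  by apply: ler_sum => k kN; exact: Dg.
rewrite -mulr_sumr big_split /= [2 * e]mulrC -mulrA ler_wpM2l//.
have h1 := shift_sum_le N (g0 i j).
have h2 : \sum_(k < N | (k.+1 < N)%N) g i j k <= \sum_(k < N) g i j k.
  by rewrite big_mkcond /=; apply: ler_sum => k _; case: ifP.
lra.
Qed.

Lemma integral_gcell (u : mR3 R -> R) n i j k : leb3.-integrable C (EFin \o u) ->
  gcell a n i j k `<=` C ->
  \int[leb3]_(x in gcell a n i j k) u x =
  \int[leb3]_(x in obox (fun d => node a n (idx3 i j k d))
     (fun d => node a n (idx3 i j k d) + mesh a n)) u x.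
Proof.
move=> iu cC; rewrite /Rintegral [X in fine X = _]integral_hbox//.
by apply: (integrableS mC _ cC iu); exact: measurable_gcell.
Qed.

Lemma gcell_sub n i j k : (i < n.+1)%N -> (j < n.+1)%N -> (k < n.+1)%N ->
  gcell a n i j k `<=` C.
Proof.
move=> iN jN kN; rewrite (CE n).
exact: (bigcup_sup (i := (Ordinal iN, Ordinal jN, Ordinal kN)) (F := @pcell R a n)).
Qed.

(* Averages over neighbouring cells of the grid play the role of [u] in
   [discrete_sobolev]; they converge weakly to [u]. *)
Lemma sobolev_cube (u : mR3 R -> R) (g : 'I_3 -> mR3 R -> R) (G : R) :
  L2 u -> (forall j, L2 (g j)) ->
  (forall j, \int[leb3]_(x in C) g j x ^+ 2 <= G) ->
  (forall n (i : 'I_3 -> nat) (j : 'I_3),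
    let lo k := node a n (i k) in
    let lo' k := lo k + mesh a n * (k == j)%:R in
    let hi k := lo k + mesh a n in
    let hi' k := lo' k + mesh a n in
    (forall k, (i k + (k == j) < n.+1)%N) ->
    `|\int[leb3]_(x in obox lo' hi') u x - \int[leb3]_(x in obox lo hi) u x|
    <= mesh a n * \int[leb3]_(x in obox lo hi') `|g j x|) ->
  (\int[leb3]_(x in C) (u x ^+ 6)%:E <=
    ((2 * ((\int[leb3]_(x in C) u x ^+ 2) / (2 * a) ^+ 2 + 64 * G)) ^+ 3)%:E)%E.
Proof.
move=> uL gL gG shift.
have iu := L2_integrable mC muC uL.
apply: (sixth_power_le mC muC mp tp CE mup m0 uL).
  by move=> E mE; exact: cube_averages_converge.
move=> n; set h := mesh a n; set U := \int[leb3]_(x in C) u x ^+ 2.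
have h0 : 0 < h by exact: mesh_gt0.
pose f i j k : R := (\int[leb3]_(x in gcell a n i j k) u x) / h ^+ 3.
pose gam (d : 'I_3) i j k : R := \int[leb3]_(x in gcell a n i j k) g d x ^+ 2.
have gam0 d i j k : 0 <= gam d i j k by apply: Rintegral_ge0 => x _; exact: sqr_ge0.
have gam_sum d : sum3 n.+1 (gam d) <= G.
  apply: le_trans (gG d); rewrite (sum_cells mC mp tp CE n (gL d).2).
  by rewrite sum3E.
have f2_sum : sum3 n.+1 (fun i j k => f i j k ^+ 2) <= h ^- 3 * U.
  rewrite /U (sum_cells mC mp tp CE n uL.2) sum3E mulr_sumr; apply: ler_sum => p _.
  rewrite /f expr_div_n ler_pdivrMr ?exprn_gt0//.
  rewrite [leRHS](_ : _ = h ^+ 3 * \int[leb3]_(x in pcell a p) u x ^+ 2).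
    exact: (sqr_mean_le mC muC mp CE mup m0 p uL).
  by rewrite /pcell; field; rewrite gt_eqF.
(* The hypothesis bounds the difference of the two integrals by h times the integral of |g d| over
   both cells. Squaring, Cauchy-Schwarz on each cell gives 2 h ^ 5, and division by h ^ 6 leaves 2 /
   h. *)
have step (d : 'I_3) i j k i' j' k' : (i < n.+1)%N -> (j < n.+1)%N -> (k < n.+1)%N ->
    (forall e, idx3 i' j' k' e = idx3 i j k e + (e == d))%N ->
    (i' < n.+1)%N -> (j' < n.+1)%N -> (k' < n.+1)%N ->
    (f i' j' k' - f i j k) ^+ 2 <= 2 / h * (gam d i j k + gam d i' j' k').
  move=> iN jN kN E iN' jN' kN'.
  have cC := gcell_sub iN jN kN; have cC' := gcell_sub iN' jN' kN'.
  pose p := (Ordinal iN, Ordinal jN, Ordinal kN).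
  pose p' := (Ordinal iN', Ordinal jN', Ordinal kN').
  have Ed k0 : (idx3 i j k k0 + (k0 == d) < n.+1)%N.
    by rewrite -E; case: k0 => [[|[|[|//]]] k3]; rewrite /idx3.
  have := shift n (idx3 i j k) d Ed; rewrite /= -/h.
  set lo := fun k0 => node a n (idx3 i j k k0).
  have loE k0 : lo k0 + h * (k0 == d)%:R = node a n (idx3 i' j' k' k0).
    by rewrite /lo E /node natrD mulrDl addrA [h * _]mulrC.
  have -> : obox (fun k0 => lo k0 + h * (k0 == d)%:R)
      (fun k0 => lo k0 + h * (k0 == d)%:R + h) =
      obox (fun k0 => node a n (idx3 i' j' k' k0)) (fun k0 => node a n (idx3 i' j' k' k0) + h).
    by congr obox; apply/funext => k0; rewrite loE.
  rewrite -(integral_gcell iu cC) -(integral_gcell iu cC').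
  set X := \int[leb3]_(x in gcell a n i' j' k') u x.
  set Y := \int[leb3]_(x in gcell a n i j k) u x => XY.
  have iabs : leb3.-integrable C (EFin \o (fun x => `|g d x|)).
    exact: (integrable_abse (L2_integrable mC muC (gL d))).
  have absL : L2 (fun x => `|g d x|).
    split; first by apply: measurableT_comp => //; exact: (gL d).1.
    rewrite (_ : (fun x => _) = (fun x => g d x ^+ 2)); first exact: (gL d).2.
    by apply/funext => x; rewrite real_normK ?num_real.
  have cell_le i1 j1 k1 (q : 'I_n.+1 * 'I_n.+1 * 'I_n.+1) : pcell a q = gcell a n i1 j1 k1 ->
      (\int[leb3]_(x in gcell a n i1 j1 k1) `|g d x|) ^+ 2 <= h ^+ 3 * gam d i1 j1 k1.
    move=> qE; have := sqr_mean_le mC muC mp CE mup m0 q absL.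
    rewrite qE -/h /gam; congr (_ <= _ * _).
    by apply: eq_Rintegral => x _; rewrite real_normK ?num_real.
  have P1 := @cell_le i j k p erefl; have P2 := @cell_le i' j' k' p' erefl.
  have mG i1 j1 k1 : measurable (gcell a n i1 j1 k1 : set (mR3 R)) by exact: measurable_gcell.
  (* The hull of the two open boxes lies in the union of the two half-open cells, since the wall
     between them belongs to the upper cell. *)
  have cover : \int[leb3]_(x in obox lo (fun k0 => lo k0 + h * (k0 == d)%:R + h)) `|g d x|
      <= \int[leb3]_(x in gcell a n i j k) `|g d x| + \int[leb3]_(x in gcell a n i' j' k') `|g d x|.
    have sub : obox lo (fun k0 => lo k0 + h * (k0 == d)%:R + h) `<=`
        gcell a n i j k `|` gcell a n i' j' k'.
      move=> x xo; have [xd|xd] := ltP (coord x d) (lo d + h); [left|right] => k0;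
        have := xo k0; rewrite /= !in_itv/= -/h.
        rewrite -/(lo k0) => /andP[/ltW -> /=]; case: eqVneq => [->//|_].
        by rewrite mulr0 addr0.
      rewrite -loE => /andP[xl ->]; rewrite andbT; move: xl; case: eqVneq => [->|_].
        by rewrite mulr1.
      by rewrite mulr0 addr0 => /ltW.
    have disj : [disjoint gcell a n i j k & gcell a n i' j' k'].
      apply/disj_setPS => x [xc xc']; have := xc d; have := xc' d.
      rewrite /= !in_itv/= -loE -/(lo d) eqxx mulr1 -/h => /andP[l _] /andP[_ r].
      by move: (le_lt_trans l r); rewrite ltxx.
    have mU : measurable (gcell a n i j k `|` gcell a n i' j' k').
      exact: measurableU.
    have iU : leb3.-integrable (gcell a n i j k `|` gcell a n i' j' k')
        (EFin \o (fun x => `|g d x|)).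
      by apply: integrableS iabs => //; move=> x [/cC|/cC'].
    rewrite -Rintegral_setU//.
    have mo : measurable (obox lo (fun k0 => lo k0 + h * (k0 == d)%:R + h) : set (mR3 R)).
      exact: measurable_obox.
    rewrite /Rintegral fine_le//.
    - by apply: integrable_fin_num => //; exact: integrableS iU.
    - exact: integrable_fin_num.
    - by apply: ge0_subset_integral => //; exact: measurable_int iU.
  move: XY P1 P2 cover.
  set Z := \int[leb3]_(x in obox _ _) _.
  set V := \int[leb3]_(x in gcell a n i j k) _.
  set W := \int[leb3]_(x in gcell a n i' j' k') _ => XY P1 P2 cover.
  have V0 : 0 <= V by apply: Rintegral_ge0 => x _; exact: normr_ge0.
  have W0 : 0 <= W by apply: Rintegral_ge0 => x _; exact: normr_ge0.
  rewrite /f -/X -/Y -mulrBl expr_div_n ler_pdivrMr ?exprn_gt0 ?exprn_gt0//.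
  have XY2 : (X - Y) ^+ 2 <= h ^+ 2 * (V + W) ^+ 2.
    rewrite -exprMn -[leLHS]real_normK ?num_real// ler_pXn2r ?nnegrE//.
      by apply: le_trans XY _; rewrite ler_pM2l.
    by rewrite mulr_ge0 ?addr_ge0// ltW.
  apply: le_trans XY2 _.
  rewrite [leRHS](_ : _ = h ^+ 2 * (2 * (h ^+ 3 * gam d i j k + h ^+ 3 * gam d i' j' k'))).
    rewrite ler_pM2l ?exprn_gt0//; have := sqr_ge0 (V - W); move: P1 P2; lra.
  by field; rewrite gt_eqF.
have N0 : n.+1%:R != 0 :> R by rewrite pnatr_eq0.
have D3 : dsum3 n.+1 (fun i j k => (f i j k.+1 - f i j k) ^+ 2) <= 2 * (2 / h) * G.
  apply: (@le_trans _ _ (2 * (2 / h) * sum3 n.+1 (gam (lift ord0 (lift ord0 ord0))))).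
    apply: dsum3_le => [||i j k iN jN kN]; [by rewrite divr_ge0// ltW|by []|].
    apply: step => //; first exact: ltnW.
    by case=> [[|[|[|//]]] d3]; rewrite /idx3 /= ?addn0 ?addn1.
  by rewrite ler_wpM2l// mulr_ge0// divr_ge0// ltW.
have D2 : dsum3 n.+1 (fun i k j => (f i j.+1 k - f i j k) ^+ 2) <= 2 * (2 / h) * G.
  apply: (@le_trans _ _ (2 * (2 / h) * sum3 n.+1 (fun i k j => gam (lift ord0 ord0) i j k))).
    apply: dsum3_le => [||i k j iN kN jN]; [by rewrite divr_ge0// ltW|by []|].
    apply: step => //; first exact: ltnW.
    by case=> [[|[|[|//]]] d3]; rewrite /idx3 /= ?addn0 ?addn1.
  apply: ler_wpM2l; first by rewrite mulr_ge0// divr_ge0// ltW.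
  apply: le_trans (gam_sum (lift ord0 ord0)); rewrite le_eqVlt; apply/orP; left; apply/eqP.
  by apply: eq_bigr => i _; rewrite exchange_big.
have D1 : dsum3 n.+1 (fun j k i => (f i.+1 j k - f i j k) ^+ 2) <= 2 * (2 / h) * G.
  apply: (@le_trans _ _ (2 * (2 / h) * sum3 n.+1 (fun j k i => gam ord0 i j k))).
    apply: dsum3_le => [||j k i jN kN iN]; [by rewrite divr_ge0// ltW|by []|].
    apply: step => //; first exact: ltnW.
    by case=> [[|[|[|//]]] d3]; rewrite /idx3 /= ?addn0 ?addn1.
  apply: ler_wpM2l; first by rewrite mulr_ge0// divr_ge0// ltW.
  apply: le_trans (gam_sum ord0); rewrite le_eqVlt; apply/orP; left; apply/eqP.
  rewrite [RHS]exchange_big; apply: eq_bigr => j _; by rewrite exchange_big.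
(* 64 is the 16 of [discrete_sobolev] times the 4 in the bounds [D1], [D2], [D3]. The mesh enters
   only through the factor 1 / h, so [h ^+ 3 * K ^+ 3] is the same at all levels: the inequality is
   scale invariant in dimension three. *)
pose K := 2 / h * (U / (2 * a) ^+ 2 + 64 * G).
have KD D : D <= 2 * (2 / h) * G ->
    2 * (sum3 n.+1 (fun i j k => f i j k ^+ 2) / n.+1%:R ^+ 2 + 16 * D) <= K.
  move=> DG.
  have h1 : sum3 n.+1 (fun i j k => f i j k ^+ 2) / n.+1%:R ^+ 2 <= h ^- 3 * U / n.+1%:R ^+ 2.
    by rewrite ler_pM2r ?invr_gt0 ?exprn_gt0.
  have -> : K = 2 * (h ^- 3 * U / n.+1%:R ^+ 2 + 16 * (2 * (2 / h) * G)).
    rewrite /K -(mesh_total a n) -/h; move: (n.+1%:R : R) N0 => k k0; field.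
    by rewrite k0 gt_eqF.
  by rewrite ler_pM2l// lerD// ler_pM2l.
have := @discrete_sobolev R n.+1 f K (KD _ D3) (KD _ D2) (KD _ D1).
rewrite sum3E => S6.
rewrite [leRHS](_ : _ = h ^+ 3 * K ^+ 3); last first.
  by rewrite /K; field; rewrite (gt_eqF h0) (gt_eqF a0).
by rewrite ler_pM2l ?exprn_gt0.
Qed.

End CubeSobolev.

(** * Functions of the energy class *)

Section Balls.
Context {R : realType}.
Implicit Types (x : space3 R) (r : R).

Lemma dotp_sqr x : dotp x x = \sum_(i < 3) coord x i ^+ 2.
Proof. by apply: eq_bigr => i _; rewrite expr2. Qed.

Lemma dotp_ge0 x : 0 <= dotp x x.
Proof. by rewrite dotp_sqr; apply: sumr_ge0 => i _; exact: sqr_ge0. Qed.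

Lemma enorm_ge0 x : 0 <= enorm x.
Proof. exact: sqrtr_ge0. Qed.

Lemma enorm_sqr x : enorm x ^+ 2 = \sum_(i < 3) coord x i ^+ 2.
Proof. by rewrite -dotp_sqr sqr_sqrtr// dotp_ge0. Qed.

Lemma coord_sqr_le x i : coord x i ^+ 2 <= enorm x ^+ 2.
Proof.
rewrite enorm_sqr (bigD1 i)//= lerDl; apply: sumr_ge0 => j _; exact: sqr_ge0.
Qed.

Lemma coord_le_enorm x i : `|coord x i| <= enorm x.
Proof.
rewrite -(@ler_pXn2r _ 2)// ?nnegrE ?enorm_ge0// real_normK ?num_real//.
exact: coord_sqr_le.
Qed.

Lemma measurable_enorm : measurable_fun [set: mR3 R] (@enorm R : mR3 R -> mR1 R).
Proof.
apply: (measurableT_comp (f := (@Num.sqrt R))).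
  by apply: continuous_measurable_fun; exact: sqrt_continuous.
by apply: measurable_sum => i; apply: measurable_funM; exact: measurable_coord.
Qed.

Lemma measurable_ball3 r : measurable (ball3 r : set (mR3 R)).
Proof.
rewrite (_ : ball3 r = setT `&` @enorm R @^-1` `]-oo, r[%classic).
  by apply: measurable_enorm => //; exact: measurable_itv.
by rewrite setTI; apply/seteqP; split => x /=; rewrite in_itv.
Qed.

Lemma ball3_gcube r : ball3 r `<=` gcube r.
Proof.
move=> x; rewrite /ball3 /= => xr k; rewrite /= in_itv/=.
have := le_lt_trans (coord_le_enorm x k) xr; rewrite ltr_norml => /andP[/ltW -> ->]//.
Qed.

(** The corners lie at distance r sqrt(3) / 2 < r from the origin. *)
Lemma gcube_ball3 r : 0 < r ->
  [set x | forall k, - (r / 2) <= coord x k <= r / 2] `<=` ball3 r.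
Proof.
move=> r0 x /= xr; rewrite /ball3 /= -(@ltr_pXn2r _ 2)// ?nnegrE ?enorm_ge0 ?ltW//.
rewrite enorm_sqr; apply: (@le_lt_trans _ _ (\sum_(i < 3) (r / 2) ^+ 2)).
  apply: ler_sum => i _; have /andP[x1 x2] := xr i; nra.
rewrite sumr_const card_ord -mulr_natr.
have : 0 < r ^+ 2 by rewrite exprn_gt0.
lra.
Qed.

Lemma sub_ball3 r r' : r <= r' -> ball3 r `<=` ball3 r'.
Proof. by move=> rr x; rewrite /ball3 /= => /lt_le_trans; apply. Qed.

Lemma leb3_ball3_le r : 0 < r -> (leb3 (ball3 r) <= ((2 * r) ^+ 3)%:E)%E.
Proof.
move=> r0; rewrite -leb3_gcube//; apply: le_measure; last exact: ball3_gcube.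
  by rewrite inE; exact: measurable_ball3.
by rewrite inE; exact: measurable_hbox.
Qed.

Lemma measurable_pcyl r : measurable (pcyl r : set (mR4 R)).
Proof. by apply: measurableX => //; exact: measurable_ball3. Qed.

Lemma leb4_pcyl_lty r : 0 < r -> (leb4 (pcyl r) < +oo)%E.
Proof.
move=> r0; rewrite /pcyl leb4_setX//; last exact: measurable_ball3.
rewrite lebesgue_measure_itv/= lte_fin oppr_lt0 exprn_gt0// -EFinD.
apply: (@le_lt_trans _ _ (((2 * r) ^+ 3)%:E * (0 - - r ^+ 2)%:E)%E); last by rewrite -EFinM ltry.
apply: lee_pmul => //; last exact: leb3_ball3_le.
by rewrite lee_fin sub0r opprK sqr_ge0.
Qed.

Lemma ess_sup_itv_le (a b : R) (f : R -> \bar R) (y : \bar R) :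
  (ess_sup_itv a b f <= y)%E -> {ae leb1, forall t : R, a < t < b -> (f t <= y)%E}.
Proof.
move=> /ess_supP [N [mN N0 fN]]; exists (N `&` `]a, b[); split => //.
  exact: measurableI.
move=> t /= /not_implyP[tab nf]; split; last by rewrite /= in_itv.
by apply: fN.
Qed.

End Balls.

Section EnergyClass.
Context {R : realType}.
Variables (v : spacetime R -> space3 R) (Dv : spacetime R -> 'M[R]_3) (q : spacetime R -> R).
Hypothesis ve : energy_class v Dv q.
Local Notation Q := (pcyl (1 : R) : set (mR4 R)).

Definition vcomp (i : 'I_3) (z : mR4 R) : R := coord (v z) i.
Definition gcomp (i j : 'I_3) (z : mR4 R) : R := Dv z i j.

Let mQ : measurable Q. Proof. exact: measurable_pcyl. Qed.

Lemma measurable_vcomp i : measurable_fun Q (vcomp i).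
Proof.
have [mv _ _ _] := ve; apply: (measurableT_comp (f := coord ^~ i)); last exact: mv.
exact: measurable_coord.
Qed.

Lemma enorm_vcomp z : enorm (v z) ^+ 2 = \sum_(i < 3) vcomp i z ^+ 2.
Proof. exact: enorm_sqr. Qed.

Lemma measurable_enorm_v : measurable_fun Q (fun z => enorm (v z) ^+ 2).
Proof.
under eq_fun do rewrite enorm_vcomp.
by apply: measurable_sum => i; apply: measurable_funX; exact: measurable_vcomp.
Qed.

(** Measurability is given on Q only, so the function is extended by zero before its slices are
    integrated. *)
Lemma integral_pcyl_slices (A : set (mR3 R)) (s t : R) (f : mR4 R -> R) :
  measurable A -> A `*` `]s, t[ `<=` Q -> measurable_fun Q f -> (forall z, 0 <= f z) ->
  (\int[leb4]_(z in A `*` `]s, t[) (f z)%:E =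
   \int[leb1]_(tau in `]s, t[) \int[leb3]_(x in A) (f (x, tau))%:E)%E.
Proof.
move=> mA AQ mf f0.
have mfQ : measurable_fun [set: mR4 R] ((EFin \o f) \_ Q).
  by apply/(measurable_restrictT _ _).1 => //; exact/measurable_EFinP.
have fQ0 z : (0 <= ((EFin \o f) \_ Q) z)%E by apply: erestrict_ge0 => y _; rewrite lee_fin.
transitivity (\int[leb4]_(z in A `*` `]s, t[) ((EFin \o f) \_ Q) z)%E.
  by apply: eq_integral => z /set_mem/AQ zQ; rewrite patchE mem_set.
rewrite (ge0_integral_slices mA (measurable_itv _) mfQ fQ0); apply: eq_integral => tau /set_mem tst.
by apply: eq_integral => x /set_mem Ax; rewrite patchE mem_set//; exact: AQ.
Qed.

Lemma measurable_pcyl_slices (A : set (mR3 R)) (s t : R) (f : mR4 R -> R) :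
  measurable A -> A `*` `]s, t[ `<=` Q -> measurable_fun Q f -> (forall z, 0 <= f z) ->
  measurable_fun (`]s, t[ : set (mR1 R)) (fun tau => \int[leb3]_(x in A) (f (x, tau))%:E)%E.
Proof.
move=> mA AQ mf f0.
have mfQ : measurable_fun [set: mR4 R] ((EFin \o f) \_ Q).
  by apply/(measurable_restrictT _ _).1 => //; exact/measurable_EFinP.
have fQ0 z : (0 <= ((EFin \o f) \_ Q) z)%E by apply: erestrict_ge0 => y _; rewrite lee_fin.
apply: (eq_measurable_fun (fun tau => \int[leb3]_(x in A) ((EFin \o f) \_ Q) (x, tau))%E).
  move=> tau /set_mem tst; apply: eq_integral => x /set_mem Ax.
  by rewrite patchE mem_set//; exact: AQ.
exact: measurable_funS (measurable_ge0_slices mA mfQ fQ0).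
Qed.

Lemma integral_enorm_v_lty : (\int[leb4]_(z in Q) (enorm (v z) ^+ 2)%:E < +oo)%E.
Proof.
have [_ Aoo _ _] := ve.
have : exists2 M : R, 0 <= M & (ess_sup_itv (-1) 0
    (fun t => \int[leb3]_(x in ball3 1) (enorm (v (x, t)) ^+ 2)%:E) <= M%:E)%E.
  move: Aoo; case: (ess_sup_itv _ _ _) => [M _|//|_].
    by exists `|M|; rewrite ?lee_fin ?ler_norm ?normr_ge0.
  by exists 0; rewrite ?leNye.
case=> M M0 /ess_sup_itv_le AM.
have QE : Q = ball3 1 `*` `]-1, 0[ by rewrite /pcyl expr1n.
rewrite QE integral_pcyl_slices//; last 4 first.
- exact: measurable_ball3.
- by rewrite -QE.
- exact: measurable_enorm_v.
- by move=> z; exact: sqr_ge0.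
apply: (@le_lt_trans _ _ (\int[leb1]_(tau in `](-1)%R, 0%R[) M%:E)%E); last first.
  rewrite integral_cst//= [X in (_ * X)%E]lebesgue_measure_itv/= lte_fin ltrN10 -EFinD -EFinM.
  exact: ltry.
apply: ae_ge0_le_integral => //.
- by move=> t _; apply: integral_ge0 => x _; rewrite lee_fin sqr_ge0.
- apply: (@measurable_pcyl_slices _ _ _ (fun z => enorm (v z) ^+ 2)).
  + exact: measurable_ball3.
  + by rewrite -QE.
  + exact: measurable_enorm_v.
  + by move=> z; exact: sqr_ge0.
Qed.

Lemma L2_of_le (f g : mR4 R -> R) : measurable_fun Q f -> measurable_fun Q g ->
  (forall z, f z ^+ 2 <= g z) -> (\int[leb4]_(z in Q) (g z)%:E < +oo)%E ->
  square_integrable leb4 Q f.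
Proof.
move=> mf mg fg goo; split => //; apply/integrableP; split.
  by apply/measurable_EFinP; exact: measurable_funX.
apply: le_lt_trans goo; apply: ge0_le_integral => //.
- by do 2 apply: measurableT_comp => //; exact: measurable_funX.
- exact/measurable_EFinP.
- by move=> z _; rewrite /= lee_fin ger0_norm ?sqr_ge0.
Qed.

Lemma L2_vcomp i : square_integrable leb4 Q (vcomp i).
Proof.
apply: L2_of_le integral_enorm_v_lty.
- exact: measurable_vcomp.
- exact: measurable_enorm_v.
- by move=> z; exact: coord_sqr_le.
Qed.

Lemma measurable_mxnorm2 : measurable_fun Q (fun z => mxnorm2 (Dv z)).
Proof.
have [_ _ [mD _] _] := ve.
by do 2 (apply: measurable_sum => ?); apply: measurable_funX; exact: mD.
Qed.

Lemma mxnorm2_ge0 (A : 'M[R]_3) : 0 <= mxnorm2 A.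
Proof. by do 2 (apply: sumr_ge0 => ? _); exact: sqr_ge0. Qed.

Lemma sqr_le_mxnorm2 (A : 'M[R]_3) i j : A i j ^+ 2 <= mxnorm2 A.
Proof.
rewrite /mxnorm2 (bigD1 i)//= (bigD1 j)//= -addrA lerDl addr_ge0//.
  by apply: sumr_ge0 => ? _; exact: sqr_ge0.
by do 2 (apply: sumr_ge0 => ? _); exact: sqr_ge0.
Qed.

Lemma L2_gcomp i j : square_integrable leb4 Q (gcomp i j).
Proof.
have [_ _ [mD Doo] _] := ve.
apply: L2_of_le Doo.
- exact: mD.
- exact: measurable_mxnorm2.
- by move=> z; exact: sqr_le_mxnorm2.
Qed.

End EnergyClass.

Lemma ae_forall_countable d (T : measurableType d) (R : realType)
    (mu : {measure set T -> \bar R}) (I : countType) (P : I -> T -> Prop) :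
  (forall i, {ae mu, forall x, P i x}) -> {ae mu, forall x, forall i, P i x}.
Proof.
move=> aP; pose F n := if @choice.unpickle I n is Some i then [set x | ~ P i x] else set0.
have nF n : mu.-negligible (F n).
  by rewrite /F; case: choice.unpickle => [i|]; [exact: aP|exact: negligible_set0].
apply: (negligibleS _ (negligible_bigcup nF)) => x /= /existsNP[i nP].
by exists (choice.pickle i) => //; rewrite /F choice.pickleK.
Qed.

(** The power mean inequality, with equality at x = y = z. *)
Lemma cube_sum3_le (R : realFieldType) (x y z : R) : 0 <= x -> 0 <= y -> 0 <= z ->
  (x + (y + z)) ^+ 3 <= 9 * (x ^+ 3 + (y ^+ 3 + z ^+ 3)).
Proof.
move=> x0 y0 z0.
have sq (a b c : R) : 0 <= c -> 0 <= c * (a - b) ^+ 2 by move=> c0; rewrite mulr_ge0 ?sqr_ge0.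
have h1 := sq x y _ (addr_ge0 x0 y0); have h2 := sq y z _ (addr_ge0 y0 z0).
have h3 := sq x z _ (addr_ge0 x0 z0); have s0 := addr_ge0 (addr_ge0 x0 y0) z0.
have h4 := sq x y _ s0; have h5 := sq y z _ s0; have h6 := sq x z _ s0.
nra.
Qed.

(** * Sobolev inequality for the velocity at almost every time *)

Section SliceSobolev.
Context {R : realType}.
Variables (v : spacetime R -> space3 R) (Dv : spacetime R -> 'M[R]_3) (q : spacetime R -> R).
Hypothesis ve : energy_class v Dv q.
Hypothesis vD : weak_gradient v Dv.
Local Notation Q := (pcyl (1 : R) : set (mR4 R)).

Let mQ : measurable Q. Proof. exact: measurable_pcyl. Qed.
Let Qfin : (leb4 Q < +oo)%E. Proof. exact: leb4_pcyl_lty. Qed.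

(** Extensions by zero to all of space-time, the setting of the results on slices. *)
Let uQ c : mR4 R -> R := vcomp v c \_ Q.
Let gQ c j : mR4 R -> R := gcomp Dv c j \_ Q.
Let nQ : mR4 R -> R := (fun z => mxnorm2 (Dv z)) \_ Q.

Let restrict_integrable (f : mR4 R -> R) : leb4.-integrable Q (EFin \o f) ->
  leb4.-integrable setT (EFin \o (f \_ Q)).
Proof. by move=> fi; rewrite -restrict_EFin; apply/(integrable_mkcond _ mQ).1. Qed.

Let iu c : leb4.-integrable setT (EFin \o uQ c).
Proof. by apply: restrict_integrable; exact: L2_integrable (L2_vcomp ve c). Qed.

Let ig c j : leb4.-integrable setT (EFin \o gQ c j).
Proof. by apply: restrict_integrable; exact: L2_integrable (L2_gcomp ve c j). Qed.

Let sqr_restrict (f : mR4 R -> R) :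
  (fun z => ((f \_ Q) : mR4 R -> R) z ^+ 2) = ((fun z => f z ^+ 2) \_ Q).
Proof. by apply/funext => z; rewrite !patchE; case: ifP => // _; rewrite expr0n. Qed.

Let iu2 c : leb4.-integrable setT (EFin \o (fun z => uQ c z ^+ 2)).
Proof.
by rewrite /uQ sqr_restrict; apply: restrict_integrable; have [] := L2_vcomp ve c.
Qed.

Let ig2 c j : leb4.-integrable setT (EFin \o (fun z => gQ c j z ^+ 2)).
Proof.
by rewrite /gQ sqr_restrict; apply: restrict_integrable; have [] := L2_gcomp ve c j.
Qed.

Let inQ : leb4.-integrable setT (EFin \o nQ).
Proof.
apply: restrict_integrable; have [_ _ [_ Doo] _] := ve.
apply/integrableP; split; first by apply/measurable_EFinP; exact: measurable_mxnorm2 ve.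
by under eq_integral do rewrite /= ger0_norm ?mxnorm2_ge0//.
Qed.

(** Component, level, cell and direction range over a countable set, so one null set of times serves
    for all of them. *)
Lemma ae_cell_shift (a : R) : 0 < a -> cbox (fun=> - a) (fun=> a) `<=` ball3 1 ->
  {ae leb1, forall t : R, - 1 ^+ 2 < t < 0 -> forall c n (i : 'I_3 -> nat) (j : 'I_3),
    let lo k := node a n (i k) in
    let lo' k := lo k + mesh a n * (k == j)%:R in
    let hi k := lo k + mesh a n in
    let hi' k := lo' k + mesh a n in
    (forall k, (i k + (k == j) < n.+1)%N) ->
    `|slice (obox lo' hi') (uQ c) t - slice (obox lo hi) (uQ c) t|
    <= mesh a n * slice (obox lo hi') (fun z => `|gQ c j z|) t}.
Proof.
move=> a0 aB.
(* Finite functions replace functions ['I_3 -> nat] to make the index type countable. *)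
pose I := ('I_3 * nat * {ffun 'I_3 -> nat} * 'I_3)%type.
pose P (p : I) (t : R) := - 1 ^+ 2 < t < 0 ->
  let: (c, n, i, j) := p in
  let lo k := node a n (i k) in
  let lo' k := lo k + mesh a n * (k == j)%:R in
  let hi k := lo k + mesh a n in
  let hi' k := lo' k + mesh a n in
  (forall k, (i k + (k == j) < n.+1)%N) ->
  `|slice (obox lo' hi') (uQ c) t - slice (obox lo hi) (uQ c) t|
    <= mesh a n * slice (obox lo hi') (fun z => `|gQ c j z|) t.
have aP : {ae leb1, forall t : R, forall p : I, P p t}.
  apply: ae_forall_countable => -[[[c n] i] j].
  have [iN|iN] := pselect (forall k, (i k + (k == j) < n.+1)%N); last first.
    by apply: aeW => t _ lo lo' hi hi' iN'; exfalso; exact: iN iN'.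
  have h0 : 0 <= mesh a n by rewrite ltW ?mesh_gt0.
  have := @weak_shift_slices R (ball3 1) (- 1 ^+ 2) 0 (uQ c) (gQ c j) j
    (fun k => node a n (i k)) (mesh a n) (measurable_ball3 1) (iu c) (ig c j) _ h0.
  move=> h; apply: ae_mono (h _ _).
  - by move=> t ht tI; cbv zeta => _; exact: (ht tI).
  - move=> phi tphi; transitivity (\int[leb4]_(z in Q) (coord (v z) c * dx j phi z)%:E)%E.
      by apply: eq_integral => z zQ; rewrite /uQ patchE zQ.
    rewrite (vD c j tphi); congr (- _)%E.
    by apply: eq_integral => z zQ; rewrite /gQ patchE zQ.
  - move=> x xb; apply: aB => k; have /andP[l r] := xb k.
    rewrite (le_trans _ l)/=; last first.
      by rewrite /node lerDl mulr_ge0.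
    apply: le_trans r _.
    (* The far corner of the shifted cell is a node of index at most n + 1, hence still in the
       closed cube. *)
    have -> : node a n (i k) + mesh a n * (k == j)%:R + mesh a n =
        node a n (i k + (k == j)).+1.
      by rewrite /node -natr1 natrD; ring.
    apply: le_trans (le_node a0 n (iN k)) _.
    by rewrite /node mesh_total; lra.
apply: ae_mono aP => t Pt tI c n i j; cbv zeta => iN.
have := Pt (c, n, [ffun k => i k], j) tI.
have E : ([ffun k => i k] : {ffun 'I_3 -> nat}) = i :> ('I_3 -> nat).
  by apply/funext => k; rewrite ffunE.
by rewrite /= E => H; exact: (H iN).
Qed.

(* Zero at the negligibly many times where the integral is infinite. *)
Definition dissipation (lam t : R) : R := \int[leb3]_(x in ball3 lam) mxnorm2 (Dv (x, t)).

Let in_Q (x : mR3 R) (t r : R) : r <= 1 -> ball3 r x -> - 1 ^+ 2 < t < 0 -> Q (x, t).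
Proof. by move=> r1 xr tI; split; [exact: (sub_ball3 r1)|rewrite /= in_itv]. Qed.

Lemma measurable_enorm_slice (r t : R) : r <= 1 -> - 1 ^+ 2 < t < 0 ->
  measurable_fun (ball3 r : set (mR3 R)) (fun x => enorm (v (x, t))).
Proof.
move=> r1 tI; apply: (measurableT_comp measurable_enorm).
have [mv _ _ _] := ve.
apply: (measurable_comp mQ) mv _ => [_ [x xr <-]|]; first exact: in_Q r1 xr tI.
by apply: (measurable_funS measurableT) => //; exact: pair2_measurable.
Qed.

(** [sobolev_cube] at a fixed time, on the cube of half-side lam / 2, which lies in the ball of
    radius lam. The full side is lam, whence the term [X / lam ^+ 2]. *)
Lemma ae_component_sobolev (lam X : R) (c : 'I_3) : 0 < lam -> lam < 1 ->
  {ae leb1, forall t : R, - lam ^+ 2 < t < 0 ->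
    (\int[leb3]_(x in ball3 lam) (enorm (v (x, t)) ^+ 2)%:E <= X%:E)%E} ->
  {ae leb1, forall t : R, - lam ^+ 2 < t < 0 ->
    (\int[leb3]_(x in gcube (lam / 2)) (uQ c (x, t) ^+ 6)%:E <=
     ((2 * (X / lam ^+ 2 + 64 * dissipation lam t)) ^+ 3)%:E)%E}.
Proof.
move=> l0 l1 AX; pose a := lam / 2.
have a0 : 0 < a by rewrite divr_gt0.
have aB : cbox (fun=> - a) (fun=> a) `<=` ball3 lam by exact: gcube_ball3.
have aB1 : cbox (fun=> - a) (fun=> a) `<=` ball3 1.
  by apply: subset_trans aB _; exact: sub_ball3 (ltW l1).
have CB : gcube a `<=` ball3 lam.
  by move=> x xC; apply: aB => k; have := xC k; rewrite /= in_itv/= => /andP[-> /ltW].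
have mC : measurable (gcube a : set (mR3 R)) by exact: measurable_hbox.
have mB : measurable (ball3 lam : set (mR3 R)) by exact: measurable_ball3.
have su := ae_integrable_slices (iu2 c).
have sg : {ae leb1, forall t : R, forall j,
    leb3.-integrable setT (fun x => (EFin \o (fun z => gQ c j z ^+ 2)) (x, t))}.
  by apply: ae_forall_countable => j; exact: ae_integrable_slices (ig2 c j).
have sn := ae_integrable_slices inQ.
apply: ae_mono (ae_and AX (ae_and (ae_cell_shift a0 aB1) (ae_and su (ae_and sg sn)))).
move=> t [AXt [shift [sut [sgt snt]]]] tI.
have tI1 : - 1 ^+ 2 < t < 0.
  have /andP[tl ->] := tI; rewrite andbT; apply: le_lt_trans tl.
  by rewrite lerN2 ler_pXn2r ?nnegrE// ltW.
have msl (f : mR4 R -> R) : measurable_fun [set: mR4 R] f ->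
    measurable_fun [set: mR3 R] (fun x => f (x, t)).
  by move=> mf; apply: (measurableT_comp mf); exact: pair2_measurable.
have mint (f : mR4 R -> R) : leb4.-integrable setT (EFin \o f) -> measurable_fun [set: mR4 R] f.
  by move=> fi; apply/measurable_EFinP; exact: measurable_int fi.
have uL : square_integrable leb3 (gcube a) (fun x => uQ c (x, t)).
  split; first by apply: (measurable_funS measurableT) => //; apply: msl; exact: mint (iu c).
  by apply: (integrableS measurableT) => //; exact: sut.
have gL j : square_integrable leb3 (gcube a) (fun x => gQ c j (x, t)).
  split; first by apply: (measurable_funS measurableT) => //; apply: msl; exact: mint (ig c j).
  by apply: (integrableS measurableT) => //; exact: (sgt j).
have snB : leb3.-integrable (ball3 lam) (EFin \o (fun x => nQ (x, t))).
  by apply: (integrableS measurableT) => //; exact: snt.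
have nQ0 z : 0 <= nQ z by rewrite /nQ patchE; case: ifP => // _; exact: mxnorm2_ge0.
have dE : dissipation lam t = \int[leb3]_(x in ball3 lam) nQ (x, t).
  apply: eq_Rintegral => x /set_mem xb; rewrite /nQ patchE mem_set//.
  exact: in_Q (ltW l1) xb tI1.
have gG j : \int[leb3]_(x in gcube a) gQ c j (x, t) ^+ 2 <= dissipation lam t.
  rewrite dE; apply: (@le_trans _ _ (\int[leb3]_(x in gcube a) nQ (x, t))).
    apply: le_Rintegral => //; first exact: (gL j).2.
      exact: integrableS snB.
    move=> x _; rewrite /gQ /nQ !patchE; case: ifP => _; last by rewrite expr0n.
    exact: sqr_le_mxnorm2.
  rewrite /Rintegral fine_le//.
  - by apply: integrable_fin_num => //; exact: integrableS snB.
  - exact: integrable_fin_num.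
  - apply: ge0_subset_integral => //; first exact: measurable_int snB.
    by move=> x _; rewrite lee_fin.
have h6 := @sobolev_cube R a a0 _ _ _ uL gL gG (fun n i j => shift tI1 c n i j).
apply: (le_trans h6); rewrite lee_fin.
have -> : 2 * a = lam by rewrite /a mulrC divfK// pnatr_eq0.
have u20 : 0 <= \int[leb3]_(x in gcube a) uQ c (x, t) ^+ 2.
  by apply: Rintegral_ge0 => x _; exact: sqr_ge0.
have d0 : 0 <= dissipation lam t by apply: Rintegral_ge0 => x _; exact: mxnorm2_ge0.
have uX : \int[leb3]_(x in gcube a) uQ c (x, t) ^+ 2 <= X.
  rewrite -lee_fin fineK; last by apply: integrable_fin_num => //; exact: uL.2.
  apply: le_trans (AXt tI).
  have mv : measurable_fun (ball3 lam : set (mR3 R)) (fun x => enorm (v (x, t)) ^+ 2).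
    by apply: measurable_funX; exact: measurable_enorm_slice (ltW l1) tI1.
  apply: (@le_trans _ _ (\int[leb3]_(x in gcube a) (enorm (v (x, t)) ^+ 2)%:E)%E).
    apply: ge0_le_integral => //.
    - by move=> x _; rewrite lee_fin sqr_ge0.
    - exact: measurable_int uL.2.
    - by apply/measurable_EFinP; exact: measurable_funS mv.
    - move=> x /CB xb; rewrite /= lee_fin /uQ patchE mem_set; last exact: in_Q (ltW l1) xb tI1.
      exact: coord_sqr_le.
  apply: ge0_subset_integral => //; first exact/measurable_EFinP.
  by move=> x _; rewrite lee_fin sqr_ge0.
have X0 : 0 <= X := le_trans u20 uX.
rewrite ler_pXn2r ?nnegrE//.
- by rewrite ler_pM2l// lerD2r ler_pM2r ?invr_gt0 ?exprn_gt0.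
- by rewrite mulr_ge0// addr_ge0 ?(mulr_ge0 (ler0n _ _) d0)// divr_ge0 ?sqr_ge0.
- by rewrite mulr_ge0// addr_ge0 ?(mulr_ge0 (ler0n _ _) d0)// divr_ge0 ?sqr_ge0.
Qed.

(** The power mean inequality costs a factor 9 and the three components a factor 3, so the bound [S]
    for one component becomes 3 [S]; thus 384 = 3 * 2 * 64. *)
Lemma ae_sixth_power (lam r X : R) : 0 < lam -> lam < 1 -> 0 < r -> r <= lam / 2 ->
  {ae leb1, forall t : R, - lam ^+ 2 < t < 0 ->
    (\int[leb3]_(x in ball3 lam) (enorm (v (x, t)) ^+ 2)%:E <= X%:E)%E} ->
  {ae leb1, forall t : R, - r ^+ 2 < t < 0 ->
    (\int[leb3]_(x in ball3 r) (enorm (v (x, t)) ^+ 6)%:E <=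
     ((384 * (X / lam ^+ 2 + dissipation lam t)) ^+ 3)%:E)%E}.
Proof.
move=> l0 l1 r0 rl AX.
have aS := ae_forall_countable (fun c => ae_component_sobolev c l0 l1 AX).
apply: ae_mono (ae_and AX aS) => t [AXt St] tI.
have tIl : - lam ^+ 2 < t < 0.
  have /andP[tl ->] := tI; rewrite andbT; apply: le_lt_trans tl.
  rewrite lerN2 ler_pXn2r ?nnegrE// ?ltW//; lra.
have tI1 : - 1 ^+ 2 < t < 0.
  have /andP[tl ->] := tIl; rewrite andbT; apply: le_lt_trans tl.
  by rewrite lerN2 ler_pXn2r ?nnegrE// ltW.
have r1 : r <= 1 by lra.
have X0 : 0 <= X.
  rewrite -lee_fin; apply: le_trans (AXt tIl).
  by apply: integral_ge0 => x _; rewrite lee_fin sqr_ge0.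
have d0 : 0 <= dissipation lam t by apply: Rintegral_ge0 => x _; exact: mxnorm2_ge0.
have mB : measurable (ball3 r : set (mR3 R)) by exact: measurable_ball3.
have mC : measurable (gcube (lam / 2) : set (mR3 R)) by exact: measurable_hbox.
have mu c : measurable_fun [set: mR3 R] (fun x => uQ c (x, t)).
  have mf : measurable_fun [set: mR4 R] (uQ c).
    by apply/measurable_EFinP; exact: measurable_int (iu c).
  by apply: (measurableT_comp mf); exact: pair2_measurable.
set S := 2 * (X / lam ^+ 2 + 64 * dissipation lam t).
have S0 : 0 <= S by rewrite mulr_ge0// addr_ge0 ?(mulr_ge0 (ler0n _ _) d0)// divr_ge0 ?sqr_ge0.
have u6 x c : 0 <= uQ c (x, t) ^+ 6 by rewrite -[6%N]/(2 * 3)%N exprM exprn_ge0 ?sqr_ge0.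
apply: (@le_trans _ _ (\int[leb3]_(x in ball3 r) (\sum_(c < 3) 9%:E * (uQ c (x, t) ^+ 6)%:E))%E).
  apply: ge0_le_integral => //.
  - by move=> x _; rewrite lee_fin exprn_ge0 ?enorm_ge0.
  - apply/measurable_EFinP; apply: measurable_funX; exact: measurable_enorm_slice r1 tI1.
  - apply: emeasurable_sum => c; apply: measurable_funeM; apply/measurable_EFinP.
    by apply: measurable_funX; exact: measurable_funS (mu c).
  - move=> x xr; under eq_bigr do rewrite -EFinM; rewrite sumEFin lee_fin.
    have uE c : uQ c (x, t) = vcomp v c (x, t).
      by rewrite /uQ patchE mem_set//; exact: in_Q r1 xr tI1.
    have e6 (y : R) : y ^+ 6 = (y ^+ 2) ^+ 3 by rewrite -exprM.
    rewrite e6 enorm_vcomp [leRHS](eq_bigr (fun c => 9 * (vcomp v c (x, t) ^+ 2) ^+ 3)); last first.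
      by move=> c _; rewrite uE e6.
    rewrite !big_ord_recl !big_ord0 !addr0.
    by apply: (le_trans (cube_sum3_le _ _ _)); rewrite ?sqr_ge0//; lra.
rewrite ge0_integral_sum//; last 2 first.
- move=> c; apply: measurable_funeM; apply/measurable_EFinP.
  by apply: measurable_funX; exact: measurable_funS (mu c).
- by move=> c x _; rewrite mule_ge0// lee_fin.
apply: (@le_trans _ _ (\sum_(c < 3) 9%:E * (S ^+ 3)%:E)%E).
  apply: lee_sum => c _; rewrite ge0_integralZl//; last 2 first.
  - apply/measurable_EFinP; apply: measurable_funX; exact: measurable_funS (mu c).
  - by move=> x _; rewrite lee_fin.
  apply: lee_pmul => //; first by apply: integral_ge0 => x _; rewrite lee_fin.
  apply: le_trans (St c tIl); apply: ge0_subset_integral => //.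
  - apply/measurable_EFinP; apply: measurable_funX; exact: measurable_funS (mu c).
  - by move=> x _; rewrite lee_fin.
  - move=> x /ball3_gcube xr k; have := xr k; rewrite /= !in_itv/= => /andP[? ?].
    by apply/andP; split; lra.
under eq_bigr do rewrite -EFinM; rewrite sumEFin lee_fin sumr_const card_ord.
rewrite (_ : 9 * S ^+ 3 *+ 3 = (3 * S) ^+ 3); last by rewrite -mulr_natr; ring.
have Xl : 0 <= X / lam ^+ 2 by rewrite divr_ge0 ?sqr_ge0.
have S3 : 0 <= 3 * S by rewrite mulr_ge0 ?ler0n.
have S384 : 3 * S <= 384 * (X / lam ^+ 2 + dissipation lam t) by rewrite /S; lra.
by apply: (lerXn2r 3 _ _ S384); rewrite nnegrE; [exact: S3|exact: le_trans S3 S384].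
Qed.

End SliceSobolev.

(** * Interpolation and decay *)

Section Interpolation.
Context {R : realType}.
Implicit Types a b c s x V X Y : R.

Lemma powR_expR x s : 0 < x -> x `^ s = expR (s * ln x).
Proof. by move=> x0; rewrite /powR gt_eqF. Qed.

(** Each exponential lies above its tangent at the mean [y], and the linear terms cancel in the
    weighted sum. *)
Lemma expR_jensen a b c (y1 y2 y3 : R) : 0 <= a -> 0 <= b -> 0 <= c -> a + b + c = 1 ->
  expR (a * y1 + b * y2 + c * y3) <= a * expR y1 + b * expR y2 + c * expR y3.
Proof.
move=> a0 b0 c0 abc; set y := a * y1 + b * y2 + c * y3.
have tangent z : expR y * (1 + (z - y)) <= expR z.
  have -> : expR z = expR y * expR (z - y) by rewrite -expRD; congr expR; lra.
  by rewrite ler_pM2l ?expR_gt0// expR_ge1Dx.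
apply: (@le_trans _ _ (a * (expR y * (1 + (y1 - y))) + b * (expR y * (1 + (y2 - y)))
    + c * (expR y * (1 + (y3 - y))))).
  rewrite [leRHS](_ : _ = expR y * ((a + b + c) * (1 - y) + y)); last by rewrite /y; ring.
  by rewrite abc mul1r subrK mulr1.
by rewrite !lerD ?ler_wpM2l.
Qed.

(** Weighted arithmetic-geometric mean of 1 / V, x ^ 2 / X and x ^ 6 / Y. The bound is linear in 1,
    x ^ 2 and x ^ 6 and can therefore be integrated term by term. *)
Lemma powR_interpolation a b c s x V X Y : 0 <= a -> 0 <= b -> 0 <= c -> a + b + c = 1 ->
  b * 2 + c * 6 = s -> 0 < s -> 0 <= x -> 0 < V -> 0 < X -> 0 < Y ->
  x `^ s <= V `^ a * X `^ b * Y `^ c * (a / V + b / X * x ^+ 2 + c / Y * x ^+ 6).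
Proof.
move=> a0 b0 c0 abc bcs s0 x0 V0 X0 Y0.
have [->|xn0] := eqVneq x 0.
  rewrite powR0 ?gt_eqF// !expr0n/= !mulr0 !addr0.
  by rewrite !mulr_ge0 ?powR_ge0 ?invr_ge0 ?(ltW V0).
have xp : 0 < x by rewrite lt_neqAle eq_sym xn0.
rewrite !powR_expR// -!expRD.
have expRln2 (n : nat) z : 0 < z -> expR (n%:R * ln x - ln z) = x ^+ n / z.
  by move=> z0; rewrite expRB expRM_natl !lnK.
have := expR_jensen (- ln V) (2 * ln x - ln X) (6 * ln x - ln Y) a0 b0 c0 abc.
rewrite !expRln2// expRN lnK// => h.
rewrite (_ : s * ln x = (a * ln V + b * ln X + c * ln Y) +
  (a * - ln V + b * (2 * ln x - ln X) + c * (6 * ln x - ln Y))); last first.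
  by rewrite -bcs; ring.
rewrite [leLHS]expRD ler_wpM2l ?expR_ge0//; apply: (le_trans h).
by rewrite le_eqVlt -![_ / _ * _]mulrAC -!mulrA eqxx.
Qed.

(** Hölder's inequality with three factors: after integration the three terms contribute at most a,
    b and c, whose sum is 1. *)
Lemma integral_powR_interpolation d (T : measurableType d) (mu : {measure set T -> \bar R})
    (B : set T) (f : T -> R) a b c s V X Y :
  measurable B -> measurable_fun B f -> (forall t, 0 <= f t) ->
  0 <= a -> 0 <= b -> 0 <= c -> a + b + c = 1 -> b * 2 + c * 6 = s -> 0 < s ->
  0 < V -> 0 < X -> 0 < Y ->
  (mu B <= V%:E)%E -> (\int[mu]_(t in B) (f t ^+ 2)%:E <= X%:E)%E ->
  (\int[mu]_(t in B) (f t ^+ 6)%:E <= Y%:E)%E ->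
  (\int[mu]_(t in B) (f t `^ s)%:E <= (V `^ a * X `^ b * Y `^ c)%:E)%E.
Proof.
move=> mB mf f0 a0 b0 c0 abc bcs s0 V0 X0 Y0 hV hX hY.
set Z := V `^ a * X `^ b * Y `^ c.
have Z0 : 0 <= Z by rewrite !mulr_ge0 ?powR_ge0.
have mfn n : measurable_fun B (fun t => (f t ^+ n)%:E).
  by apply/measurable_EFinP; exact: measurable_funX.
have aV : 0 <= a / V by rewrite divr_ge0 ?(ltW V0) ?(ltW X0) ?(ltW Y0).
have bX : 0 <= b / X by rewrite divr_ge0 ?(ltW V0) ?(ltW X0) ?(ltW Y0).
have cY : 0 <= c / Y by rewrite divr_ge0 ?(ltW V0) ?(ltW X0) ?(ltW Y0).
apply: (@le_trans _ _ (\int[mu]_(t in B) (Z%:E * ((a / V)%:E + (b / X)%:E * (f t ^+ 2)%:E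
    + (c / Y)%:E * (f t ^+ 6)%:E)))%E).
  apply: ge0_le_integral => //.
  - by move=> t _; rewrite lee_fin powR_ge0.
  - by apply/measurable_EFinP; exact: (measurableT_comp (measurable_powR s)).
  - apply: measurable_funeM; apply: emeasurable_funD; last exact: measurable_funeM.
    by apply: emeasurable_funD => //; exact: measurable_funeM.
  - move=> t _ /=.
    rewrite -[leRHS]/((Z * (a / V + b / X * f t ^+ 2 + c / Y * f t ^+ 6))%:E) lee_fin.
    exact: powR_interpolation.
have kp0 k n t : 0 <= k -> (0 <= k%:E * (f t ^+ n)%:E)%E.
  by move=> k0; rewrite mule_ge0 ?lee_fin ?exprn_ge0.
have p0 n t : (0 <= (f t ^+ n)%:E)%E by rewrite lee_fin exprn_ge0.
rewrite ge0_integralZl//; last 2 first.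
- apply: emeasurable_funD; last exact: measurable_funeM.
  by apply: emeasurable_funD => //; exact: measurable_funeM.
- by move=> t _; rewrite !adde_ge0 ?kp0.
rewrite ge0_integralD//; last 4 first.
- by move=> t _; rewrite !adde_ge0 ?kp0.
- by apply: emeasurable_funD => //; exact: measurable_funeM.
- by move=> t _; exact: kp0.
- exact: measurable_funeM.
rewrite ge0_integralD//; last 2 first.
- by move=> t _; exact: kp0.
- exact: measurable_funeM.
rewrite integral_cst// !ge0_integralZl//.
rewrite -[leRHS]mule1 lee_pmul//.
  by rewrite !adde_ge0// mule_ge0// integral_ge0.
have scale w W (I : \bar R) : 0 < W -> 0 <= w / W -> (I <= W%:E)%E ->
    ((w / W)%:E * I <= w%:E)%E.
  move=> W0 w0 IW; apply: (@le_trans _ _ ((w / W)%:E * W%:E)%E).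
    by apply: lee_wpmul2l.
  by rewrite -EFinM divfK ?lt0r_neq0.
rewrite -[1%E]/(1%:E) -abc 2!EFinD !leeD//; first exact: scale.
  exact: scale.
exact: scale.
Qed.

(** The tangent at [G] of the concave power tau, obtained from [expR_jensen] with third weight 0. *)
Lemma powR_tangent (g G tau : R) : 0 <= tau <= 1 -> 0 < G -> 0 < g ->
  g `^ tau <= G `^ tau * (1 - tau + tau / G * g).
Proof.
move=> /andP[t0 t1] G0 g0; rewrite !powR_expR//.
have t1' : 0 <= 1 - tau by rewrite subr_ge0.
have sum1 : 1 - tau + tau + 0 = 1 by rewrite addr0 subrK.
have := expR_jensen 0 (ln g - ln G) 0 t1' t0 (lexx 0) sum1.
rewrite expR0 mulr1 mul0r mulr0 !(addr0, add0r) expRB !lnK// => h.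
rewrite (_ : tau * ln g = tau * ln G + tau * (ln g - ln G)); last by ring.
rewrite [leLHS]expRD ler_wpM2l ?expR_ge0//; apply: (le_trans h).
by rewrite mul0r addr0 mulrA mulrAC.
Qed.

(** Jensen's inequality for the concave power tau, by integrating its tangent at [G]. Upper bounds
    [L] for the measure and [G * L] for the integral are enough, both coefficients of the tangent
    being nonnegative. *)
Lemma integral_powR_tangent d (T : measurableType d) (mu : {measure set T -> \bar R})
    (D : set T) (N : T -> \bar R) (g : T -> R) (W tau G L : R) :
  measurable D -> measurable_fun D N -> (forall t, (0 <= N t)%E) ->
  measurable_fun D g -> (forall t, 0 < g t) -> 0 <= tau <= 1 -> 0 < G -> 0 <= W ->
  (mu D <= L%:E)%E -> (\int[mu]_(t in D) (g t)%:E <= (G * L)%:E)%E ->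
  {ae mu, forall t, D t -> (N t <= (W * g t `^ tau)%:E)%E} ->
  (\int[mu]_(t in D) N t <= (W * G `^ tau * L)%:E)%E.
Proof.
move=> mD mN N0 mg g0 tau01 G0 W0 hL hg Ng.
have /andP[t0 t1] := tau01.
have Z0 : 0 <= W * G `^ tau by rewrite mulr_ge0 ?powR_ge0.
have tG : 0 <= tau / G by rewrite divr_ge0 ?(ltW G0).
have t1' : 0 <= 1 - tau by rewrite subr_ge0.
have mge : measurable_fun D (fun t => (g t)%:E) by exact/measurable_EFinP.
have ge0 t : (0 <= (g t)%:E)%E by rewrite lee_fin ltW.
have gk0 t : (0 <= (tau / G)%:E * (g t)%:E)%E by rewrite mule_ge0 ?lee_fin ?(ltW (g0 t)).
apply: (@le_trans _ _ (\int[mu]_(t in D) ((W * G `^ tau)%:E *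
    ((1 - tau)%:E + (tau / G)%:E * (g t)%:E)))%E).
  apply: ae_ge0_le_integral => //.
  - by move=> t _; rewrite mule_ge0 ?adde_ge0 ?gk0 ?lee_fin.
  - by apply: measurable_funeM; apply: emeasurable_funD => //; exact: measurable_funeM.
  - apply: ae_mono Ng => t Nt Dt; apply: (le_trans (Nt Dt)).
    rewrite -[leRHS]/((W * G `^ tau * (1 - tau + tau / G * g t))%:E) lee_fin -mulrA.
    by rewrite ler_wpM2l// powR_tangent.
rewrite ge0_integralZl//; last 2 first.
- by apply: emeasurable_funD => //; exact: measurable_funeM.
- by move=> t _; rewrite adde_ge0 ?gk0 ?lee_fin.
rewrite ge0_integralD//; last exact: measurable_funeM.
rewrite integral_cst// ge0_integralZl// [leRHS]EFinM lee_wpmul2l ?lee_fin//.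
apply: (@le_trans _ _ ((1 - tau)%:E * L%:E + (tau / G)%:E * (G * L)%:E)%E).
  by apply: leeD; apply: lee_wpmul2l; rewrite ?lee_fin.
rewrite -!EFinM -EFinD lee_fin mulrA divfK ?lt0r_neq0//.
by rewrite mulrBl mul1r subrK.
Qed.

End Interpolation.

(** * The mixed norm on small balls *)

Section MixedNorm.
Context {R : realType}.
Variables (v : spacetime R -> space3 R) (Dv : spacetime R -> 'M[R]_3) (q : spacetime R -> R).
Hypothesis ve : energy_class v Dv q.
Hypothesis vD : weak_gradient v Dv.
Local Notation Q := (pcyl (1 : R) : set (mR4 R)).

Lemma ess_sup_itv_ge0 (a b : R) (f : R -> \bar R) : a < b -> (forall t, (0 <= f t)%E) ->
  (0 <= ess_sup_itv a b f)%E.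
Proof.
move=> ab f0; apply: ess_sup_gee; last exact: aeW.
rewrite [ltRHS](_ : _ = leb1 `]a, b[%classic); last by rewrite -[in RHS](setTI `]a, b[%classic).
by rewrite [ltRHS]lebesgue_measure_itv/= lte_fin ab -EFinB lte_fin subr_gt0.
Qed.

Lemma uniform_bounds (m m1 : R) :
  (ereal_sup [set qA m1 v r + qE m Dv r + qD m q r | r in `]0%R, 1%R[%classic] < +oo)%E ->
  exists2 M : R, 0 < M & forall lam : R, 0 < lam < 1 ->
    {ae leb1, forall t : R, - lam ^+ 2 < t < 0 ->
      (\int[leb3]_(x in ball3 lam) (enorm (v (x, t)) ^+ 2)%:E <= (M * lam `^ m1)%:E)%E} /\
    (\int[leb4]_(z in pcyl lam) (mxnorm2 (Dv z))%:E <= (M * lam `^ m)%:E)%E.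
Proof.
set S := ereal_sup _ => Soo.
(* [M] is taken positive because the interpolation divides by bounds proportional to it. *)
have [M M0 SM] : exists2 M : R, 0 < M & (S <= M%:E)%E.
  move: Soo; case: S => [M _|//|_]; last by exists 1; rewrite ?leNye.
  exists (`|M| + 1); first by have := normr_ge0 M; lra.
  by rewrite lee_fin; have := ler_norm M; lra.
exists M => // lam /andP[l0 l1].
have lN : - lam ^+ 2 < 0 by rewrite oppr_lt0 exprn_gt0.
have A0 : (0 <= qA m1 v lam)%E.
  apply: ess_sup_itv_ge0 => // t; rewrite mule_ge0 ?lee_fin ?invr_ge0 ?powR_ge0//.
  by apply: integral_ge0 => x _; rewrite lee_fin sqr_ge0.
have E0 : (0 <= qE m Dv lam)%E.
  rewrite mule_ge0 ?lee_fin ?invr_ge0 ?powR_ge0//.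
  by apply: integral_ge0 => x _; rewrite lee_fin mxnorm2_ge0.
have D0 : (0 <= qD m q lam)%E.
  rewrite mule_ge0 ?lee_fin ?invr_ge0 ?powR_ge0//.
  by apply: integral_ge0 => x _; rewrite lee_fin powR_ge0.
have sumM : (qA m1 v lam + qE m Dv lam + qD m q lam <= M%:E)%E.
  apply: le_trans SM; apply: ereal_sup_ubound; exists lam => //.
  by rewrite /= in_itv/= l0.
have scale k (I : \bar R) : (((lam `^ k)^-1)%:E * I <= M%:E)%E -> (I <= (M * lam `^ k)%:E)%E.
  by rewrite muleC lee_pdivrMr ?powR_gt0.
split.
- have : (qA m1 v lam <= M%:E)%E.
    by apply: le_trans sumM; rewrite -addeA leeDl// adde_ge0.
  by move=> /ess_sup_itv_le; apply: ae_mono => t /[apply] /scale.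
- by apply: scale; apply: le_trans sumM; rewrite addeAC leeDr// adde_ge0.
Qed.

Let time_slab (lam r : R) : 0 <= r -> r <= lam -> lam <= 1 ->
  (ball3 lam `*` `]- r ^+ 2, 0[ : set (mR4 R)) `<=` pcyl lam /\
  (pcyl lam : set (mR4 R)) `<=` Q.
Proof.
move=> r0 rl l1; have l0 := le_trans r0 rl.
split=> -[x t] [/= xl]; rewrite in_itv/= => /andP[tl t0]; split => /=; rewrite ?in_itv/= ?t0 ?andbT//.
- by apply: le_lt_trans tl; rewrite lerN2 ler_pXn2r ?nnegrE.
- exact: sub_ball3 l1 _ xl.
- by apply: le_lt_trans tl; rewrite lerN2 ler_pXn2r ?nnegrE.
Qed.

Lemma dissipation_ge0 (lam t : R) : 0 <= dissipation Dv lam t.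
Proof. by apply: Rintegral_ge0 => x _; exact: mxnorm2_ge0. Qed.

Lemma measurable_dissipation (lam r : R) : 0 <= r -> r <= lam -> lam <= 1 ->
  measurable_fun (`]- r ^+ 2, 0[%classic : set (mR1 R)) (dissipation Dv lam : mR1 R -> mR1 R).
Proof.
move=> r0 rl l1; have [s1 s2] := time_slab r0 rl l1.
apply: (measurableT_comp (f := fine)); first exact: fine_measurable.
apply: (measurable_pcyl_slices (f := fun z => mxnorm2 (Dv z))).
- exact: measurable_ball3.
- exact: subset_trans s1 s2.
- exact: measurable_mxnorm2 ve.
- by move=> z; exact: mxnorm2_ge0.
Qed.

Lemma integral_dissipation_le (lam r : R) : 0 <= r -> r <= lam -> lam <= 1 ->
  (\int[leb1]_(t in `](- r ^+ 2)%R, 0%R[) (dissipation Dv lam t)%:E <=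
   \int[leb4]_(z in pcyl lam) (mxnorm2 (Dv z))%:E)%E.
Proof.
move=> r0 rl l1; have [s1 s2] := time_slab r0 rl l1.
have mD := measurable_mxnorm2 ve.
have D0 z : 0 <= mxnorm2 (Dv z) by exact: mxnorm2_ge0.
apply: (@le_trans _ _ (\int[leb4]_(z in ball3 lam `*` `](- r ^+ 2)%R, 0%R[) (mxnorm2 (Dv z))%:E)%E).
  rewrite (integral_pcyl_slices (measurable_ball3 lam) (subset_trans s1 s2) mD D0).
  apply: ge0_le_integral => //.
  - by move=> t _; rewrite lee_fin dissipation_ge0.
  - by apply/measurable_EFinP; exact: measurable_dissipation.
  - exact: (measurable_pcyl_slices (measurable_ball3 lam) (subset_trans s1 s2) mD D0).
  (* The finite part of a nonnegative extended real is at most its value. *)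
  - move=> t _; rewrite /dissipation /Rintegral.
    have : (0 <= \int[leb3]_(x in ball3 lam) (mxnorm2 (Dv (x, t)))%:E)%E.
      by apply: integral_ge0 => x _; rewrite lee_fin.
    by case: (\int[leb3]_(x in _) _)%E => [y|//|//] _; rewrite ?leey.
apply: ge0_subset_integral => //.
- by apply: measurableX => //; exact: measurable_ball3.
- exact: measurable_pcyl.
- by apply/measurable_EFinP; apply: measurable_funS mD => //; exact: measurable_pcyl.
- by move=> z _; rewrite lee_fin.
Qed.

(** The interpolation is applied at almost every time with V = (2 r) ^ 3 and Y = g ^ 3, so that g
    enters with the power 3 c l / s. The term [D / r ^+ 2] comes from the mean of the dissipation
    over a time interval of length r ^ 2. *)
Lemma mixed_norm_le (lam r X D a b c s l : R) :
  0 < lam -> lam < 1 -> 0 < r -> r <= lam / 2 -> 0 < X -> 0 < D ->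
  {ae leb1, forall t : R, - lam ^+ 2 < t < 0 ->
    (\int[leb3]_(x in ball3 lam) (enorm (v (x, t)) ^+ 2)%:E <= X%:E)%E} ->
  (\int[leb4]_(z in pcyl lam) (mxnorm2 (Dv z))%:E <= D%:E)%E ->
  0 <= a -> 0 <= b -> 0 <= c -> a + b + c = 1 -> b * 2 + c * 6 = s -> 0 < s -> 0 < l ->
  3 * c * (l / s) <= 1 ->
  (\int[leb1]_(t in `](- r ^+ 2)%R, 0%R[)
      (\int[leb3]_(x in ball3 r) (enorm (v (x, t)) `^ s)%:E) `^ (l / s)
   <= ((((2 * r) ^+ 3) `^ a * X `^ b) `^ (l / s)
       * (384 * (X / lam ^+ 2 + D / r ^+ 2)) `^ (3 * c * (l / s)) * r ^+ 2)%:E)%E.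
Proof.
move=> l0 l1 r0 rl X0 D0 AX DX a0 b0 c0 abc bcs s0 lp tau1.
have ls0 : 0 <= l / s by rewrite divr_ge0 ?(ltW s0) ?(ltW lp).
have rlam : r <= lam by lra.
have r1 : r <= 1 by lra.
have S6 := ae_sixth_power ve vD l0 l1 r0 rl AX.
have K0 : 0 < 384 :> R by rewrite ltr0n.
move: (384 : R) K0 S6 => K K0 S6.
pose g t := K * (X / lam ^+ 2 + dissipation Dv lam t).
have Xl : 0 < X / lam ^+ 2 by rewrite divr_gt0 ?exprn_gt0.
have g0 t : 0 < g t by rewrite mulr_gt0// ltr_wpDr ?dissipation_ge0.
have slabE : leb1 `]- r ^+ 2, 0[%classic = (r ^+ 2)%:E.
  rewrite [LHS]lebesgue_measure_itv/= lte_fin oppr_lt0 exprn_gt0// -EFinB.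
  by rewrite sub0r opprK.
have [_ s2] := time_slab (ltW r0) (lexx r) r1.
have mv : measurable_fun Q (fun z => enorm (v z) `^ s).
  have [mv _ _ _] := ve.
  apply: (measurableT_comp (measurable_powR s)).
  exact: measurableT_comp measurable_enorm mv.
have md : measurable_fun (`]- r ^+ 2, 0[%classic : set (mR1 R)) (g : mR1 R -> mR1 R).
  apply: measurable_funM => //; apply: measurable_funD => //.
  exact: measurable_dissipation (ltW r0) rlam (ltW l1).
have G0 : 0 < K * (X / lam ^+ 2 + D / r ^+ 2).
  by rewrite mulr_gt0// addr_gt0// divr_gt0 ?exprn_gt0.
apply: (@integral_powR_tangent _ _ _ leb1 _ _ g _ _ _ (r ^+ 2)) => //.
- apply: (measurableT_comp (measurable_poweR (l / s))).
  apply: (measurable_pcyl_slices (f := fun z => enorm (v z) `^ s)) => //.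
  + exact: measurable_ball3.
  + by move=> z; exact: powR_ge0.
- by move=> t; exact: poweR_ge0.
- by rewrite tau1 mulr_ge0// mulr_ge0.
- exact: powR_ge0.
- by rewrite slabE.
- rewrite (eq_integral (fun t : mR1 R => K%:E * ((X / lam ^+ 2)%:E + (dissipation Dv lam t)%:E))%E)//.
  have mdE : measurable_fun (`]- r ^+ 2, 0[%classic : set (mR1 R))
      (fun t : mR1 R => (dissipation Dv lam t)%:E).
    by apply/measurable_EFinP; exact: measurable_dissipation (ltW r0) rlam (ltW l1).
  have d0 t : (0 <= (dissipation Dv lam t)%:E)%E by rewrite lee_fin dissipation_ge0.
  have x0 : (0 <= (X / lam ^+ 2)%:E)%E by rewrite lee_fin ltW.
  rewrite ge0_integralZl//; last 3 first.
  - exact: emeasurable_funD.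
  - by move=> t _; exact: adde_ge0.
  - by rewrite lee_fin ltW.
  rewrite ge0_integralD// integral_cst// slabE -mulrA [leRHS]EFinM lee_wpmul2l ?lee_fin ?(ltW K0)//.
  rewrite mulrDl divfK ?lt0r_neq0 ?exprn_gt0// EFinD EFinM leeD2l//.
  exact: le_trans (integral_dissipation_le (ltW r0) rlam (ltW l1)) DX.
- apply: ae_mono (ae_and AX S6) => t [AXt S6t]; rewrite /= in_itv/= => tI.
  have tIl : - lam ^+ 2 < t < 0.
    have /andP[tl ->] := tI; rewrite andbT; apply: le_lt_trans tl.
    by rewrite lerN2 ler_pXn2r ?nnegrE ?(ltW l0) ?(ltW r0) ?(ltW l1).
  have tI1 : - 1 ^+ 2 < t < 0.
    have /andP[tl ->] := tIl; rewrite andbT; apply: le_lt_trans tl.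
    by rewrite lerN2 ler_pXn2r ?nnegrE ?(ltW l0) ?(ltW r0) ?(ltW l1).
  have mB := @measurable_ball3 R.
  have mvt r' : r' <= 1 -> measurable_fun (ball3 r' : set (mR3 R)) (fun x => enorm (v (x, t))).
    by move=> r'1; exact: (measurable_enorm_slice ve r'1 tI1).
  have AXr : (\int[leb3]_(x in ball3 r) (enorm (v (x, t)) ^+ 2)%:E <= X%:E)%E.
    apply: le_trans (AXt tIl); apply: ge0_subset_integral => //.
    - by apply/measurable_EFinP; apply: measurable_funX; exact: mvt (ltW l1).
    - by move=> x _; rewrite lee_fin sqr_ge0.
    - exact: sub_ball3.
  have V0 : 0 < (2 * r) ^+ 3 by rewrite exprn_gt0// mulr_gt0.
  have Y0 : 0 < g t ^+ 3 by rewrite exprn_gt0.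
  have h := integral_powR_interpolation (mB r) (mvt r r1) (fun x => enorm_ge0 _) a0 b0 c0
    abc bcs s0 V0 X0 Y0 (leb3_ball3_le r0) AXr (S6t tI).
  have I0 : (\int[leb3]_(x in ball3 r) (enorm (v (x, t)) `^ s)%:E)%E \in `[0%E, +oo%E].
    by rewrite in_itv/= leey andbT; apply: integral_ge0 => x _; rewrite lee_fin powR_ge0.
  have Z0 : (((2 * r) ^+ 3) `^ a * X `^ b * (g t ^+ 3) `^ c)%:E \in `[0%E, +oo%E].
    by rewrite in_itv/= leey andbT lee_fin !mulr_ge0 ?powR_ge0.
  apply: (le_trans (gt0_ler_poweR ls0 I0 Z0 h)).
  rewrite poweR_EFin lee_fin powRM ?mulr_ge0 ?powR_ge0// ler_wpM2l ?powR_ge0//.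
  by rewrite -powRrM -(powR_mulrn 3 (ltW (g0 t))) -powRrM mulrA.
Qed.

End MixedNorm.

Lemma mixed_norm_power_le (R : realType) (v : spacetime R -> space3 R)
    (Dv : spacetime R -> 'M[R]_3) (q : spacetime R -> R) (m a b c s l : R) :
  energy_class v Dv q -> weak_gradient v Dv -> 0 < m < 1 ->
  (ereal_sup [set qA (2 * m - 1) v r + qE m Dv r + qD m q r
     | r in `]0%R, 1%R[%classic] < +oo)%E ->
  0 <= a -> 0 <= b -> 0 <= c -> a + b + c = 1 -> b * 2 + c * 6 = s -> 0 < s -> 0 < l ->
  3 * c * (l / s) <= 1 ->
  let A := 3 - m in
  exists2 C : R, 0 <= C & \forall r \near 0^'+,
    (\int[leb1]_(t in `](- r ^+ 2)%R, 0%R[)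
      (\int[leb3]_(x in ball3 r) (enorm (v (x, t)) `^ s)%:E) `^ (l / s)
     <= (C * r `^ ((3 * a + 2 / A * (2 * m - 1) * b) * (l / s)
                   + (2 / A * m - 2) * (3 * c * (l / s)) + 2))%:E)%E.
Proof.
move=> ve vD /andP[m0 m1] bd a0 b0 c0 abc bcs s0 l0 tau1 A.
have [M M0 bM] := uniform_bounds bd.
set k := l / s in tau1 *; set tau := 3 * c * k in tau1 *.
exists ((8 `^ a * M `^ b) `^ k * (768 * M) `^ tau).
  by rewrite mulr_ge0 ?powR_ge0.
have A2 : 2 < A by rewrite /A; lra.
have A0 : 0 < A by lra.
have An : A != 0 by rewrite lt0r_neq0.
(* As e A = 2, the radius lam = r ^ e satisfies lam ^ (3 - m) = r ^ 2, that is lam ^ (2 m - 1) / lam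
   ^ 2 = lam ^ m / r ^ 2. *)
pose e := 2 / A; pose d := 1 - e.
have e0 : 0 < e by rewrite divr_gt0.
have d0 : 0 < d by rewrite subr_gt0 ltr_pdivrMr// mul1r.
(* Below this threshold r ^ (1 - e) <= 1 / 2, which amounts to r <= lam / 2. *)
pose r0 := (2^-1 : R) `^ d^-1.
have r00 : 0 < r0 by rewrite powR_gt0.
near=> r.
have rp : 0 < r by near: r; exact: nbhs_right_gt.
have r1 : r < 1 by near: r; exact: nbhs_right_lt.
have rr0 : r < r0 by near: r; exact: nbhs_right_lt.
have pD x y : r `^ x * r `^ y = r `^ (x + y).
  by rewrite powRD// lt0r_neq0 ?implybT.
have pS K x y : 0 <= K -> (K * r `^ x) `^ y = K `^ y * r `^ (x * y).
  by move=> K0; rewrite powRM ?powR_ge0// -powRrM.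
have pn n : r ^+ n = r `^ n%:R by rewrite powR_mulrn ?ltW.
set lam := r `^ e.
have lp : 0 < lam by exact: powR_gt0.
have rd : r `^ d <= 2^-1.
  have -> : 2^-1 = r0 `^ d :> R by rewrite /r0 -powRrM mulVf ?lt0r_neq0// powRr1.
  by rewrite ge0_ler_powR ?nnegrE ?(ltW d0) ?(ltW rp) ?(ltW r00) ?(ltW rr0).
have rl : r <= lam / 2.
  have -> : r = lam * r `^ d by rewrite /lam pD /d subrKC powRr1 ?ltW.
  by rewrite ler_pM2l.
have l1 : lam < 1.
  rewrite (_ : 1 = 1 `^ e); last by rewrite powR1.
  by apply: gt0_ltr_powR; rewrite ?nnegrE ?(ltW rp).
have lE x : lam `^ x = r `^ (e * x) by rewrite /lam -powRrM.
have [AX DX] := bM lam (introT andP (conj lp l1)).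
have X0 : 0 < M * lam `^ (2 * m - 1) by rewrite mulr_gt0 ?powR_gt0.
have D0 : 0 < M * lam `^ m by rewrite mulr_gt0 ?powR_gt0.
apply: (le_trans (mixed_norm_le ve vD lp l1 rp rl X0 D0 AX DX a0 b0 c0 abc bcs s0 l0 tau1)).
rewrite lee_fin -/k -/tau.
have eA : e * A = 2 by rewrite /e divfK.
have XlE : M * lam `^ (2 * m - 1) / lam ^+ 2 = M * r `^ (e * m - 2).
  rewrite -(powR_mulrn 2 (ltW lp)) !lE -mulrA -powRN pD; congr (_ * _ `^ _).
  by move: eA; rewrite /A; lra.
have DrE : M * lam `^ m / r ^+ 2 = M * r `^ (e * m - 2).
  by rewrite pn lE -mulrA -powRN pD.
(* The two terms have become equal, so 384 doubles to 768. *)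
rewrite XlE DrE [X in _ * X `^ tau * _](_ : _ = 768 * M * r `^ (e * m - 2)); last by ring.
have -> : (2 * r) ^+ 3 = 8 * r `^ 3 by rewrite -pn; ring.
have M768 : 0 <= 768 * M by rewrite mulr_ge0 ?ler0n ?(ltW M0).
rewrite !lE (pS _ _ _ M768) (pS 8) ?ler0n// (pS M) ?(ltW M0)//.
rewrite (_ : 8 `^ a * r `^ (3 * a) * (M `^ b * r `^ (e * (2 * m - 1) * b)) =
  8 `^ a * M `^ b * r `^ (3 * a + e * (2 * m - 1) * b)); last by rewrite -pD; ring.
rewrite pS ?mulr_ge0 ?powR_ge0// pn -!pD.
by rewrite le_eqVlt; apply/orP; left; apply/eqP; ring.
Unshelve. all: by end_near.
Qed.

Theorem theorem2p1 (R : realType)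
  (v : spacetime R -> space3 R) (Dv : spacetime R -> 'M[R]_3)
  (q : spacetime R -> R)
  (m m1 s l kappa eta alpha m0 : R)
  (hsol : suitable_weak_solution v Dv q)
  (hm : 0 < m < 1)
  (m1E : m1 = 2 * m - 1)
  (hM1 : (ereal_sup [set qA m1 v r + qE m Dv r + qD m q r
                    | r in `]0%R, 1%R[%classic] < +oo)%E)
  (hs : 1 < s) (hl : 1 < l)
  (kappaE : kappa = l * (3 / s + 2 / l - 1))
  (hkappa : 0 < kappa < l)
  (heta : 0 <= eta <= 1)
  (hsp : s < p_eta eta) (hlq : l < q_eta eta)
  (alphaE : alpha = 2 - m)
  (hm0 : 0 < m0 <
     (3 * (alpha - 1) / 2 * (1 - s / p_eta eta) * (l / s)
      - (alpha * l - 3 * l / s - alpha - 1))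
     / ((alpha + 1) / 2 * kappa)) :
  qM0 s l kappa m0 v r @[r --> 0^'+] --> 0%E.
Proof.
have [vD ve _ _] := hsol.
have /andP[m_gt0 m_lt1] := hm; have /andP[k0 _] := hkappa.
have /andP[eta0 eta1] := heta.
have s0 : 0 < s by exact: lt_trans hs.
have l0 : 0 < l by exact: lt_trans hl.
have sP : s * (eta / 6 + 3 * (1 - eta) / 10) < 1.
  by move: hsp; rewrite /p_eta -[X in s < X]div1r ltr_pdivlMr//; lra.
have lQ : l * (eta / 2 + 3 * (1 - eta) / 10) < 1.
  by move: hlq; rewrite /q_eta -[X in l < X]div1r ltr_pdivlMr//; lra.
(* The exponents of [1], [|v| ^ 2] and [|v| ^ 6] in the interpolation of [|v| `^ s]. *)
pose a := 1 - s * (eta / 6 + 3 * (1 - eta) / 10).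
pose b := s * (1 - eta) / 5.
pose c := s * (10^-1 + eta / 15).
have a0 : 0 <= a by rewrite subr_ge0 ltW.
have b0 : 0 <= b by rewrite !mulr_ge0 ?subr_ge0 ?(ltW s0).
have c0 : 0 <= c by rewrite mulr_ge0 ?(ltW s0)//; lra.
have abc : a + b + c = 1 by rewrite /a /b /c; field.
have bcs : b * 2 + c * 6 = s by rewrite /b /c; field.
have sn : s != 0 by rewrite lt0r_neq0.
have tauE : 3 * c * (l / s) = l * (eta / 2 + 3 * (1 - eta) / 10).
  by rewrite /c; field.
have tau1 : 3 * c * (l / s) <= 1 by rewrite tauE ltW.
rewrite m1E in hM1.
have [C C0 near_le] := mixed_norm_power_le ve vD hm hM1 a0 b0 c0 abc bcs s0 l0 tau1.
pose E := (3 * a + 2 / (3 - m) * (2 * m - 1) * b) * (l / s)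
  + (2 / (3 - m) * m - 2) * (3 * c * (l / s)) + 2.
have A0 : 0 < 3 - m by lra.
have beta0 : 0 < E - kappa * m0.
  have /andP[_] := hm0; rewrite ltr_pdivlMr; last by rewrite mulr_gt0// alphaE; lra.
  (* Numerator and denominator of f(m) are (3 - m) / 2 times [E] and (3 - m) / 2 times kappa; the
     upper bound on m0 says exactly that kappa m0 < [E]. *)
  have -> : 3 * (alpha - 1) / 2 * (1 - s / p_eta eta) * (l / s)
      - (alpha * l - 3 * l / s - alpha - 1) = (3 - m) / 2 * E.
    rewrite /p_eta invrK -/a /E tauE alphaE /a /b; field.
    by rewrite sn lt0r_neq0.
  rewrite (_ : m0 * _ = (3 - m) / 2 * (kappa * m0)); last by rewrite alphaE; field.
  by rewrite ltr_pM2l ?subr_gt0// divr_gt0.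
have lim0 : (C * r `^ (E - kappa * m0))%:E @[r --> 0^'+] --> 0%E.
  apply: cvg_EFin; first exact: nearW.
  by rewrite -[0 in X in _ --> X](mulr0 C); exact: cvgM (cvg_cst C) (powR_cvg0 beta0).
apply: (squeeze_cvge _ (cvg_cst 0%E) lim0).
near=> r.
have rp : 0 < r by near: r; exact: nbhs_right_gt.
have I0 : (0 <= \int[leb1]_(t in `](- r ^+ 2)%R, 0%R[)
    (\int[leb3]_(x in ball3 r) (enorm (v (x, t)) `^ s)%:E) `^ (l / s))%E.
  by apply: integral_ge0 => t _; exact: poweR_ge0.
have Ir : (\int[leb1]_(t in `](- r ^+ 2)%R, 0%R[)
    (\int[leb3]_(x in ball3 r) (enorm (v (x, t)) `^ s)%:E) `^ (l / s)
    <= (C * r `^ E)%:E)%E.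
  by near: r.
rewrite /qM0 /qM; apply/andP; split.
  by rewrite !mule_ge0 ?lee_fin ?invr_ge0 ?powR_ge0.
(* The two normalizing powers of r, of exponents kappa (1 - m0) and -kappa, combine to the exponent
   -kappa m0. *)
rewrite muleA -EFinM -powRN -powRD; last by rewrite (lt0r_neq0 rp) implybT.
apply: (le_trans (lee_wpmul2l _ Ir)); first by rewrite lee_fin powR_ge0.
rewrite -EFinM lee_fin mulrCA -powRD; last by rewrite (lt0r_neq0 rp) implybT.
by rewrite (_ : _ + E = E - kappa * m0)//; ring.
Unshelve. all: by end_near.
Qed.
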